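(* Let $N\ge1$. (i) Let $-1\le\gamma<0$. There exists a $C^\infty$ function $u\in\dot W^{1,1}(\mathbb R^N)$ that is rapidly decreasing (i.e. $\sup_x|x|^k|u(x)|<\infty$ for every $k\ge0$) such that $\lim_{\lambda\to0^+}\lambda\,\nu_\gamma(E_{\lambda,\gamma}[u])=\infty$. (ii) Let $-1\le\gamma<0$. There exists a compactly supported $u\in W^{1,1}(\mathbb R^N)$ with $\lim_{\lambda\to0^+}\lambda\,\nu_\gamma(E_{\lambda,\gamma}[u])=\infty$. Moreover the set $\{u\in W^{1,1}(\mathbb R^N):\limsup_{\lambda\to0^+}\lambda\,\nu_\gamma(E_{\lambda,\gamma}[u])<\infty\}$ is meager (of first Baire category) in $W^{1,1}(\mathbb R^N)$. (iii) Suppose either $-1\le\gamma<0$ and $N\ge2$, or $-1<\gamma<0$ and $N=1$. There exists a compactly supported $u\in W^{1,1}(\mathbb R^N)$ such that $\nu_\gamma(E_{\lambda,\gamma}[u])=\infty$ for all $\lambda>0$. Moreover the set $\{u\in W^{1,1}(\mathbb R^N):\nu_\gamma(E_{\lambda,\gamma}[u])<\infty\text{ for some }\lambda\in(0,\infty)\}$ is meager in $W^{1,1}(\mathbb R^N)$.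
   Context: For $N\ge1$ and $\gamma\in\mathbb R$, $\nu_\gamma(E)=\iint_{(x,y)\in E,\,x\ne y}|x-y|^{\gamma-N}\,dx\,dy$ for measurable $E\subset\mathbb R^N\times\mathbb R^N$. For measurable $u$, $E_{\lambda,\gamma}[u]=\{(x,y):x\ne y,\ \frac{|u(x)-u(y)|}{|x-y|^{1+\gamma}}>\lambda\}$. $\dot W^{1,1}(\mathbb R^N)$: locally integrable functions with distributional gradient in $L^1$; $W^{1,1}(\mathbb R^N)=\dot W^{1,1}\cap L^1$ with norm $\|u\|_{L^1}+\|\nabla u\|_{L^1}$ (a Banach space). *)

(* Defs.v *)
(* R^N is modelled as N.-tuple R with the
   library's product (= Borel) sigma-algebra; Lebesgue integration on R^N is the
   N-fold iterated Lebesgue integral (Tonelli), since the library has no Lebesgue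
   measure on R^N. *)
From HB Require Import structures.
From mathcomp Require Import all_boot all_order all_algebra.
From mathcomp Require Import all_classical all_reals all_analysis.
Set Implicit Arguments. Unset Strict Implicit. Unset Printing Implicit Defensive.
Import Order.TTheory GRing.Theory Num.Theory.
Import numFieldNormedType.Exports.
Local Open Scope classical_set_scope.
Local Open Scope ring_scope.

Section Defs.
Context {R : realType}.

Definition tadd N (x y : N.-tuple R) : N.-tuple R := [tuple tnth x i + tnth y i | i < N].
Definition tsub N (x y : N.-tuple R) : N.-tuple R := [tuple tnth x i - tnth y i | i < N].
Definition enorm N (x : N.-tuple R) : R := Num.sqrt (\sum_(i < N) tnth x i ^+ 2).
Definition shift N (x : N.-tuple R) (i : 'I_N) (h : R) : N.-tuple R :=
  [tuple tnth x j + (if j == i then h else 0) | j < N].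

(* Lebesgue integral on R^N of a nonnegative (extended-real) function, as an
   iterated integral x_1, ..., x_N *)
Fixpoint tint (n : nat) : (n.-tuple R -> \bar R) -> \bar R :=
  match n with
  | 0 => fun f => f [tuple]
  | n'.+1 => fun f =>
      (\int[lebesgue_measure]_x tint (fun t : n'.-tuple R => f [tuple of (x : R) :: t]))%E
  end.

Definition Lint N (f : N.-tuple R -> R) : \bar R :=
  (tint (fun x => (Num.max (f x) 0%R)%:E) - tint (fun x => (Num.max (- f x)%R 0%R)%:E))%E.

Definition L1 N (f : N.-tuple R -> R) : Prop :=
  measurable_fun [set: N.-tuple R] f /\ (tint (fun x => (`|f x|)%:E) < +oo)%E.

Definition loc_integrable N (f : N.-tuple R -> R) : Prop :=
  measurable_fun [set: N.-tuple R] f /\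
  forall M : R, (tint (fun x => if (enorm x <= M)%R then (`|f x|)%:E else 0%E) < +oo)%E.

Definition has_pderiv N (i : 'I_N) (f g : N.-tuple R -> R) : Prop :=
  forall x, (fun h : R => (f (shift x i h) - f x) / h) @ (0 : R)^' --> g x.

Definition econt N (f : N.-tuple R -> R) : Prop :=
  forall x (e : R), 0 < e -> exists2 d : R, 0 < d &
    forall y, enorm (tsub y x) < d -> `|f y - f x| < e.

(* C^infinity: all iterated partial derivatives exist and are continuous;
   D s is the partial derivative along the word s *)
Definition smooth N (f : N.-tuple R -> R) : Prop :=
  exists D : seq 'I_N -> N.-tuple R -> R,
    [/\ D [::] = f, (forall s i, has_pderiv i (D s) (D (i :: s))) & (forall s, econt (D s))].

Definition compact_supp N (f : N.-tuple R -> R) : Prop :=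
  exists M : R, forall x, M < enorm x -> f x = 0.

Definition test_fun N (phi : N.-tuple R -> R) : Prop := smooth phi /\ compact_supp phi.

Definition weak_grad N (u : N.-tuple R -> R) (g : 'I_N -> N.-tuple R -> R) : Prop :=
  forall i phi dphi, test_fun phi -> has_pderiv i phi dphi ->
    Lint (fun x => u x * dphi x) = (- Lint (fun x => (g i x * phi x)%R))%E.

Definition Wdot11 N (u : N.-tuple R -> R) : Prop :=
  loc_integrable u /\ exists g, (forall i, L1 (g i)) /\ weak_grad u g.

Definition W11 N (u : N.-tuple R -> R) : Prop := L1 u /\ Wdot11 u.

Definition W11_ball N (u : N.-tuple R -> R) (r : R) : set (N.-tuple R -> R) :=
  [set v | W11 v /\ exists g, [/\ (forall i, L1 (g i)), weak_grad (fun x => v x - u x) g &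
     (tint (fun x => (`|v x - u x|%R)%:E) +
      tint (fun x => (Num.sqrt (\sum_(i < N) g i x ^+ 2)%R)%:E) < r%:E)%E]].

Definition W11_nowhere_dense N (A : set (N.-tuple R -> R)) : Prop :=
  forall u r, W11 u -> 0 < r -> exists v s,
    [/\ W11 v, 0 < s, W11_ball v s `<=` W11_ball u r & W11_ball v s `&` A = set0].

Definition W11_meager N (A : set (N.-tuple R -> R)) : Prop :=
  exists F : nat -> set (N.-tuple R -> R),
    (forall n, W11_nowhere_dense (F n)) /\ A `<=` \bigcup_n F n.

Definition rapidly_decreasing N (u : N.-tuple R -> R) : Prop :=
  forall k : nat, exists C : R, forall x, enorm x ^+ k * `|u x| <= C.

Definition nu N (gam : R) (E : set (N.-tuple R * N.-tuple R)) : \bar R :=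
  tint (fun x => tint (fun y =>
    if `[< E (x, y) /\ x <> y >] then (enorm (tsub x y) `^ (gam - N%:R))%:E else 0%E)).

Definition Elg N (u : N.-tuple R -> R) (lam gam : R) : set (N.-tuple R * N.-tuple R) :=
  [set p | p.1 <> p.2 /\ lam < `|u p.1 - u p.2| / enorm (tsub p.1 p.2) `^ (1 + gam)].

End Defs.

(* Main.v *)
(* A spike is phi(x) = a G((x_1 - tau)/r) prod_(i > 1) chi(x_i/r), where G rises as a smooth
   approximation of a Cantor function of ratio rho with rho^(1 + gamma) = 1/2 (a single steep
   step if gamma = -1).  At each of its generations the approximant contributes a fixed amount
   to nu_gamma(E_lam[phi]), because |phi(x) - phi(y)| is comparable to |x - y|^(1 + gamma) on a
   union of disjoint rectangles of that scale; so the mass grows linearly with the number of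
   generations while the W^{1,1} norm stays bounded.  Summing spikes with disjoint supports,
   tending to infinity for (i) and to a hyperplane for (ii) and (iii), gives the functions u.
   For the meager sets, either v or v + phi has large nu for every v, and a lower bound on nu
   that is carried by a bounded region away from the diagonal survives small L^1 perturbations. *)
Require Import Defs.
From HB Require Import structures.
From mathcomp Require Import all_boot all_order all_algebra.
From mathcomp Require Import all_classical all_reals all_analysis.
From mathcomp Require Import measurable_realfun ring lra.
Import Order.TTheory GRing.Theory Num.Theory.
Import numFieldNormedType.Exports.
Set Implicit Arguments.
Unset Strict Implicit.
Local Open Scope classical_set_scope.
Local Open Scope ring_scope.

(** * Lebesgue integration on tuples *)

Section TupleMeasure.
Context {R : realType}.
Notation leb := (@lebesgue_measure R).

(** In dimension N a spike of width r at level lam has height of order lam r^(1 + gam), so its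
    gradient costs at most a multiple of lam r^(N + gam) in L^1, while each generation of the
    approximant adds a multiple of r^(N + gam) to nu. The approximant rises monotonically from 0 to
    1, so its total variation does not depend on the number of generations; that number is chosen
    last and makes the mass as large as desired at no cost. The exponent N + gam decides what is
    available. If it is positive, shrinking r makes the norm small at any fixed lam, which gives
    infinite nu at every level. If it is 0, that is N = 1 and gam = -1, the norm is only controlled
    by lam, which still suffices as lam tends to 0. The kernel of each spike keeps a positive
    distance eta from the diagonal, but eta is not uniform; stability is therefore used for one
    spike at a time, inside a ball whose radius depends on eta. *)

Definition tcons n (z : measurableTypeR R * n.-tuple R) : n.+1.-tuple R :=
  [tuple of (z.1 : R) :: z.2].

Lemma measurable_tcons n : measurable_fun [set: (measurableTypeR R * n.-tuple R)%type] (@tcons n).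
Proof.
apply: (@measurable_cons _ _ _ _ (fun z : measurableTypeR R * n.-tuple R => z.1 : R)).
- exact: measurable_fst.
- exact: measurable_snd.
Qed.

Section ConsMeasure.
Variables (n : nat) (m2 : {sigma_finite_measure set (n.-tuple R) -> \bar R}).

Definition cons_measure : set (n.+1.-tuple R) -> \bar R :=
  pushforward (leb \x m2)%E (@tcons n).

Let cons_measure0 : cons_measure set0 = 0%E.
Proof. by rewrite /cons_measure /pushforward preimage_set0 measure0. Qed.

Let cons_measure_ge0 A : (0 <= cons_measure A)%E.
Proof. by rewrite /cons_measure /pushforward measure_ge0. Qed.

Let cons_measure_additive : semi_sigma_additive cons_measure.
Proof.
exact: (@measure_semi_sigma_additive _ _ _
  (measure_function_pushforward__canonical__measure_function_Measure
     (leb \x m2)%E (@measurable_tcons n))).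
Qed.

HB.instance Definition _ := isMeasure.Build _ _ _
  cons_measure cons_measure0 cons_measure_ge0 cons_measure_additive.

Let cons_measure_sigma_finite : sigma_finite setT cons_measure.
Proof.
have /sigma_finiteP[F [TF ndF Foo]] := sigma_finiteT leb.
have /sigma_finiteP[G [TG ndG Goo]] := sigma_finiteT m2.
(* [u] inverts [tcons], so preimages under [u] of products of exhausting sets exhaust the tuples. *)
pose u : n.+1.-tuple R -> measurableTypeR R * n.-tuple R :=
  fun t => (thead t, [tuple of behead t]).
have uK z : u (tcons z) = z.
  case: z => a t; rewrite /u /tcons theadE /=; congr pair; exact: val_inj.
have mu_ : measurable_fun setT u.
  apply/measurable_fun_pairP; split; first exact: (measurable_tnth ord0).
  exact: measurable_behead.
exists (fun k => u @^-1` (F k `*` G k)).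
  apply/esym/seteqP; split=> // t _.
  have [i _ Fi] : (\bigcup_i F i) (u t).1 by rewrite -TF.
  have [j _ Gj] : (\bigcup_i G i) (u t).2 by rewrite -TG.
  exists (maxn i j) => //; split.
  - by move: Fi; exact/subsetPset/ndF/leq_maxl.
  - by move: Gj; exact/subsetPset/ndG/leq_maxr.
move=> k; have [mF Fk] := Foo k; have [mG Gk] := Goo k; split.
  by rewrite -[X in measurable X]setTI; apply: mu_ => //; exact: measurableX.
rewrite /cons_measure /pushforward -comp_preimage.
rewrite (_ : u \o @tcons n = id); last by apply/funext => z /=; rewrite uK.
by rewrite preimage_id product_measure1E// lte_mul_pinfty// ge0_fin_numE.
Qed.

HB.instance Definition _ := @Measure_isSigmaFinite.Build _ _ _
  cons_measure cons_measure_sigma_finite.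

End ConsMeasure.

(** By induction on the dimension: Tonelli turns the integral against the image measure back into
    the iterated integral. Sigma-finiteness is carried along because the next product needs it.
    Linearity, monotonicity and dominated convergence for [tint] are all inherited from this
    measure. *)
Lemma tint_measure_exists n :
  exists mu : {sigma_finite_measure set (n.-tuple R) -> \bar R},
    forall f : n.-tuple R -> \bar R, measurable_fun [set: n.-tuple R] f ->
      (forall x, 0 <= f x)%E -> tint f = (\int[mu]_x f x)%E.
Proof.
elim: n => [|n [m2 Hm2]].
  exists (@dirac _ (0.-tuple R) [tuple] R) => f mf f0 /=.
  by rewrite integral_dirac// diracT mul1e.
exists (cons_measure m2) => f mf f0 /=.
rewrite (ge0_integral_pushforward (@measurable_tcons n))//=.
rewrite preimage_setT fubini_tonelli1//=; last first.
  exact: (measurableT_comp mf (@measurable_tcons n)).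
apply: eq_integral => x _; rewrite /fubini_F /= Hm2//.
exact: (measurableT_comp mf (measurable_cons (measurable_cst x) (@measurable_id _ _ _))).
Qed.

Definition lebn n : {sigma_finite_measure set (n.-tuple R) -> \bar R} :=
  sval (cid (tint_measure_exists n)).

Lemma tintE n (f : n.-tuple R -> \bar R) : measurable_fun [set: n.-tuple R] f ->
  (forall x, 0 <= f x)%E -> tint f = (\int[lebn n]_x f x)%E.
Proof. by move=> mf f0; rewrite (svalP (cid (tint_measure_exists n))). Qed.

Lemma tint_ge0 n (f : n.-tuple R -> \bar R) : (forall x, 0 <= f x)%E -> (0 <= tint f)%E.
Proof.
elim: n f => [|n IH] f f0 //=.
by apply: integral_ge0 => x _; exact: IH.
Qed.

Lemma eq_tint n (f g : n.-tuple R -> \bar R) : f =1 g -> tint f = tint g.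
Proof. by move=> /funext ->. Qed.

Lemma le_tint n (f g : n.-tuple R -> \bar R) :
  measurable_fun [set: n.-tuple R] f -> measurable_fun [set: n.-tuple R] g ->
  (forall x, 0 <= f x)%E -> (forall x, f x <= g x)%E -> (tint f <= tint g)%E.
Proof.
move=> mf mg f0 fg; have g0 x : (0 <= g x)%E by exact: le_trans (fg x).
by rewrite !tintE//; apply: ge0_le_integral.
Qed.

Lemma tintD n (f g : n.-tuple R -> \bar R) :
  measurable_fun [set: n.-tuple R] f -> measurable_fun [set: n.-tuple R] g ->
  (forall x, 0 <= f x)%E -> (forall x, 0 <= g x)%E ->
  tint (fun x => f x + g x)%E = (tint f + tint g)%E.
Proof.
move=> mf mg f0 g0; rewrite !tintE//; last 2 first.
- exact: emeasurable_funD.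
- by move=> x; exact: adde_ge0.
exact: ge0_integralD.
Qed.

Lemma tintZ n (k : R) (f : n.-tuple R -> \bar R) : 0 <= k ->
  measurable_fun [set: n.-tuple R] f -> (forall x, 0 <= f x)%E ->
  tint (fun x => k%:E * f x)%E = (k%:E * tint f)%E.
Proof.
move=> k0 mf f0; rewrite !tintE//; last 2 first.
- exact: measurable_funeM.
- by move=> x; rewrite mule_ge0// lee_fin.
exact: ge0_integralZl_EFin.
Qed.

Lemma tint_sum n (I : Type) (s : seq I) (f : I -> n.-tuple R -> \bar R) :
  (forall i, measurable_fun [set: n.-tuple R] (f i)) ->
  (forall i x, 0 <= f i x)%E ->
  tint (fun x => \sum_(i <- s) f i x)%E = (\sum_(i <- s) tint (f i))%E.
Proof.
move=> mf f0; rewrite tintE//; last 2 first.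
- exact: emeasurable_sum.
- by move=> x; exact: sume_ge0.
by rewrite ge0_integral_sum//; apply: eq_bigr => i _; rewrite tintE.
Qed.

Lemma tint_prod n (f : 'I_n -> R -> R) (I : 'I_n -> R) :
  (forall i, measurable_fun [set: R] (f i)) -> (forall i x, 0 <= f i x) ->
  (forall i, (\int[leb]_x (f i x)%:E)%E = (I i)%:E) ->
  tint (fun x : n.-tuple R => (\prod_(i < n) f i (tnth x i))%:E) = (\prod_(i < n) I i)%:E.
Proof.
elim: n f I => [|n IH] f I mf f0 fI; first by rewrite /= !big_ord0.
have Ige0 i : 0 <= I i.
  by rewrite -lee_fin -fI; apply: integral_ge0 => x _; rewrite lee_fin.
have mp : measurable_fun [set: n.-tuple R]
    (fun t : n.-tuple R => (\prod_(i < n) f (lift ord0 i) (tnth t i))%:E).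
  apply/measurable_EFinP; apply: measurable_prod => i _.
  exact: (measurableT_comp (mf _) (measurable_tnth i)).
rewrite /= (eq_integral (fun x : measurableTypeR R =>
    (f ord0 x)%:E * (\prod_(i < n) I (lift ord0 i))%:E)%E).
  rewrite ge0_integralZr//=.
  - by rewrite fI big_ord_recl.
  - by apply/measurable_EFinP; exact: (mf ord0).
  - by move=> x _; rewrite lee_fin.
  - by rewrite lee_fin prodr_ge0.
move=> x _; rewrite -(IH (fun i => f (lift ord0 i)) (fun i => I (lift ord0 i)))//.
rewrite -tintZ//; last by move=> t; rewrite lee_fin prodr_ge0.
apply: eq_tint => t; rewrite big_ord_recl EFinM (tnth_nth 0)/=; congr (_ * _%:E)%E.
by apply: eq_bigr => i _; rewrite !(tnth_nth 0).
Qed.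

(** The form in which [nu] integrates; [dintE] gives access to the product measure for measurable
    integrands. *)
Definition dint n (F : n.-tuple R * n.-tuple R -> \bar R) : \bar R :=
  tint (fun x => tint (fun y => F (x, y))).

Lemma measurable_tint_section n (F : n.-tuple R * n.-tuple R -> \bar R) :
  measurable_fun [set: (n.-tuple R * n.-tuple R)%type] F -> (forall z, 0 <= F z)%E ->
  measurable_fun [set: n.-tuple R] (fun x => tint (fun y => F (x, y))).
Proof.
move=> mF F0.
rewrite (_ : (fun x => _) = fubini_F (lebn n) F).
  exact: measurable_fun_fubini_tonelli_F.
apply/funext => x; rewrite tintE//.
exact: (measurableT_comp mF (measurable_pair1 x)).
Qed.

Lemma dintE n (F : n.-tuple R * n.-tuple R -> \bar R) :
  measurable_fun [set: (n.-tuple R * n.-tuple R)%type] F -> (forall z, 0 <= F z)%E ->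
  dint F = (\int[lebn n \x lebn n]_z F z)%E.
Proof.
move=> mF F0; rewrite /dint tintE; last 2 first.
- exact: measurable_tint_section.
- by move=> x; exact: tint_ge0.
rewrite fubini_tonelli1//; apply: eq_integral => x _; rewrite /fubini_F tintE//.
exact: (measurableT_comp mF (measurable_pair1 x)).
Qed.

Lemma le_dint n (F G : n.-tuple R * n.-tuple R -> \bar R) :
  measurable_fun [set: (n.-tuple R * n.-tuple R)%type] F ->
  measurable_fun [set: (n.-tuple R * n.-tuple R)%type] G ->
  (forall z, 0 <= F z)%E -> (forall z, F z <= G z)%E -> (dint F <= dint G)%E.
Proof.
move=> mF mG F0 FG; have G0 x : (0 <= G x)%E by exact: le_trans (FG x).
by rewrite !dintE//; apply: ge0_le_integral.
Qed.

Lemma dintD n (F G : n.-tuple R * n.-tuple R -> \bar R) :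
  measurable_fun [set: (n.-tuple R * n.-tuple R)%type] F ->
  measurable_fun [set: (n.-tuple R * n.-tuple R)%type] G ->
  (forall z, 0 <= F z)%E -> (forall z, 0 <= G z)%E ->
  dint (fun z => F z + G z)%E = (dint F + dint G)%E.
Proof.
move=> mF mG F0 G0; rewrite !dintE//; last 2 first.
- exact: emeasurable_funD.
- by move=> z; exact: adde_ge0.
exact: ge0_integralD.
Qed.

Lemma dint_sum n (I : Type) (s : seq I) (F : I -> n.-tuple R * n.-tuple R -> \bar R) :
  (forall i, measurable_fun [set: (n.-tuple R * n.-tuple R)%type] (F i)) ->
  (forall i z, 0 <= F i z)%E ->
  dint (fun z => \sum_(i <- s) F i z)%E = (\sum_(i <- s) dint (F i))%E.
Proof.
move=> mF F0; rewrite dintE//; last 2 first.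
- exact: emeasurable_sum.
- by move=> z; exact: sume_ge0.
by rewrite ge0_integral_sum//; apply: eq_bigr => i _; rewrite dintE.
Qed.

Lemma L1P n (f : n.-tuple R -> R) :
  L1 f <-> (lebn n).-integrable [set: n.-tuple R] (EFin \o f).
Proof.
split=> [[mf foo]|/integrableP[mf foo]].
  apply/integrableP; split; first exact/measurable_EFinP.
  rewrite -tintE//; apply: measurableT_comp => //; exact/measurable_EFinP.
have {}mf : measurable_fun [set: n.-tuple R] f by exact/measurable_EFinP.
split => //; rewrite tintE//.
by apply/measurable_EFinP; exact: measurableT_comp.
Qed.

Lemma LintE n (f : n.-tuple R -> R) : measurable_fun [set: n.-tuple R] f ->
  Lint f = (\int[lebn n]_x (f x)%:E)%E.
Proof.
move=> mf; rewrite /Lint integralE !tintE.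
- by congr (_ - _)%E; apply: eq_integral => x _; rewrite ?funeposE ?funenegE EFin_max.
- by apply/measurable_EFinP; apply: measurable_maxr => //; exact: measurable_funN.
- by move=> x; rewrite lee_fin le_max lexx orbT.
- by apply/measurable_EFinP; exact: measurable_maxr.
- by move=> x; rewrite lee_fin le_max lexx orbT.
Qed.

End TupleMeasure.

(** * Euclidean continuity *)

Section EContinuity.
Context {R : realType}.

Lemma enorm_ge0 n (x : n.-tuple R) : 0 <= enorm x.
Proof. exact: sqrtr_ge0. Qed.

Lemma tnth_tsub n (x y : n.-tuple R) i : tnth (tsub x y) i = tnth x i - tnth y i.
Proof. by rewrite tnth_mktuple. Qed.

Lemma tnth_shift n (x : n.-tuple R) i h j :
  tnth (Defs.shift x i h) j = tnth x j + (if j == i then h else 0).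
Proof. by rewrite tnth_mktuple. Qed.

Lemma tnth_le_enorm n (x : n.-tuple R) i : `|tnth x i| <= enorm x.
Proof.
rewrite -sqrtr_sqr ler_wsqrtr// (bigD1 i)//= lerDl.
by apply: sumr_ge0 => j _; exact: sqr_ge0.
Qed.

Lemma enorm_le n (x : n.-tuple R) c : 0 <= c -> (forall i, `|tnth x i| <= c) ->
  enorm x <= Num.sqrt n%:R * c.
Proof.
move=> c0 xc; rewrite -[c in leRHS]ger0_norm// -sqrtr_sqr -sqrtrM ?ler0n//.
rewrite ler_wsqrtr// (@le_trans _ _ (\sum_(i < n) c ^+ 2))//.
  by apply: ler_sum => i _; rewrite -real_normK ?num_real// ler_sqr ?nnegrE.
by rewrite sumr_const card_ord mulr_natl.
Qed.

(** The Euclidean and the sup norm differ by a factor of at most sqrt n. Through this equivalence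
    the algebra of continuous functions and the compactness of boxes carry over to [econt]. *)
Lemma econtP n (f : n.-tuple R -> R) :
  econt f <-> continuous (fun v : 'rV[R]_n => f [tuple v ord0 i | i < n]).
Proof.
have rowK (x : n.-tuple R) : [tuple (\row_i tnth x i) ord0 j | j < n] = x.
  by apply: eq_from_tnth => i; rewrite tnth_mktuple mxE.
split=> [cf v|cf x e e0].
  apply/(@cvgrPdist_lt _ _ _ _ (nbhs_filter v)) => e e0.
  have [d d0 Hd] := cf [tuple v ord0 i | i < n] e e0.
  (* Adding 1 keeps the denominator positive for n = 0 and makes sqrt n * c < d strict. *)
  pose c := d / (Num.sqrt n%:R + 1).
  have s0 : 0 < Num.sqrt n%:R + 1 :> R by rewrite ltr_wpDl// sqrtr_ge0.
  have c0 : 0 < c by rewrite divr_gt0.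
  apply/nbhs_ballP; exists c => //= w vw; rewrite distrC; apply: Hd.
  apply: (@le_lt_trans _ _ (Num.sqrt n%:R * c)).
    apply: enorm_le (ltW c0) _ => i; rewrite tnth_tsub !tnth_mktuple distrC.
    by case: vw => _ vw; apply: ltW; exact: (vw ord0 i).
  by rewrite -[ltRHS](divfK (lt0r_neq0 s0)) mulrC ltr_pM2l// ltrDl.
have /(@cvgrPdist_lt _ _ _ _ (nbhs_filter (\row_i tnth x i)))/(_ e e0)/nbhs_ballP[d/= d0 Hd] := cf (\row_i tnth x i).
exists d => // y xy; have := Hd (\row_i tnth y i); rewrite !rowK distrC; apply.
split=> // i j; rewrite !mxE /ball/= distrC -tnth_tsub.
exact: le_lt_trans (tnth_le_enorm _ _) xy.
Qed.

Lemma econt_cst n (c : R) : econt (fun _ : n.-tuple R => c).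
Proof. by apply/econtP => v; exact: cst_continuous. Qed.

Lemma econtD n (f g : n.-tuple R -> R) :
  econt f -> econt g -> econt (fun x => f x + g x).
Proof. by move=> /econtP cf /econtP cg; apply/econtP => v; exact: continuousD (cf v) (cg v). Qed.

Lemma econtM n (f g : n.-tuple R -> R) :
  econt f -> econt g -> econt (fun x => f x * g x).
Proof. by move=> /econtP cf /econtP cg; apply/econtP => v; exact: continuousM (cf v) (cg v). Qed.

Lemma econt_sum n (I : Type) (s : seq I) (P : pred I) (f : I -> n.-tuple R -> R) :
  (forall i, P i -> econt (f i)) -> econt (fun x => \sum_(i <- s | P i) f i x).
Proof.
move=> cf; rewrite (_ : (fun x => _) = \sum_(i <- s | P i) f i).
  by elim/big_ind : _ => //; [exact: econt_cst|move=> *; exact: econtD].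
by apply/funext => x; rewrite fct_sumE.
Qed.

Lemma econt_prod n (I : Type) (s : seq I) (P : pred I) (f : I -> n.-tuple R -> R) :
  (forall i, P i -> econt (f i)) -> econt (fun x => \prod_(i <- s | P i) f i x).
Proof.
move=> cf; elim: s => [|i s IH].
  by by rewrite (_ : (fun x => _) = cst 1); [exact: econt_cst|apply/funext => x; rewrite big_nil].
case: (boolP (P i)) => Pi.
  rewrite (_ : (fun x => _) = (fun x => f i x * \prod_(i <- s | P i) f i x)).
    exact: econtM (cf _ Pi) IH.
  by apply/funext => x; rewrite big_cons Pi.
rewrite (_ : (fun x => _) = (fun x => \prod_(i <- s | P i) f i x))//.
by apply/funext => x; rewrite big_cons (negbTE Pi).
Qed.

Lemma econt_coord n (h : R -> R) (i : 'I_n) :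
  continuous h -> econt (fun x : n.-tuple R => h (tnth x i)).
Proof.
move=> ch; apply/econtP.
rewrite (_ : (fun v => _) = (fun v : 'rV[R]_n => h (v ord0 i))); last first.
  by apply/funext => v; rewrite tnth_mktuple.
move=> v.
apply: (@continuous_comp _ _ _ (fun w : 'rV[R]_n => w ord0 i) h v); last exact: ch.
exact: coord_continuous.
Qed.

Lemma econt_section n (f : n.+1.-tuple R -> R) (a : R) :
  econt f -> econt (fun t : n.-tuple R => f [tuple of a :: t]).
Proof.
move=> cf t e e0; have [d d0 Hd] := cf [tuple of a :: t] e e0.
exists d => // s st; apply: Hd; apply: le_lt_trans st.
rewrite /enorm big_ord_recl tnth_tsub !(tnth_nth 0)/= subrr expr0n/= add0r.
rewrite le_eqVlt; apply/orP; left; apply/eqP; congr Num.sqrt; apply: eq_bigr => i _.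
by rewrite !tnth_tsub !(tnth_nth 0).
Qed.

Lemma econt_bounded n (f : n.-tuple R -> R) : econt f -> compact_supp f ->
  exists2 B, 0 <= B & forall x, `|f x| <= B.
Proof.
move=> /econtP cf [M fM].
have cK := @rV_compact R n (fun=> `[(- M), M]%classic) (fun=> @segment_compact _ _ _).
have /compact_bounded[B [_ HB]] :=
  continuous_compact (continuous_subspaceT cf) cK.
exists (Num.max 0 (B + 1)); first by rewrite le_max lexx.
move=> x; have [/fM ->|xM] := ltP M (enorm x); first by rewrite normr0 le_max lexx.
rewrite le_max; apply/orP; right; apply: (HB (B + 1)); first by rewrite ltrDl.
exists (\row_i tnth x i) => /=.
  move=> i; rewrite mxE in_itv/= -ler_norml.
  exact: le_trans (tnth_le_enorm _ _) xM.
by congr f; apply: eq_from_tnth => i; rewrite tnth_mktuple mxE.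
Qed.

(* [f] is the pointwise limit of its values at the points of the grid (1/(k+1)) Z^n. *)
Lemma econt_measurable n (f : n.-tuple R -> R) :
  econt f -> measurable_fun [set: n.-tuple R] f.
Proof.
move=> cf.
pose g (k : nat) (z : n.-tuple int) : n.-tuple R := [tuple (tnth z i)%:~R / k.+1%:R | i < n].
pose fl (k : nat) (x : n.-tuple R) : n.-tuple int :=
  [tuple Num.floor (tnth x i * k.+1%:R) | i < n].
apply: (@measurable_fun_cvg _ _ _ _ (fun k => f \o g k \o fl k)).
  move=> k _ Y mY; rewrite setTI.
  rewrite (_ : _ @^-1` Y = \bigcup_(z in setT)
      (if `[< Y (f (g k z)) >] then
        \bigcap_(i in setT) ((fun x => tnth x i) @^-1`
          `[(tnth z i)%:~R / k.+1%:R, (tnth z i + 1)%:~R / k.+1%:R[%classic)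
       else set0)); last first.
    apply/seteqP; split=> x /=.
      move=> Yx; exists (fl k x) => //; rewrite asboolT// => i _ /=.
      rewrite tnth_mktuple in_itv/= ler_pdivrMr ?ltr0n// ltr_pdivlMr ?ltr0n//.
      exact: floor_itv.
    move=> [z _]; case: ifPn => // /asboolP Yz xz.
    rewrite (_ : fl k x = z)//; apply: eq_from_tnth => i; rewrite tnth_mktuple.
    have := xz i Logic.I; rewrite /= in_itv/= ler_pdivrMr ?ltr0n// ltr_pdivlMr ?ltr0n//.
    by move/floor_def.
  apply: countable_bigcupT_measurable => // z; case: ifPn => // _.
  apply: fin_bigcap_measurable => // i _; rewrite -[X in measurable X]setTI.
  exact: (measurable_tnth i).
move=> x _; apply/cvgrPdist_lt => e e0.
have [d d0 Hd] := cf x e e0.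
near=> k; rewrite distrC; apply: Hd.
apply: (@le_lt_trans _ _ (Num.sqrt n%:R * k.+1%:R^-1)).
  apply: enorm_le => // i; rewrite tnth_tsub !tnth_mktuple.
  have /andP[h1 h2] := floor_itv (tnth x i * k.+1%:R).
  rewrite intrD in h2.
  have K0 : 0 < k.+1%:R :> R by rewrite ltr0n.
  rewrite -[X in _ - X](mulfK (lt0r_neq0 K0)) -mulrBl normrM.
  rewrite [X in _ * X]gtr0_norm ?invr_gt0//.
  apply: ler_piMl; first by rewrite invr_ge0 ltW.
  rewrite ler_norml; apply/andP; split; lra.
rewrite ltr_pdivrMr ?ltr0n// mulrC -ltr_pdivrMr//.
apply: (@lt_trans _ _ k%:R); last by rewrite ltr_nat.
by near: k; exact: nbhs_infty_gtr.
Unshelve. all: by end_near. Qed.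

End EContinuity.

(** * Integration by parts *)

Section IntegrationByParts.
Context {R : realType}.
Notation leb := (@lebesgue_measure R).

Lemma is_derive1P (f : R -> R) (x l : R) :
  is_derive x 1 f l <-> (fun h : R => (f (x + h) - f x) / h) @ (0 : R)^' --> l.
Proof.
rewrite (_ : (fun h => _) = (fun h : R => h^-1 *: (f (h *: 1 + x) - f x))); last first.
  by apply/funext => h; rewrite /GRing.scale/= mulr1 mulrC (addrC h).
split=> [[df <-]|dl]; first exact: df.
apply: DeriveDef; first by apply/cvg_ex; exists l.
exact: cvg_lim dl.
Qed.

Lemma is_derive1_continuous (F f : R -> R) : (forall x : R, is_derive x 1 F (f x)) -> continuous F.
Proof.
move=> dF x; apply: differentiable_continuous; apply/derivable1_diffP.
exact: (@ex_derive _ _ _ _ _ _ _ (dF x)).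
Qed.

Lemma ftc_itv (F f : R -> R) a b : a < b -> (forall x : R, is_derive x 1 F (f x)) -> continuous f ->
  (\int[leb]_(x in `[a, b]) (f x)%:E = (F b - F a)%:E)%E.
Proof.
move=> ab dF cf; have cF := is_derive1_continuous dF.
rewrite (continuous_FTC2 ab (F := F))//.
- exact: continuous_subspaceT.
- split; last 2 first.
  + by apply: cvg_at_right_filter; exact: cF.
  + by apply: cvg_at_left_filter; exact: cF.
  by move=> x _; exact: (@ex_derive _ _ _ _ _ _ _ (dF x)).
- by move=> x _; rewrite derive1E (@derive_val _ _ _ _ _ _ _ (dF x)).
Qed.

Lemma integral_supp_itv (f : R -> \bar R) a b : (forall x, x \notin `[a, b] -> f x = 0%E) ->
  (\int[leb]_x f x = \int[leb]_(x in `[a, b]) f x)%E.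
Proof.
move=> f0; rewrite [RHS]integral_mkcond; apply: eq_integral => x _.
rewrite patchE; case: ifPn => // /negP xab; rewrite f0//.
by apply/negP => h; apply: xab; rewrite inE.
Qed.

Lemma integral_is_derive_supp (F f : R -> R) M :
  (forall x : R, is_derive x 1 F (f x)) -> continuous f ->
  (forall x, M < `|x| -> F x = 0) -> (forall x, M < `|x| -> f x = 0) ->
  (\int[leb]_x (f x)%:E = 0)%E.
Proof.
move=> dF cf F0 f0; pose K := `|M| + 1.
have MK : M < K by rewrite (le_lt_trans (ler_norm _))// ltrDl.
have K0 : 0 < K by rewrite ltr_wpDl.
rewrite (@integral_supp_itv _ (- K) K).
  rewrite (ftc_itv (F := F))//; last by rewrite gtrN.
  by rewrite !F0 ?subrr// ?normrN gtr0_norm.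
move=> x; rewrite in_itv/= -ler_norml -ltNge => Kx.
by rewrite f0// (lt_trans MK).
Qed.

Lemma integral_cst_itv (a b c : R) : a <= b ->
  (\int[leb]_x (if x \in `[a, b] then c else 0)%:E = (c * (b - a))%:E)%E.
Proof.
move=> ab; rewrite (@integral_supp_itv _ a b); last by move=> x /negbTE ->.
rewrite (eq_integral (cst c%:E)); last by move=> x; rewrite inE/= => ->.
rewrite integral_cst//= lebesgue_measure_itv/= lte_fin EFinM.
by case: ltgtP ab => // -> _; rewrite subrr.
Qed.

Lemma measurable_cst_itv (a b c : R) :
  measurable_fun [set: R] (fun x => if x \in `[a, b] then c else 0).
Proof.
rewrite (_ : (fun x => _) = (fun x => c * \1_(`[a, b]%classic) x)).
  by apply: measurable_funM.
apply/funext => x; rewrite indicE mem_setE.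
by case: (x \in `[a, b]); rewrite ?mulr1 ?mulr0.
Qed.

Lemma tint_box n (lo hi : 'I_n -> R) (c : R) : 0 <= c -> (forall i, lo i <= hi i) ->
  tint (fun x : n.-tuple R =>
    (c * \prod_(i < n) (if tnth x i \in `[lo i, hi i] then 1 else 0))%:E) =
  (c * \prod_(i < n) (hi i - lo i))%:E.
Proof.
move=> c0 lohi.
under eq_tint do rewrite EFinM.
have mp : measurable_fun [set: n.-tuple R]
   (fun x => (\prod_(i < n) (if tnth x i \in `[lo i, hi i] then 1 else 0) : R)%:E).
  apply/measurable_EFinP; apply: measurable_prod => i _.
  exact: (measurableT_comp (@measurable_cst_itv (lo i) (hi i) 1) (measurable_tnth i)).
rewrite tintZ//; last first.
  by move=> x; rewrite lee_fin prodr_ge0// => i _; case: ifP.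
rewrite (@tint_prod _ n (fun i r => if r \in `[lo i, hi i] then 1 else 0) (fun i => hi i - lo i))//.
- by move=> i; exact: measurable_cst_itv.
- by move=> i x; case: ifP.
- by move=> i; rewrite integral_cst_itv// mul1r.
Qed.

Lemma L1_bounded_supp n (f : n.-tuple R -> R) B : measurable_fun [set: n.-tuple R] f ->
  (forall x, `|f x| <= B) -> compact_supp f -> L1 f.
Proof.
move=> mf fB [M fM]; split=> //.
pose c := `|B|; pose K := `|M|.
have mb : measurable_fun [set: n.-tuple R] (fun x : n.-tuple R =>
    (c * \prod_(i < n) (if tnth x i \in `[- K, K] then 1 else 0))%:E).
  apply/measurable_EFinP; apply: measurable_funM => //.
  apply: measurable_prod => i _.
  exact: (measurableT_comp (@measurable_cst_itv (-K) K 1) (measurable_tnth i)).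
apply: (@le_lt_trans _ _ (tint (fun x : n.-tuple R =>
    (c * \prod_(i < n) (if tnth x i \in `[- K, K] then 1 else 0))%:E))).
  apply: le_tint => // [|x]; rewrite ?lee_fin//.
    by apply/measurable_EFinP; exact: measurableT_comp.
  have p0 : 0 <= \prod_(i < n) (if tnth x i \in `[- K, K] then 1 else 0) :> R.
    by rewrite prodr_ge0// => i _; case: ifP.
  have [/fM ->|xM] := ltP M (enorm x); first by rewrite normr0 mulr_ge0 /c.
  rewrite big1 ?mulr1; first by rewrite (le_trans (fB x))// ler_norm.
  move=> i _; rewrite in_itv/= -ler_norml.
  by rewrite (le_trans (tnth_le_enorm _ _) (le_trans xM _))// ler_norm.
by rewrite (@tint_box n (fun=> - K) (fun=> K)) ?ltry// /c /K// => _; rewrite ge0_cp.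
Qed.

Lemma L1_econt n (f : n.-tuple R -> R) : econt f -> compact_supp f -> L1 f.
Proof.
move=> cf sf; have [B _ fB] := econt_bounded cf sf.
exact: L1_bounded_supp (econt_measurable cf) fB sf.
Qed.

Lemma enorm_cons n (x : R) (t : n.-tuple R) : enorm t <= enorm [tuple of x :: t].
Proof.
rewrite /enorm big_ord_recl ler_wsqrtr// (_ : \sum_(i < n) tnth [tuple of x :: t] (lift ord0 i) ^+ 2 = \sum_(i < n) tnth t i ^+ 2) ?lerDr ?sqr_ge0//.
by apply: eq_bigr => i _; rewrite !(tnth_nth 0).
Qed.

Lemma compact_supp_section n (f : n.+1.-tuple R -> R) (a : R) :
  compact_supp f -> compact_supp (fun t : n.-tuple R => f [tuple of a :: t]).
Proof. by move=> [M fM]; exists M => t Mt; apply: fM; exact: lt_le_trans (enorm_cons _ _). Qed.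

Lemma shift_cons0 n (x h : R) (t : n.-tuple R) :
  Defs.shift [tuple of x :: t] ord0 h = [tuple of x + h :: t].
Proof.
apply: eq_from_tnth => j; rewrite tnth_shift !(tnth_nth 0).
by case: j => -[|j] jn //=; rewrite addr0.
Qed.

Lemma shift_consS n (x h : R) (t : n.-tuple R) i :
  Defs.shift [tuple of x :: t] (lift ord0 i) h = [tuple of x :: Defs.shift t i h].
Proof.
apply: eq_from_tnth => j; rewrite tnth_shift.
have [k ->|->] := unliftP ord0 j; last by rewrite !(tnth_nth 0)/= addr0.
rewrite (inj_eq lift_inj).
have cE (s : n.-tuple R) : tnth [tuple of x :: s] (lift ord0 k) = tnth s k.
  by rewrite !(tnth_nth 0).
by rewrite !cE tnth_shift.
Qed.

(** Both orders of integration are needed: the first to descend to the tail when differentiating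
    along a later coordinate, the second to integrate along the first coordinate with the tail
    fixed. *)
Lemma Lint_cons n (f : n.+1.-tuple R -> R) : L1 f ->
  Lint f = (\int[leb]_x Lint (fun t : n.-tuple R => f [tuple of x :: t]))%E /\
  Lint f = (\int[lebn n]_t \int[leb]_x (f [tuple of (x : R) :: t])%:E)%E.
Proof.
move=> [mf foo].
have mfc : measurable_fun [set: (measurableTypeR R * n.-tuple R)%type] (f \o @tcons R n).
  exact: (measurableT_comp mf (@measurable_tcons R n)).
have intE (g : n.+1.-tuple R -> R) : measurable_fun [set: n.+1.-tuple R] g ->
    (forall x, 0 <= g x) ->
    tint (fun x => (g x)%:E) = (\int[leb \x lebn n]_z (g (tcons z))%:E)%E.
  move=> mg g0.
  have mgc : measurable_fun [set: (measurableTypeR R * n.-tuple R)%type]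
      (fun z => (g (tcons z))%:E).
    by apply/measurable_EFinP; exact: (measurableT_comp mg (@measurable_tcons R n)).
  rewrite fubini_tonelli1//=; last by move=> z; rewrite lee_fin.
  apply: eq_integral => x _; rewrite tintE// /fubini_F//; last by move=> t; rewrite lee_fin.
  apply/measurable_EFinP.
    exact: (measurableT_comp mg (measurable_cons (measurable_cst x) (@measurable_id _ _ _))).
have -> : Lint f = (\int[leb \x lebn n]_z (f (tcons z))%:E)%E.
  rewrite /Lint integralE !intE.
  - by congr (_ - _)%E; apply: eq_integral => x _; rewrite ?funeposE ?funenegE EFin_max.
  - by apply: measurable_maxr => //; exact: measurable_funN.
  - by move=> x; rewrite le_max lexx orbT.
  - exact: measurable_maxr.
  - by move=> x; rewrite le_max lexx orbT.
have If : (leb \x lebn n)%E.-integrable setT (EFin \o (f \o @tcons R n)).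
  apply/integrableP; split; first exact/measurable_EFinP.
  rewrite -(@intE (fun x => `|f x|))//; exact: measurableT_comp.
split; last by rewrite -(integral21_prod_meas1 If).
rewrite -(integral12_prod_meas1 If); apply: eq_integral => x _.
rewrite LintE//.
exact: (measurableT_comp mf (measurable_cons (measurable_cst x) (@measurable_id _ _ _))).
Qed.

(** Fubini reduces to the line in direction i, where the fundamental theorem of calculus gives a
    difference of two boundary values outside the support. Applied to a product, this is integration
    by parts. *)
Lemma Lint_pderiv0 n (i : 'I_n) (Phi dPhi : n.-tuple R -> R) : has_pderiv i Phi dPhi ->
  econt dPhi -> compact_supp Phi -> compact_supp dPhi -> Lint dPhi = 0%E.
Proof.
elim: n i Phi dPhi => [[]//|n IH] i Phi dPhi dP cd [M PM] sd.
have [E1 E2] := Lint_cons (L1_econt cd sd).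
have [j ij|ij] := unliftP ord0 i.
  rewrite E1 integral0_eq// => x _.
  apply: (IH j (fun t => Phi [tuple of x :: t])).
  - by move=> t; have := dP [tuple of x :: t]; rewrite ij; under eq_fun do rewrite shift_consS.
  - exact: econt_section.
  - by apply: compact_supp_section; exists M.
  - exact: compact_supp_section.
have {sd}[K dK] := sd.
have big (L x : R) (t : n.-tuple R) : L < `|x| -> L < enorm [tuple of x :: t].
  by move=> Lx; apply: lt_le_trans Lx _; have := tnth_le_enorm [tuple of x :: t] ord0.
rewrite E2 integral0_eq// => t _.
apply: (@integral_is_derive_supp (fun x => Phi [tuple of x :: t]) _ (Num.max M K)).
- move=> x; apply/is_derive1P.
  by have := dP [tuple of x :: t]; rewrite ij; under eq_fun do rewrite shift_cons0.
- move=> x; apply/cvgrPdist_lt => e e0.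
  have [d d0 Hd] := cd [tuple of x :: t] e e0.
  apply/nbhs_ballP; exists d => //= y xy; rewrite distrC; apply: Hd.
  rewrite /enorm big_ord_recl big1 ?addr0; last first.
    by move=> k _; rewrite tnth_tsub !(tnth_nth 0)/= subrr expr0n.
  by rewrite sqrtr_sqr tnth_tsub !(tnth_nth 0)/= distrC.
- by move=> x xM; apply: PM; apply: big; apply: le_lt_trans xM; rewrite le_max lexx.
- by move=> x xM; apply: dK; apply: big; apply: le_lt_trans xM; rewrite le_max lexx orbT.
Qed.

End IntegrationByParts.

(** * Weak gradients *)

Section WeakGradient.
Context {R : realType}.

Lemma minkowski2 n (a b : 'I_n -> R) :
  Num.sqrt (\sum_(i < n) (a i + b i) ^+ 2) <=
  Num.sqrt (\sum_(i < n) a i ^+ 2) + Num.sqrt (\sum_(i < n) b i ^+ 2).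
Proof.
have sq0 (c : 'I_n -> R) : 0 <= \sum_(i < n) c i ^+ 2.
  by apply: sumr_ge0 => i _; exact: sqr_ge0.
set A := Num.sqrt (\sum_(i < n) a i ^+ 2); set B := Num.sqrt (\sum_(i < n) b i ^+ 2).
have A2 : \sum_(i < n) a i ^+ 2 = A ^+ 2 by rewrite sqr_sqrtr.
have B2 : \sum_(i < n) b i ^+ 2 = B ^+ 2 by rewrite sqr_sqrtr.
have A0 : 0 <= A by exact: sqrtr_ge0.
have B0 : 0 <= B by exact: sqrtr_ge0.
have z0 (c : 'I_n -> R) : \sum_(i < n) c i ^+ 2 = 0 -> forall i, c i = 0.
  move=> /eqP; rewrite psumr_eq0; last by move=> i _; exact: sqr_ge0.
  move=> /allP h i; apply/eqP.
  by have := h i (mem_index_enum i); rewrite /= sqrf_eq0.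
have CS : \sum_(i < n) a i * b i <= A * B.
  have [A00|A1] := eqVneq A 0.
    rewrite A00 mul0r big1// => i _.
    by rewrite (z0 a) ?mul0r// A2 A00 expr0n.
  have [B00|B1] := eqVneq B 0.
    rewrite B00 mulr0 big1// => i _.
    by rewrite (z0 b) ?mulr0// B2 B00 expr0n.
  have AB : 0 < A * B by rewrite mulr_gt0// lt0r ?A0 ?B0 ?A1 ?B1.
  (* This sum of squares equals 2 A B (A B - sum of a_i b_i); dividing by A B is legitimate since
     the degenerate cases are settled above. *)
  have := sq0 (fun i => B * a i - A * b i).
  rewrite (eq_bigr (fun i => B ^+ 2 * a i ^+ 2 + A ^+ 2 * b i ^+ 2 - 2 * (A * B) * (a i * b i))).
    rewrite sumrB big_split/= -!mulr_sumr A2 B2 => h.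
    rewrite -(ler_pM2l AB); nra.
  by move=> i _; ring.
rewrite -(@ler_pXn2r _ 2)// ?nnegrE ?addr_ge0// ?sqrtr_ge0//.
rewrite sqr_sqrtr//.
rewrite (eq_bigr (fun i => a i ^+ 2 + b i ^+ 2 + 2 * (a i * b i))).
  rewrite 2!big_split/= -mulr_sumr A2 B2; nra.
by move=> i _; ring.
Qed.

Lemma shift0 n (x : n.-tuple R) i : Defs.shift x i 0 = x.
Proof. by apply: eq_from_tnth => j; rewrite tnth_shift if_same addr0. Qed.

Lemma has_pderivP n (i : 'I_n) (f g : n.-tuple R -> R) :
  has_pderiv i f g <-> forall x, is_derive (0 : R) 1 (fun h : R => f (Defs.shift x i h)) (g x).
Proof.
have E x : (fun h : R => (f (Defs.shift x i h) - f x) / h) =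
    (fun h : R => (f (Defs.shift x i (0 + h)) - f (Defs.shift x i 0)) / h).
  by apply/funext => h; rewrite add0r shift0.
split=> [fg x|fg x].
  by apply/is_derive1P; rewrite -E; exact: fg.
by have /is_derive1P := fg x; rewrite -E.
Qed.

Lemma has_pderiv_unique n (i : 'I_n) (f g g' : n.-tuple R -> R) :
  has_pderiv i f g -> has_pderiv i f g' -> g = g'.
Proof.
move=> fg fg'; apply/funext => x.
exact: (cvg_unique _ (fg x) (fg' x)).
Qed.

Lemma has_pderiv0 n (i : 'I_n) : has_pderiv i (fun=> 0 : R) (fun=> 0).
Proof. by apply/has_pderivP => x; exact: is_derive_cst. Qed.

Lemma has_pderivD n (i : 'I_n) (f g f' g' : n.-tuple R -> R) :
  has_pderiv i f f' -> has_pderiv i g g' ->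
  has_pderiv i (fun x => f x + g x) (fun x => f' x + g' x).
Proof.
by move=> /has_pderivP df /has_pderivP dg; apply/has_pderivP => x.
Qed.

Lemma has_pderivM n (i : 'I_n) (f g f' g' : n.-tuple R -> R) :
  has_pderiv i f f' -> has_pderiv i g g' ->
  has_pderiv i (fun x => f x * g x) (fun x => f x * g' x + f' x * g x).
Proof.
move=> /has_pderivP df /has_pderivP dg; apply/has_pderivP => x.
have := is_deriveM (df x) (dg x); rewrite !shift0 [X in _ -> is_derive _ _ _ X](_ : _ = f x *: g' x + g x *: f' x)//.
by rewrite [_ *: f' x]mulrC.
Qed.

Lemma has_pderiv_sum n (i : 'I_n) (J : Type) (s : seq J) (f f' : J -> n.-tuple R -> R) :
  (forall j, has_pderiv i (f j) (f' j)) ->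
  has_pderiv i (fun x => \sum_(j <- s) f j x) (fun x => \sum_(j <- s) f' j x).
Proof.
move=> df; elim: s => [|j s IH].
  rewrite (_ : (fun x => _) = fun=> 0); last by apply/funext => x; rewrite big_nil.
  rewrite [X in has_pderiv _ _ X](_ : _ = fun=> 0); last by apply/funext => x; rewrite big_nil.
  exact: has_pderiv0.
rewrite (_ : (fun x => _) = fun x => f j x + \sum_(j <- s) f j x); last first.
  by apply/funext => x; rewrite big_cons.
rewrite [X in has_pderiv _ _ X](_ : _ = fun x => f' j x + \sum_(j <- s) f' j x); last first.
  by apply/funext => x; rewrite big_cons.
exact: has_pderivD.
Qed.

Lemma has_pderiv_supp n (i : 'I_n) (f g : n.-tuple R -> R) :
  has_pderiv i f g -> compact_supp f -> compact_supp g.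
Proof.
(* The margin 1 keeps the shifted points outside the support of [f] for |h| < 1, so the difference
   quotients vanish. *)
move=> fg [M fM]; exists (M + 1) => x xM.
suff h0 : (fun h : R => (f (Defs.shift x i h) - f x) / h) @ (0 : R)^' --> (0 : R).
  exact: (cvg_unique _ (fg x) h0).
apply: cvg_near_cst; near=> h.
rewrite (fM x); last by apply: lt_trans xM; rewrite ltrDl.
rewrite fM ?subrr ?mul0r//.
have h1 : `|h| < 1 by near: h; apply: dnbhs0_lt.
have : enorm x <= enorm (Defs.shift x i h) + `|h|.
  rewrite /enorm (eq_bigr (fun j => (tnth (Defs.shift x i h) j + (if j == i then - h else 0)) ^+ 2)); last first.
    by move=> j _; rewrite tnth_shift; case: ifP => _; rewrite ?addrK// !addr0.
  apply: le_trans (minkowski2 _ _) _; rewrite lerD2l.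
  rewrite (bigD1 i)//= eqxx big1 ?addr0 ?sqrtr_sqr ?normrN//.
  by move=> j /negbTE ->; rewrite expr0n.
lra.
Unshelve. all: by end_near. Qed.

(** In [weak_grad] the derivative [dphi] is an arbitrary function satisfying [has_pderiv];
    uniqueness of limits identifies it with the continuous one provided by smoothness. *)
Lemma test_fun_pderiv n (i : 'I_n) (phi dphi : n.-tuple R -> R) :
  test_fun phi -> has_pderiv i phi dphi ->
  [/\ econt phi, econt dphi & compact_supp dphi].
Proof.
move=> [[D [D0 DS Dc]] sphi] dp; split.
- by rewrite -D0.
- by rewrite (has_pderiv_unique dp (g' := D [:: i])) // -D0; exact: DS.
- exact: has_pderiv_supp dp sphi.
Qed.

Lemma L1_measurable n (f : n.-tuple R -> R) : L1 f -> measurable_fun [set: n.-tuple R] f.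
Proof. by case. Qed.

Lemma L1D n (f g : n.-tuple R -> R) : L1 f -> L1 g -> L1 (fun x => f x + g x).
Proof. by move=> /L1P f1 /L1P g1; apply/L1P; exact: (integrableD measurableT f1 g1). Qed.

Lemma L1M_bounded n (f g : n.-tuple R -> R) B : L1 f -> measurable_fun [set: n.-tuple R] g ->
  (forall x, `|g x| <= B) -> L1 (fun x => f x * g x).
Proof.
move=> /L1P f1 mg gB; apply/L1P; apply: (integrableMl measurableT f1 mg).
by exists B; split; rewrite ?num_real// => y /= By x _; exact: le_trans (gB x) (ltW By).
Qed.

Lemma Lint_fin_num n (f : n.-tuple R -> R) : L1 f -> Lint f \is a fin_num.
Proof. by move=> f1; rewrite (LintE (L1_measurable f1)) integrable_fin_num//; exact/L1P. Qed.

Lemma LintD n (f g : n.-tuple R -> R) : L1 f -> L1 g ->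
  Lint (fun x => f x + g x) = (Lint f + Lint g)%E.
Proof.
move=> f1 g1; rewrite !LintE; try exact: L1_measurable.
- by rewrite -integralD//; exact/L1P.
- exact: (L1_measurable (L1D f1 g1)).
Qed.

Lemma weak_gradD n (u v : n.-tuple R -> R) g h : L1 u -> L1 v ->
  (forall i, L1 (g i)) -> (forall i, L1 (h i)) -> weak_grad u g -> weak_grad v h ->
  weak_grad (fun x => u x + v x) (fun i x => g i x + h i x).
Proof.
move=> u1 v1 g1 h1 ug vh i phi dphi tphi dp.
have [cphi cdphi sdphi] := test_fun_pderiv tphi dp.
have [B _ phiB] := econt_bounded cphi (proj2 tphi).
have [B' _ dphiB] := econt_bounded cdphi sdphi.
have mphi := econt_measurable cphi; have mdphi := econt_measurable cdphi.
rewrite [in LHS](_ : (fun x => _) = fun x => u x * dphi x + v x * dphi x); last first.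
  by apply/funext => x; rewrite mulrDl.
rewrite [in RHS](_ : (fun x => _) = fun x => g i x * phi x + h i x * phi x); last first.
  by apply/funext => x; rewrite mulrDl.
have ugp := L1M_bounded (g1 i) mphi phiB; have vhp := L1M_bounded (h1 i) mphi phiB.
have udp := L1M_bounded u1 mdphi dphiB; have vdp := L1M_bounded v1 mdphi dphiB.
rewrite !LintD//.
by rewrite (ug _ _ _ tphi dp) (vh _ _ _ tphi dp) [RHS]fin_num_oppeD// Lint_fin_num.
Qed.

(** The derivative of the compactly supported product u phi integrates to 0. *)
Lemma weak_grad_pderiv n (u : n.-tuple R -> R) g : econt u -> (forall i, econt (g i)) ->
  compact_supp u -> (forall i, has_pderiv i u (g i)) -> weak_grad u g.
Proof.
move=> cu cg su du i phi dphi tphi dp.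
have [cphi cdphi sdphi] := test_fun_pderiv tphi dp.
have suppM (f h : n.-tuple R -> R) : compact_supp f -> compact_supp (fun x => f x * h x).
  by move=> [M fM]; exists M => x /fM ->; rewrite mul0r.
have sg := has_pderiv_supp (du i) su.
have dup := has_pderivM (du i) dp.
have := Lint_pderiv0 dup _ (suppM _ _ su) (has_pderiv_supp dup (suppM _ _ su)).
have I1 : L1 (fun x => u x * dphi x) by apply: L1_econt; [exact: econtM|exact: suppM].
have I2 : L1 (fun x => g i x * phi x) by apply: L1_econt; [exact: econtM|exact: suppM].
have h0 := Lint_pderiv0 dup (econtD (econtM cu cdphi) (econtM (cg i) cphi))
  (suppM _ _ su) (has_pderiv_supp dup (suppM _ _ su)).
move: h0; rewrite LintD// -(fineK (Lint_fin_num I1)) -(fineK (Lint_fin_num I2)) -EFinD.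
by move=> [/eqP]; rewrite addr_eq0 => /eqP ->.
Qed.

End WeakGradient.

(** * Series of functions with disjoint supports *)

Section DisjointSums.
Context {R : realType}.

Definition disjoint_sum n (f : nat -> n.-tuple R -> R) (u : n.-tuple R -> R) :=
  forall x, exists k, u x = f k x /\ forall j, j != k -> f j x = 0.

Lemma disjoint_sum_partial n (f : nat -> n.-tuple R -> R) u x : disjoint_sum f u ->
  exists k, forall K, \sum_(j < K) f j x = if (k < K)%N then u x else 0.
Proof.
move=> /(_ x)[k [ux fx]]; exists k => K; case: ifPn => kK.
  rewrite (bigD1 (Ordinal kK))//= big1 ?addr0 ?ux// => j jk.
  by apply: fx; apply: contra jk => /eqP jk; apply/eqP/val_inj.
rewrite big1// => j _; apply: fx; apply: contra kK => /eqP <-.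
exact: ltn_ord.
Qed.

Lemma disjoint_sum_cvg n (f : nat -> n.-tuple R -> R) u x : disjoint_sum f u ->
  (fun K => \sum_(j < K) f j x) @ \oo --> u x.
Proof.
move=> fu; have [k fx] := disjoint_sum_partial x fu.
apply: cvg_near_cst; near=> K; rewrite fx ifT//.
by near: K; exact: nbhs_infty_gt.
Unshelve. all: by end_near. Qed.

Lemma disjoint_sum_measurable n (f : nat -> n.-tuple R -> R) u : disjoint_sum f u ->
  (forall k, measurable_fun [set: n.-tuple R] (f k)) -> measurable_fun [set: n.-tuple R] u.
Proof.
move=> fu mf; apply: (@measurable_fun_cvg _ _ _ _ (fun K x => \sum_(j < K) f j x)).
  by move=> K; apply: measurable_sum.
by move=> x _; exact: disjoint_sum_cvg.
Qed.

Lemma disjoint_sum_L1 n (f : nat -> n.-tuple R -> R) u (c : nat -> R) (C : R) :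
  disjoint_sum f u -> (forall k, L1 (f k)) ->
  (forall k, (tint (fun x => (`|f k x|)%:E) <= (c k)%:E)%E) ->
  (forall K, \sum_(k < K) c k <= C) -> L1 u.
Proof.
move=> fu f1 fc cC.
have mf k : measurable_fun [set: n.-tuple R] (fun x => (`|f k x|)%:E).
  by apply/measurable_EFinP; apply: measurableT_comp => //; exact: L1_measurable.
have mu : measurable_fun [set: n.-tuple R] u.
  by apply: disjoint_sum_measurable fu _ => k; exact: L1_measurable.
split=> //; apply: (@le_lt_trans _ _ C%:E); last exact: ltry.
have f0 k x : [set: n.-tuple R] x -> (0 <= (`|f k x|)%:E)%E by rewrite lee_fin.
rewrite tintE//; last by apply/measurable_EFinP; exact: measurableT_comp.
apply: (@le_trans _ _ (\int[lebn n]_x (\sum_(0 <= k <oo) (`|f k x|)%:E))%E).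
  apply: ge0_le_integral => //.
  - by apply/measurable_EFinP; exact: measurableT_comp.
  - by apply: ge0_emeasurable_sum => // k x _ _; rewrite lee_fin.
  - move=> x _; have [k [-> _]] := fu x.
    have := @nneseries_lim_ge R (fun k => (`|f k x|)%:E) xpredT 0 k.+1.
    move=> /(_ (fun i _ => _)) h; apply: le_trans (h _); last first.
      by move=> i _; rewrite lee_fin.
    rewrite big_nat_recr//= leeDr// sume_ge0// => i _; rewrite ?lee_fin//.
rewrite integral_nneseries//; apply: lime_le.
  by apply: is_cvg_nneseries => k _ _; apply: integral_ge0 => x _; rewrite lee_fin.
apply: nearW => K; apply: (@le_trans _ _ (\sum_(0 <= k < K) (c k)%:E)%E).
  by apply: lee_sum => k _; rewrite -tintE//; exact: fc.
by rewrite sumEFin lee_fin big_mkord.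
Qed.

(** Dominated convergence: by disjointness a partial sum is, at each point, either 0 or already the
    full value, so |u psi| itself is the majorant. *)
Lemma disjoint_sum_Lint n (f : nat -> n.-tuple R -> R) u (psi : n.-tuple R -> R) B :
  disjoint_sum f u -> (forall k, measurable_fun [set: n.-tuple R] (f k)) -> L1 u ->
  measurable_fun [set: n.-tuple R] psi -> (forall x, `|psi x| <= B) ->
  (fun K => Lint (fun x => (\sum_(j < K) f j x) * psi x)) @ \oo --> Lint (fun x => u x * psi x).
Proof.
move=> fu mf u1 mpsi psiB.
have up := L1M_bounded u1 mpsi psiB.
have mfp K : measurable_fun [set: n.-tuple R] (fun x => (\sum_(j < K) f j x) * psi x).
  by apply: measurable_funM => //; exact: measurable_sum.
rewrite (LintE (L1_measurable up)).
under eq_fun do rewrite (LintE (mfp _)).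
apply: (@dominated_cvg _ _ _ _ _ measurableT _ _ (fun x => (`|u x * psi x|)%:E)) => //.
- by move=> K; exact/measurable_EFinP.
- move=> x _; apply/fine_cvgP; split; first by apply: nearW.
  by apply: cvgMl; exact: disjoint_sum_cvg.
- by have /L1P/integrable_abse := up.
- move=> K x _; rewrite /= lee_fin.
  have [k ->] := disjoint_sum_partial x fu.
  by case: ifP => // _; rewrite mul0r normr0.
Qed.

Lemma weak_grad_sum n (f : nat -> n.-tuple R -> R) (g : nat -> 'I_n -> n.-tuple R -> R) K :
  (forall k, L1 (f k)) -> (forall k i, L1 (g k i)) -> (forall k, weak_grad (f k) (g k)) ->
  [/\ L1 (fun x => \sum_(j < K) f j x), forall i, L1 (fun x => \sum_(j < K) g j i x) &
  weak_grad (fun x => \sum_(j < K) f j x) (fun i x => \sum_(j < K) g j i x)].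
Proof.
move=> f1 g1 fg; elim: K => [|K [IH1 IH2 IH3]].
  have L0 : L1 (fun _ : n.-tuple R => 0 : R).
    by apply/L1P; exact: integrable0.
  rewrite (_ : (fun x => _) = fun=> 0); last by apply/funext => x; rewrite big_ord0.
  rewrite [X in weak_grad _ X](_ : _ = fun _ _ => 0); last first.
    by apply/funext => i; apply/funext => x; rewrite big_ord0.
  split=> // [i|].
    by rewrite (_ : (fun x => _) = fun=> 0)//; apply/funext => x; rewrite big_ord0.
  apply: weak_grad_pderiv => [|i||i]; [exact: econt_cst|exact: econt_cst| |exact: has_pderiv0].
  by exists 0.
rewrite (_ : (fun x => _) = fun x => \sum_(j < K) f j x + f K x); last first.
  by apply/funext => x; rewrite big_ord_recr.
rewrite [X in weak_grad _ X](_ : _ = fun i x => \sum_(j < K) g j i x + g K i x); last first.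
  by apply/funext => i; apply/funext => x; rewrite big_ord_recr.
split; [exact: L1D| |exact: weak_gradD].
move=> i; rewrite (_ : (fun x => _) = fun x => \sum_(j < K) g j i x + g K i x); last first.
  by apply/funext => x; rewrite big_ord_recr.
exact: L1D.
Qed.

(** Finite sums satisfy the weak identity by linearity; both of its sides converge along the partial
    sums, so their limits agree. *)
Lemma weak_grad_disjoint_sum n (f : nat -> n.-tuple R -> R)
    (g : nat -> 'I_n -> n.-tuple R -> R) u gu :
  (forall k, L1 (f k)) -> (forall k i, L1 (g k i)) -> (forall k, weak_grad (f k) (g k)) ->
  disjoint_sum f u -> (forall i, disjoint_sum (fun k => g k i) (gu i)) ->
  L1 u -> (forall i, L1 (gu i)) -> weak_grad u gu.
Proof.
move=> f1 g1 fg fu ggu u1 gu1 i phi dphi tphi dp.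
have [cphi cdphi sdphi] := test_fun_pderiv tphi dp.
have [B _ phiB] := econt_bounded cphi (proj2 tphi).
have [B' _ dphiB] := econt_bounded cdphi sdphi.
have mphi := econt_measurable cphi; have mdphi := econt_measurable cdphi.
have h1 := disjoint_sum_Lint fu (fun k => L1_measurable (f1 k)) u1 mdphi dphiB.
have h2 := disjoint_sum_Lint (ggu i) (fun k => L1_measurable (g1 k i)) (gu1 i) mphi phiB.
suff h3 : (fun K => Lint (fun x => (\sum_(j < K) f j x) * dphi x)) @ \oo -->
    (- Lint (fun x => (gu i x * phi x)%R))%E by exact: (cvg_unique _ h1 h3).
rewrite (_ : (fun K => _) = (fun K => - Lint (fun x => ((\sum_(j < K) g j i x) * phi x)%R))%E).
  exact: cvgeN h2.
apply/funext => K; have [_ _ wK] := weak_grad_sum K f1 g1 fg.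
exact: (wK i phi dphi tphi dp).
Qed.

Lemma measurable_enorm d (T : measurableType d) n (F : T -> n.-tuple R) :
  (forall i, measurable_fun [set: T] (fun z => tnth (F z) i)) ->
  measurable_fun [set: T] (fun z => enorm (F z)).
Proof.
move=> mF; apply: (measurableT_comp (continuous_measurable_fun (@sqrt_continuous R))).
by apply: measurable_sum => i; exact: measurable_funX.
Qed.

Lemma L1_loc_integrable n (u : n.-tuple R -> R) : L1 u -> loc_integrable u.
Proof.
move=> [mu uoo]; split=> // M; apply: le_lt_trans uoo.
apply: le_tint => [|||x].
- apply: measurable_fun_ifT => //.
  + apply: measurable_fun_ler => //.
    by apply: (@measurable_enorm _ _ n id) => i; exact: measurable_tnth.
  + by apply/measurable_EFinP; exact: measurableT_comp.
- by apply/measurable_EFinP; exact: measurableT_comp.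
- by move=> x; case: ifP.
- by case: ifP.
Qed.

End DisjointSums.

(** * A smooth step *)

Section SmoothStep.
Context {R : realType}.

(** The derivative is an existential witness, so closure under sums, products, inverses and affine
    substitutions goes by induction on the order. Continuity of the derivatives is not recorded, as
    it follows from the next order. *)
Fixpoint diffn (m : nat) (f : R -> R) : Prop :=
  if m is m'.+1 then exists2 f', (forall x : R, is_derive x 1 f (f' x)) & diffn m' f'
  else True.

Definition smooth1 (f : R -> R) := forall m, diffn m f.

Lemma is_derive1_unique (f f1 f2 : R -> R) : (forall x : R, is_derive x 1 f (f1 x)) ->
  (forall x : R, is_derive x 1 f (f2 x)) -> f1 = f2.
Proof.
move=> d1 d2; apply/funext => x.
by rewrite -(@derive_val _ _ _ _ _ _ _ (d1 x)) -(@derive_val _ _ _ _ _ _ _ (d2 x)).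
Qed.

Lemma smooth1_derive (f f' : R -> R) : smooth1 f -> (forall x : R, is_derive x 1 f (f' x)) ->
  smooth1 f'.
Proof. by move=> sf df m; have [g dg] := sf m.+1; rewrite (is_derive1_unique df dg). Qed.

Lemma smooth1_iter (f : R -> R) : smooth1 f -> exists D : nat -> R -> R,
  [/\ D 0%N = f, forall k (x : R), is_derive x 1 (D k) (D k.+1 x) & forall k, smooth1 (D k)].
Proof.
move=> sf; have sD k : smooth1 (derive1n k f).
  elim: k => [|k IH] //=; apply: (smooth1_derive IH) => x.
  have [g dg _] := IH 1%N.
  by rewrite derive1E (@derive_val _ _ _ _ _ _ _ (dg x)).
exists (fun k => derive1n k f); split; [by []| |exact: sD] => k x.
have [g dg _] := sD k 1%N.
by rewrite /= derive1E (@derive_val _ _ _ _ _ _ _ (dg x)).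
Qed.

Lemma smooth1_continuous f : smooth1 f -> continuous f.
Proof. by move=> /(_ 1%N)[f' df _]; exact: is_derive1_continuous df. Qed.

Lemma diffnS m f : diffn m.+1 f -> diffn m f.
Proof. by elim: m f => [|m IH] f //= -[f' df /IH ?]; exists f'. Qed.

Lemma is_derive1_cst (c : R) (x : R) : is_derive x 1 (fun _ : R => c) 0.
Proof. exact: is_derive_cst. Qed.

Lemma is_derive1D (f g : R -> R) (x df dg : R) : is_derive x 1 f df -> is_derive x 1 g dg ->
  is_derive x 1 (fun y => f y + g y) (df + dg).
Proof. by move=> hf hg; exact: (is_deriveD hf hg). Qed.

Lemma is_derive1M (f g : R -> R) (x df dg : R) : is_derive x 1 f df -> is_derive x 1 g dg ->
  is_derive x 1 (fun y => f y * g y) (f x * dg + df * g x).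
Proof.
by move=> hf hg; have := is_deriveM hf hg; rewrite [g x *: df]mulrC.
Qed.

Lemma is_derive1Z (c : R) (f : R -> R) (x df : R) : is_derive x 1 f df ->
  is_derive x 1 (fun y => c * f y) (c * df).
Proof.
by move=> hf; have := is_derive1M (is_derive1_cst c x) hf; rewrite mul0r addr0.
Qed.

Lemma is_derive1_affine (f : R -> R) (a b x df : R) : is_derive (a * x + b) 1 f df ->
  is_derive x 1 (fun y => f (a * y + b)) (a * df).
Proof.
move=> hf.
have ha : is_derive x 1 (fun y : R => a * y + b) a.
  have := is_derive1D (is_derive1Z a (is_derive_id x 1)) (is_derive1_cst b x).
  by rewrite mulr1 addr0.
by have := @is_derive1_comp R f (fun y => a * y + b) x _ _ hf ha; rewrite mulrC.
Qed.

Lemma diffn_cst m (c : R) : diffn m (fun=> c).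
Proof.
elim: m c => [|m IH] c //=; exists (fun=> 0); last exact: IH.
by move=> x; exact: is_derive1_cst.
Qed.

Lemma diffnD m f g : diffn m f -> diffn m g -> diffn m (fun x => f x + g x).
Proof.
elim: m f g => [|m IH] f g //= [f' df sf] [g' dg sg].
exists (fun x => f' x + g' x); last exact: IH.
by move=> x; exact: is_derive1D.
Qed.

Lemma diffnM m f g : diffn m f -> diffn m g -> diffn m (fun x => f x * g x).
Proof.
elim: m f g => [|m IH] f g // hf hg.
have [f' df sf] := hf; have [g' dg sg] := hg.
exists (fun x => f x * g' x + f' x * g x).
  by move=> x; exact: is_derive1M.
by apply: diffnD; apply: IH => //; exact: diffnS.
Qed.

Lemma diffn_affine m f (a b : R) : diffn m f -> diffn m (fun x => f (a * x + b)).
Proof.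
elim: m f => [|m IH] f //= [f' df sf]; exists (fun x => a * f' (a * x + b)).
  by move=> x; exact: is_derive1_affine.
by apply: diffnM; [exact: diffn_cst|exact: IH].
Qed.

Lemma is_derive1V (f : R -> R) (x df : R) : f x != 0 -> is_derive x 1 f df ->
  is_derive x 1 (fun y => (f y)^-1) (- df * ((f x)^-1 * (f x)^-1)).
Proof.
move=> fx hf; have := @is_deriveV _ f x _ _ fx hf.
rewrite (_ : _ *: _ = - df * ((f x)^-1 * (f x)^-1))//.
by rewrite /GRing.scale/= expr2 invfM mulrC mulrN mulNr.
Qed.

Lemma diffnV m f : (forall x, f x != 0) -> diffn m f -> diffn m (fun x => (f x)^-1).
Proof.
move=> f0; elim: m => [|m IH] // hf; have [f' df sf] := hf.
exists (fun x => - f' x * ((f x)^-1 * (f x)^-1)).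
  by move=> x; exact: is_derive1V.
have hV := IH (diffnS hf).
apply: diffnM; last exact: diffnM.
rewrite (_ : (fun x => _) = fun x => -1 * f' x); last by apply/funext => x; rewrite mulN1r.
by apply: diffnM => //; exact: diffn_cst.
Qed.

(** The classical flat function exp(-1/x) is the case k = 0. With the powers of 1/x the family spans
    its own derivatives, so one induction proves smoothness for all k. *)
Definition flat (k : nat) (x : R) : R := if 0 < x then x^-1 ^+ k * expR (- x^-1) else 0.

Lemma flat_ge0 k x : 0 <= flat k x.
Proof. by rewrite /flat; case: ifP => // x0; rewrite mulr_ge0 ?expR_ge0// exprn_ge0// invr_ge0 ltW. Qed.

Lemma flat_gt0 x : 0 < x -> 0 < flat 0 x.
Proof. by move=> x0; rewrite /flat x0 mul1r expR_gt0. Qed.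

Lemma flat_le0 k x : x <= 0 -> flat k x = 0.
Proof. by rewrite /flat ltNge => ->. Qed.

(** A quadratic bound forces derivative 0 at the origin. With y = 1/h and m = k + 2 it reads y^m <=
    m^m exp(y), which is the m-th power of y/m <= exp(y/m). *)
Lemma flat_bound k h : flat k h <= (k.+2%:R ^+ k.+2) * h ^+ 2.
Proof.
rewrite /flat; case: ifPn => h0; last by rewrite mulr_ge0 ?sqr_ge0// exprn_ge0.
have [y y0 hy] : exists2 y, 0 < y & h = y^-1 by exists h^-1; rewrite ?invr_gt0 ?invrK.
have m0 : 0 < k.+2%:R :> R by rewrite ltr0n.
have ey : (y / k.+2%:R) ^+ k.+2 <= expR y.
  rewrite (_ : expR y = expR (y / k.+2%:R) ^+ k.+2).
    rewrite ler_pXn2r ?nnegrE ?expR_ge0//; last by rewrite divr_ge0// ltW.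
    by rewrite (le_trans _ (expR_ge1Dx _))// lerDr.
  by rewrite -expRM_natl mulrC divfK// gt_eqF.
rewrite expr_div_n ler_pdivrMr ?exprn_gt0// in ey.
rewrite hy invrK expRN ler_pdivrMr ?expR_gt0// exprVn [leRHS]mulrAC.
by rewrite ler_pdivlMr ?exprn_gt0// -exprD addn2 [leRHS]mulrC.
Qed.

Lemma is_derive_flat k (x : R) :
  is_derive x 1 (flat k) (- k%:R * flat k.+1 x + flat k.+2 x).
Proof.
have [x0|x0|->] := ltgtP x 0.
- rewrite !flat_le0 ?ltW// mulr0 addr0.
  apply: (@near_eq_is_derive _ _ _ (fun=> 0)).
  by near=> y; rewrite flat_le0// ltW//; near: y; exact: lt_nbhsl.
- rewrite (_ : _ + _ = - k%:R * (x^-1 ^+ k.+1 * expR (- x^-1)) +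
    x^-1 ^+ k.+2 * expR (- x^-1)); last by rewrite /flat x0.
  apply: (@near_eq_is_derive _ _ _ (fun y : R => y^-1 ^+ k * expR (- y^-1))).
    by near=> y; rewrite /flat ifT//; near: y; exact: lt_nbhsr.
  have xn0 : x != 0 by rewrite gt_eqF.
  have dV : is_derive x 1 (fun y : R => y^-1) (- (x^-1 ^+ 2)).
    by have := is_derive1V xn0 (is_derive_id x 1); rewrite mulN1r expr2.
  have dN : is_derive x 1 (fun y : R => - y^-1) (x^-1 ^+ 2).
    have := is_derive1Z (-1) dV; rewrite mulrN mulN1r opprK.
    by under eq_fun do rewrite mulN1r.
  have dE := @is_derive1_comp R expR (fun y => - y^-1) x _ _ (is_derive_expR _) dN.
  have dX : is_derive x 1 (fun y : R => y^-1 ^+ k) (- k%:R * x^-1 ^+ k.+1).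
    elim: (k) => [|j IH]; first by rewrite oppr0 mul0r; exact: is_derive1_cst.
    have := is_derive1M dV IH.
    rewrite (_ : _ + _ = - j.+1%:R * x^-1 ^+ j.+2); last first.
      by rewrite -natr1 !exprS; ring.
    by under eq_fun do rewrite -exprS.
  have := is_derive1M dX dE.
  rewrite (_ : x^-1 ^+ k * _ + _ = - k%:R * (x^-1 ^+ k.+1 * expR (- x^-1)) +
    x^-1 ^+ k.+2 * expR (- x^-1))//.
  by rewrite /= !exprS; ring.
rewrite !flat_le0// mulr0 addr0.
apply/is_derive1P.
rewrite (_ : (fun h => _) = (fun h => flat k h / h)); last first.
  by apply/funext => h; rewrite add0r (@flat_le0 _ 0)// subr0.
apply/cvgrPdist_le => e e0.
pose A : R := k.+2%:R ^+ k.+2; have A0 : 0 < A by rewrite exprn_gt0// ltr0n.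
have eA : 0 < e / A by rewrite divr_gt0.
near=> h.
have h0 : h != 0 by near: h; exact: nbhs_dnbhs_neq.
rewrite sub0r normrN normrM normfV ler_pdivrMr ?normr_gt0// ger0_norm ?flat_ge0//.
apply: le_trans (flat_bound _ _) _; rewrite -/A.
rewrite -real_normK ?num_real// expr2 mulrA ler_wpM2r//.
rewrite mulrC -ler_pdivlMr//.
by near: h; exact: dnbhs0_le.
Unshelve. all: by end_near. Qed.

Lemma smooth1_flat k : smooth1 (flat k).
Proof.
move=> m; elim: m k => [|m IH] k //=.
exists (fun x => - k%:R * flat k.+1 x + flat k.+2 x); first exact: is_derive_flat.
by apply: diffnD => //; apply: diffnM => //; exact: diffn_cst.
Qed.

Lemma flat0_homo : {homo flat 0 : x y / x <= y}.
Proof.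
move=> x y xy; have [x0|x0] := leP x 0; first by rewrite flat_le0// flat_ge0.
have y0 := lt_le_trans x0 xy.
by rewrite /flat x0 y0 !mul1r ler_expR lerN2 lef_pV2.
Qed.

Definition is_step (F : R -> R) :=
  [/\ smooth1 F, {homo F : x y / x <= y}, forall x, x <= 0 -> F x = 0 &
      forall x, 1 <= x -> F x = 1].

(** The quotient f(x) / (f(x) + f(1 - x)) with f = [flat 0]. After clearing denominators,
    monotonicity is f(x) f(1 - y) <= f(y) f(1 - x) for x <= y. *)
Lemma step_exists : exists F, is_step F.
Proof.
pose g x := flat 0 x + flat 0 (-1 * x + 1).
have g0 x : 0 < g x.
  have [x0|x0] := ltP 0 x; first by rewrite ltr_pwDl ?flat_gt0 ?flat_ge0.
  by rewrite ltr_wpDl ?flat_ge0// flat_gt0// mulN1r ltr_wpDl// oppr_ge0.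
exists (fun x => flat 0 x * (g x)^-1); split.
- move=> m; apply: diffnM; first exact: smooth1_flat.
  apply: diffnV; first by move=> x; rewrite gt_eqF.
  by apply: diffnD; [exact: smooth1_flat|apply: diffn_affine; exact: smooth1_flat].
- move=> x y xy; rewrite ler_pdivrMr// mulrAC ler_pdivlMr// /g.
  rewrite !mulrDr [flat 0 y * flat 0 x]mulrC lerD2l.
  by apply: ler_pM; rewrite ?flat_ge0//; apply: flat0_homo; rewrite ?mulN1r ?lerD2r ?lerN2.
- by move=> x x0; rewrite flat_le0// mul0r.
- move=> x x1; rewrite /g [flat 0 (_ * _ + _)]flat_le0 ?addr0 ?divff ?gt_eqF ?flat_gt0//.
    exact: lt_le_trans x1.
  by rewrite mulN1r addrC subr_le0.
Qed.

Lemma homo_derive_ge0 (F F' : R -> R) : {homo F : x y / x <= y} ->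
  (forall x : R, is_derive x 1 F (F' x)) -> forall x, 0 <= F' x.
Proof.
move=> hF dF x; have /is_derive1P dx := dF x.
rewrite -(cvg_lim _ dx)//; apply: limr_ge; first by apply/cvg_ex; exists (F' x).
near=> h; have [h0|h0] := leP 0 h.
  by rewrite divr_ge0// subr_ge0 hF// lerDl.
by rewrite ler_ndivlMr// mul0r subr_le0 hF// gerDl ltW.
Unshelve. all: by end_near. Qed.

(** The endpoint x = a is included because the left difference quotients alone determine the
    derivative. *)
Lemma derive_cst_le (f f' : R -> R) (a c : R) : (forall x : R, is_derive x 1 f (f' x)) ->
  (forall x, x <= a -> f x = c) -> forall x, x <= a -> f' x = 0.
Proof.
move=> df fc x xa; have /is_derive1P dx := df x.
have dl : (fun h : R => (f (x + h) - f x) / h) @ (0 : R)^'- --> f' x.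
  exact: cvg_dnbhs_at_left dx.
have d0 : (fun h : R => (f (x + h) - f x) / h) @ (0 : R)^'- --> (0 : R).
  apply: cvg_near_cst; near=> h; rewrite (fc x)// fc ?subrr ?mul0r//.
  by apply: le_trans xa; rewrite gerDl ltW//; near: h; exact: nbhs_left_lt.
exact: (cvg_unique _ dl d0).
Unshelve. all: by end_near. Qed.

Lemma derive_cst_ge (f f' : R -> R) (a c : R) : (forall x : R, is_derive x 1 f (f' x)) ->
  (forall x, a <= x -> f x = c) -> forall x, a <= x -> f' x = 0.
Proof.
move=> df fc x ax.
have df2 (y : R) : is_derive y 1 (fun y => f (-1 * y + 0)) (-1 * f' (-1 * y + 0)).
  exact: is_derive1_affine.
have := @derive_cst_le _ _ (- a) c df2 _ (- x).
rewrite lerN2 addr0 mulN1r mulN1r opprK => h; apply/eqP; rewrite -oppr_eq0; apply/eqP.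
by apply: h => // y ya; rewrite fc// addr0 mulN1r lerNr.
Qed.

End SmoothStep.

(** * Cantor-type steps *)

Section CantorSteps.
Context {R : realType}.

Lemma homo_affine (F : R -> R) (c r o : R) : 0 <= c -> 0 < r -> {homo F : x y / x <= y} ->
  {homo (fun x => c * F (r^-1 * x + - r^-1 * o)) : x y / x <= y}.
Proof.
move=> c0 r0 hF x y xy; rewrite ler_wpM2l// hF// lerD2r ler_pM2l// invr_gt0//.
Qed.

Lemma smooth1_affine (F : R -> R) (c r o : R) : smooth1 F ->
  smooth1 (fun x => c * F (r^-1 * x + - r^-1 * o)).
Proof. by move=> sF m; apply: diffnM; [exact: diffn_cst|exact: diffn_affine]. Qed.

(* The pair (t, s) encodes the rectangle (t + s[p1, p2]) x (t + s[1, q2]). *)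
Definition in_rect (p1 p2 q2 : R) (x y : R) (b : R * R) : bool :=
  [&& b.1 + b.2 * p1 <= x, x <= b.1 + b.2 * p2, b.1 + b.2 <= y & y <= b.1 + b.2 * q2].

(** The first clause confines the family to a region that can be copied at a smaller scale; the
    count expresses pairwise disjointness; the third clause is the Hölder-type lower bound on the
    rise of F, at the scale s = [b.2] of the rectangle. *)
Definition rect_family (p1 p2 q2 kap e : R) (F : R -> R) (l : seq (R * R)) :=
  [/\ forall b, b \in l -> [/\ 0 < b.2, b.2 <= 1, 0 <= b.1 & b.1 + b.2 * q2 <= q2],
      forall x y, (count (in_rect p1 p2 q2 x y) l <= 1)%N &
      forall x y b, b \in l -> in_rect p1 p2 q2 x y b -> kap * b.2 `^ e <= F y - F x].

Definition child (o r : R) (b : R * R) : R * R := (o + r * b.1, r * b.2).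

Lemma in_rect_child p1 p2 q2 o r x y b : 0 < r ->
  in_rect p1 p2 q2 x y (child o r b) =
  in_rect p1 p2 q2 (r^-1 * x + - r^-1 * o) (r^-1 * y + - r^-1 * o) b.
Proof.
move=> r0; have K z : r * (r^-1 * z + - r^-1 * o) = z - o.
  by field; rewrite gt_eqF.
have E z w : (o + r * b.1 + r * b.2 * w <= z) = (b.1 + b.2 * w <= r^-1 * z + - r^-1 * o).
  by rewrite -[RHS](ler_pM2l r0) K mulrDr lerBrDl !addrA mulrA.
have E' z w : (z <= o + r * b.1 + r * b.2 * w) = (r^-1 * z + - r^-1 * o <= b.1 + b.2 * w).
  by rewrite -[RHS](ler_pM2l r0) K mulrDr lerBlDl !addrA mulrA.
rewrite /in_rect /= E E' E'; congr [&& _, _, _ & _].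
by have := E y 1; rewrite !mulr1.
Qed.

(** All rectangles of a family lie in 0 < x <= q2, y <= q2; used contrapositively to separate
    rescaled copies. *)
Lemma rect_count0 p1 p2 q2 kap e F l x y : 0 < p1 -> p2 < 1 ->
  rect_family p1 p2 q2 kap e F l -> p2 < q2 ->
  ~~ [&& 0 < x, x <= q2 & y <= q2] -> count (in_rect p1 p2 q2 x y) l = 0%N.
Proof.
move=> p10 p21 [lP _ _] pq H; apply/eqP; rewrite -leqn0 leqNgt -has_count.
apply: contra H => /hasP[b /lP[b0 b1 b2 b3] /and4P[h1 h2 h3 h4]].
apply/and3P; split; nra.
Qed.

(** One Cantor generation: two half-height copies of F, shrunk by r, at the ends of [0, 1]. Halving
    the rise is compensated by (r s)^e = s^e / 2, and the two copies together keep the total weight,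
    to which the new rectangle adds 1. The bound q2 <= 1/r - 1 means r q2 <= 1 - r: rectangles of
    the left copy end before the right copy starts to rise. The bound q2 <= 2 keeps y where the bump
    built later still follows F. *)
Lemma cantor_step2 (e : R) (r : R) : 0 < r -> r < 2^-1 -> r `^ e = 2^-1 -> e <= 1 -> 0 <= e ->
  let q2 := Num.min 2 (r^-1 - 1) in
  forall F l, is_step F -> rect_family r (1 - r) q2 2^-1 e F l ->
  exists F' l', [/\ is_step F', rect_family r (1 - r) q2 2^-1 e F' l' &
    \sum_(b <- l') b.2 `^ e = 1 + \sum_(b <- l) b.2 `^ e].
Proof.
move=> r0 r2 re e1 e0 q2 F l [sF hF F0 F1] lF.
have rV : 2 < r^-1 by rewrite -[2]invrK ltf_pV2// posrE.
have q21 : 1 < q2 by rewrite lt_min; apply/andP; split; lra.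
have rr : r^-1 * r = 1 by rewrite mulVf// gt_eqF.
have rq2 : r * q2 <= 1 - r.
  have : q2 <= r^-1 - 1 by rewrite ge_min lexx orbT.
  by move=> h; have := ler_wpM2l (ltW r0) h; rewrite mulrBr mulr1 [r * r^-1]mulrC rr.
have q2_2 : q2 <= 2 by rewrite ge_min lexx.
pose fl x := r^-1 * x + - r^-1 * 0; pose fr x := r^-1 * x + - r^-1 * (1 - r).
pose F' x := 2^-1 * F (fl x) + 2^-1 * F (fr x).
(* The new rectangle (0, 1) pairs the middle gap [r, 1 - r], where F' = 1/2, with [1, q2], where F'
   = 1. *)
pose l' := (0, 1) :: [seq child 0 r b | b <- l] ++ [seq child (1 - r) r b | b <- l].
have flE x : r * fl x = x by rewrite /fl; field; rewrite gt_eqF.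
have frE x : r * fr x = x - (1 - r) by rewrite /fr; field; rewrite gt_eqF.
have cl x y : count (in_rect r (1 - r) q2 x y) [seq child 0 r b | b <- l] =
    count (in_rect r (1 - r) q2 (fl x) (fl y)) l.
  by rewrite count_map; apply: eq_count => b /=; rewrite in_rect_child.
have cr x y : count (in_rect r (1 - r) q2 x y) [seq child (1 - r) r b | b <- l] =
    count (in_rect r (1 - r) q2 (fr x) (fr y)) l.
  by rewrite count_map; apply: eq_count => b /=; rewrite in_rect_child.
have p21 : 1 - r < 1 by lra.
have pq : 1 - r < q2 by lra.
have c0 := rect_count0 r0 p21 lF pq.
have [lP lc lk] := lF.
exists F', l'; split.
- split.
  + by move=> m; apply: diffnD; exact: smooth1_affine.
  + have h20 : 0 <= 2^-1 :> R by rewrite invr_ge0.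
    move=> x y xy; apply: lerD; first exact: (homo_affine 0 h20 r0 hF xy).
    exact: (homo_affine (1 - r) h20 r0 hF xy).
  + move=> x x0; rewrite /F' !F0 ?mulr0 ?addr0//.
    * by rewrite -(ler_pM2l r0) frE mulr0; lra.
    * by rewrite -(ler_pM2l r0) flE mulr0.
  + move=> x x1; rewrite /F' !F1 ?mulr1; first by lra.
    * by rewrite -(ler_pM2l r0) frE mulr1; lra.
    * by rewrite -(ler_pM2l r0) flE mulr1; lra.
- split.
  + move=> b; rewrite inE => /orP[/eqP ->|]; first by rewrite /= mul1r add0r.
    rewrite mem_cat => /orP[]/mapP[b0 /lP[h1 h2 h3 h4] ->] /=; split; nra.
  (* The new rectangle has x <= 1 - r, so it misses the right copies, and y >= 1 > r q2, so it
     misses the left ones. A left copy has x <= r q2 <= 1 - r and misses the right copies. *)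
  + move=> x y; rewrite /= count_cat cl cr.
    have [h0|h0] := boolP (in_rect _ _ _ _ _ _).
      rewrite !c0//.
        have /and4P[_ /= h1 _ _] := h0; rewrite add0r mul1r in h1.
        apply/negP => /and3P[h _ _]; have := frE x; nra.
      have /and4P[_ /= _ h1 _] := h0; rewrite add0r in h1.
      apply/negP => /and3P[_ _ h]; have := flE y; nra.
    rewrite add0n.
    have [h1|h1] := boolP [&& 0 < fl x, fl x <= q2 & fl y <= q2]; last by rewrite (c0 _ _ h1) add0n.
    rewrite (c0 (fr x)) ?addn0//.
    apply/negP => /and3P[h _ _]; have /and3P[_ h2 _] := h1.
    have := frE x; have := flE x; nra.
  + move=> x y b; rewrite inE => /orP[/eqP -> /and4P[]/=|].
      rewrite !add0r !mul1r powR1 mulr1 => h1 h2 h3 h4.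
      rewrite /F' (F1 (fl x)); last by rewrite -(ler_pM2l r0) flE mulr1.
      rewrite (F0 (fr x)); last by rewrite -(ler_pM2l r0) frE mulr0; lra.
      rewrite !F1; first by lra.
        by rewrite -(ler_pM2l r0) frE mulr1; lra.
      by rewrite -(ler_pM2l r0) flE mulr1; lra.
    have bs c : c \in l -> 2^-1 * (r * c.2) `^ e = 2^-1 * (2^-1 * c.2 `^ e).
      by move=> /lP[c0_ _ _ _]; rewrite powRM ?re// ltW.
    rewrite mem_cat => /orP[]/mapP[c cl0 ->]; rewrite in_rect_child// => hin;
      have /= := lk _ _ _ cl0 hin; rewrite bs//; have [h1 h2 h3 h4] := lP _ cl0.
      have /and4P[g1 g2 g3 g4] := hin.
      rewrite -/(fl x) -/(fl y) in g1 g2 g3 g4 *.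
      have small z : fl z <= q2 -> fr z <= 0.
        move=> /(ler_wpM2l (ltW r0)) hz; rewrite -(ler_pM2l r0) mulr0 frE.
        by have := flE z; lra.
      rewrite /F' (F0 (fr x)); last by apply: small; nra.
      rewrite (F0 (fr y)); last by apply: small; lra.
      by lra.
    have /and4P[g1 g2 g3 g4] := hin.
    rewrite -/(fr x) -/(fr y) in g1 g2 g3 g4 *.
    have large z : 0 <= fr z -> 1 <= fl z.
      move=> /(ler_wpM2l (ltW r0)) hz; rewrite -(ler_pM2l r0) mulr1 flE.
      by have := frE z; lra.
    rewrite /F' (F1 (fl x)); last by apply: large; nra.
    rewrite (F1 (fl y)); last by apply: large; nra.
    by lra.
- rewrite /l' big_cons big_cat/= powR1; congr (_ + _).
  rewrite !big_map/= -big_split/=; apply: eq_big_seq => b /lP[h1 _ _ _].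
  by rewrite powRM ?re ?ltW//; lra.
Qed.

(* For e = 0 a single steep step suffices: one child, with the full weight. *)
Lemma cantor_step1 F l : is_step F -> rect_family 4^-1 2^-1 2 1 0 F l ->
  exists F' l', [/\ is_step F', rect_family 4^-1 2^-1 2 1 0 F' l' &
    \sum_(b <- l') b.2 `^ 0 = 1 + \sum_(b <- l) b.2 `^ (0 : R)].
Proof.
move=> [sF hF F0 F1] lF; have [lP lc lk] := lF.
pose r : R := 2^-1; have r0 : 0 < r by rewrite invr_gt0.
have rE : r = 2^-1 by [].
pose f x := r^-1 * x + - r^-1 * r.
pose F' x := 1 * F (f x).
(* On the new rectangle x <= 1/2 gives F' = 0 and y >= 1 gives F' = 1; the rescaled rectangles all
   have x > 1/2. *)
pose l' := (0, 1) :: [seq child r r b | b <- l].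
have fE x : r * f x = x - r by rewrite /f; field; rewrite gt_eqF.
have q0 : 0 < 4^-1 :> R by rewrite invr_gt0.
have p21 : 2^-1 < 1 :> R by lra.
have pq : 2^-1 < 2 :> R by lra.
have c0 := rect_count0 q0 p21 lF pq.
exists F', l'; split.
- split.
  + exact: smooth1_affine.
  + by move=> x y xy; exact: (homo_affine r ler01 r0 hF xy).
  + by move=> x x0; rewrite /F' F0 ?mulr0// -(ler_pM2l r0) fE mulr0; lra.
  + by move=> x x1; rewrite /F' F1 ?mulr1// -(ler_pM2l r0) fE mulr1; lra.
- split.
  + move=> b; rewrite inE => /orP[/eqP ->|]; first by split=> /=; lra.
    by move=> /mapP[b0 /lP[h1 h2 h3 h4] ->] /=; split; nra.
  + move=> x y; rewrite /= count_map.
    rewrite (eq_count (a2 := in_rect 4^-1 2^-1 2 (f x) (f y))); last first.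
      by move=> b /=; rewrite in_rect_child.
    have [h0|h0] := boolP (in_rect _ _ _ _ _ _); last by rewrite add0n.
    rewrite c0//; have /and4P[_ /= h1 _ _] := h0; rewrite add0r mul1r in h1.
    by apply/negP => /and3P[h _ _]; have := fE x; nra.
  + move=> x y b; rewrite inE => /orP[/eqP -> /and4P[]/=|].
      rewrite !add0r !mul1r powR1 => h1 h2 h3 h4; rewrite /F' (F0 (f x)); last first.
        by rewrite -(ler_pM2l r0) fE mulr0; lra.
      by rewrite (F1 (f y)); [lra|rewrite -(ler_pM2l r0) fE mulr1; lra].
    move=> /mapP[c cl0 ->]; rewrite in_rect_child// => hin.
    by have := lk _ _ _ cl0 hin; rewrite /F' !powRr0 !mul1r.
- rewrite /l' big_cons/= powR1; congr (_ + _).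
  by rewrite big_map; apply: eq_bigr => b _; rewrite !powRr0.
Qed.

(** The point is the order of quantifiers: the geometry and [kap] are fixed before n, while the
    total weight exceeds any n. *)
Lemma cantor_family (gam : R) : -1 <= gam < 0 -> exists p1 p2 q2 kap : R,
  [/\ [/\ 0 < p1, p1 < p2 & p2 < 1], [/\ 1 < q2, q2 <= 2 & 0 < kap] &
  forall n : nat, exists F l, [/\ is_step F, rect_family p1 p2 q2 kap (1 + gam) F l &
    n%:R <= \sum_(b <- l) b.2 `^ (1 + gam)]].
Proof.
move=> /andP[g1 g0]; have [S sS] := @step_exists R.
have [ge|gn] := eqVneq gam (-1).
  exists 4^-1, 2^-1, 2, 1; split; [by split; lra|by split; lra|].
  have -> : 1 + gam = 0 by rewrite ge subrr.
  elim=> [|n [F [l [sF lF nl]]]].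
    by exists S, [::]; split; [exact: sS|split|rewrite big_nil].
  have [F' [l' [sF' lF' El]]] := cantor_step1 sF lF.
  by exists F', l'; split=> //; rewrite El -nat1r lerD2l.
pose e := 1 + gam; have e0 : 0 < e by rewrite /e; move: gn g1; case: ltgtP => //; lra.
(* The solution of r^e = 1/2; since e < 1 it is below 1/2, which leaves the middle gap. *)
pose r : R := 2^-1 `^ e^-1.
have h2 : 0 < 2^-1 :> R by rewrite invr_gt0.
have r0 : 0 < r by rewrite powR_gt0.
have re : r `^ e = 2^-1 by rewrite /r -powRrM mulVf ?gt_eqF// powRr1// ltW.
have e1 : e < 1 by rewrite /e; lra.
have r2 : r < 2^-1.
  have L0 : ln (2^-1 : R) < 0 by apply: ln_lt0; rewrite h2; lra.
  rewrite -[ltRHS](lnK (x := 2^-1)) ?posrE// /r /powR gt_eqF// ltr_expR.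
  by rewrite -[ltRHS]mul1r ltr_nM2r// invf_gt1.
have rV : 2 < r^-1 by rewrite -[2]invrK ltf_pV2// posrE.
exists r, (1 - r), (Num.min 2 (r^-1 - 1)), 2^-1; split.
- by split; lra.
- by split; rewrite ?lt_min ?ge_min ?lexx//; apply/andP; split; lra.
elim=> [|n [F [l [sF lF nl]]]].
  by exists S, [::]; split; [exact: sS|split|rewrite big_nil].
have [F' [l' [sF' lF' El]]] := cantor_step2 r0 r2 re (ltW e1) (ltW e0) sF lF.
by exists F', l'; split=> //; rewrite El -nat1r lerD2l.
Qed.

End CantorSteps.

(** * Tensor products *)

Section Tensors.
Context {R : realType}.
Notation leb := (@lebesgue_measure R).

Definition tensor n (a : R) (h : 'I_n -> R -> R) (x : n.-tuple R) : R :=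
  a * \prod_(i < n) h i (tnth x i).

Lemma econt_tensor n a (h : 'I_n -> R -> R) : (forall i, continuous (h i)) -> econt (tensor a h).
Proof.
move=> ch; apply: econtM; first exact: econt_cst.
by apply: econt_prod => i _; exact: econt_coord.
Qed.

Lemma tensor_pderiv n a (h : 'I_n -> R -> R) i (h' : R -> R) :
  (forall x : R, is_derive x 1 (h i) (h' x)) ->
  has_pderiv i (tensor a h) (tensor a (fun j => if j == i then h' else h j)).
Proof.
move=> dh; apply/has_pderivP => x.
pose c := a * \prod_(j < n | j != i) h j (tnth x j).
have E : (fun t : R => tensor a h (Defs.shift x i t)) = (fun t : R => c * h i (1 * t + tnth x i)).
  apply/funext => t; rewrite /tensor (bigD1 i)//= tnth_shift eqxx mul1r [t + _]addrC.
  rewrite /c -mulrA [_ * h i _]mulrC; congr (_ * (_ * _)).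
  by apply: eq_bigr => j /negbTE ji; rewrite tnth_shift ji addr0.
rewrite E (_ : tensor _ _ x = c * (1 * h' (1 * 0 + tnth x i))).
  by apply: is_derive1Z; exact: is_derive1_affine.
rewrite /tensor (bigD1 i)//= eqxx mulr0 add0r mul1r /c.
rewrite (eq_bigr (fun j => h j (tnth x j))); last by move=> j /negbTE ->.
by ring.
Qed.

(** The order of the letters of [s] is irrelevant: factor i is differentiated as often as i occurs.
    The last clause makes all derivatives vanish on a half-space, as needed to glue infinitely many
    spikes smoothly. *)
Lemma tensor_smooth n a (h : 'I_n -> R -> R) : (forall i, smooth1 (h i)) ->
  exists D : seq 'I_n -> n.-tuple R -> R,
    [/\ D [::] = tensor a h, forall s i, has_pderiv i (D s) (D (i :: s)),
        forall s, econt (D s) &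
        forall s i x z, (forall y, y <= z -> h i y = 0) -> tnth x i <= z -> D s x = 0].
Proof.
move=> sh; have [dh dhP] := choice (fun i => smooth1_iter (sh i)).
exists (fun s => tensor a (fun i => dh i (count_mem i s))); split.
- by congr tensor; apply/funext => i; have [-> _ _] := dhP i.
- move=> s i; rewrite (_ : tensor _ (fun j => dh j (count_mem j (i :: s))) =
      tensor a (fun j => if j == i then dh i (count_mem i s).+1 else dh j (count_mem j s))).
    by apply: tensor_pderiv; have [_ d _] := dhP i; exact: d.
  congr tensor; apply/funext => j /=.
  by case: eqVneq => [->|ji]; rewrite ?eqxx// eq_sym (negbTE ji).
- move=> s; apply: econt_tensor => i; apply: smooth1_continuous.
  by have [_ _ sd] := dhP i; exact: sd.
- move=> s i x z hz xz; rewrite /tensor (bigD1 i)//= (_ : dh i _ _ = 0) ?mul0r ?mulr0//.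
  have [d0 dS _] := dhP i.
  suff : forall k y, y <= z -> dh i k y = 0 by apply.
  elim=> [y yz|k IH]; first by rewrite d0 hz.
  exact: (derive_cst_le (dS k) IH).
Qed.

Lemma tint_tensor n a (h : 'I_n -> R -> R) (J : 'I_n -> R) : (forall i, continuous (h i)) ->
  (forall i, (\int[leb]_x (`|h i x|)%:E)%E = (J i)%:E) ->
  tint (fun x => (`|tensor a h x|)%:E) = (`|a| * \prod_(i < n) J i)%:E.
Proof.
move=> ch hJ.
have mh i : measurable_fun [set: R] (fun y => `|h i y|).
  by apply: measurableT_comp => //; exact: continuous_measurable_fun.
rewrite EFinM -(@tint_prod R n (fun i y => `|h i y|) J)//.
rewrite -tintZ//.
- by apply: eq_tint => x; rewrite /tensor normrM normr_prod.
- apply/measurable_EFinP; apply: measurable_prod => i _.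
  exact: (measurableT_comp (mh i) (measurable_tnth i)).
- by move=> x; rewrite lee_fin prodr_ge0.
Qed.

(** The total variation of a monotone step is its height, however steep it is. This is why extra
    generations are free in the W^{1,1} norm. *)
Lemma integral_step_derive (f f' : R -> R) a b : a < b -> {homo f : x y / x <= y} ->
  (forall x : R, is_derive x 1 f (f' x)) -> continuous f' ->
  (forall x, x <= a -> f x = 0) -> (forall x, b <= x -> f x = 1) ->
  (\int[leb]_x (`|f' x|)%:E)%E = 1%E.
Proof.
move=> ab hf df cf' f0 f1.
have f'0 := homo_derive_ge0 hf df.
under eq_integral do rewrite ger0_norm//.
rewrite (@integral_supp_itv _ _ a b); last first.
  move=> x; rewrite in_itv/= negb_and -!ltNge => /orP[/ltW xa|/ltW xb].
    by rewrite (derive_cst_le df f0).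
  by rewrite (derive_cst_ge df f1).
by rewrite (ftc_itv ab df cf') (f0 a)// (f1 b)// subr0.
Qed.

Lemma integral_le_fin (f : R -> R) (I : R) : (forall x, 0 <= f x) ->
  (\int[leb]_x (f x)%:E <= I%:E)%E -> exists2 J, (\int[leb]_x (f x)%:E)%E = J%:E & 0 <= J <= I.
Proof.
move=> f0 fI; have i0 : (0 <= \int[leb]_x (f x)%:E)%E.
  by apply: integral_ge0 => x _; rewrite lee_fin.
have fin : (\int[leb]_x (f x)%:E)%E \is a fin_num.
  by rewrite ge0_fin_numE// (le_lt_trans fI)// ltry.
by exists (fine (\int[leb]_x (f x)%:E)%E); rewrite ?fineK// -!lee_fin fineK// i0.
Qed.

(** The difference of F((x - o)/r) and its translate by 2r: it follows F up to o + 2r, is 1 on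
    [o + r, o + 2r], and is back at 0 from o + 3r on. The derivative costs 1 for the rise and 1 for
    the fall. *)
Lemma bump_exists (F : R -> R) (r o : R) : is_step F -> 0 < r -> exists h h' : R -> R,
  [/\ smooth1 h, forall x : R, is_derive x 1 h (h' x),
      forall x, 0 <= h x <= 1,
      forall x, (h x != 0) || (h' x != 0) -> o < x < o + 3 * r &
      forall x, x <= o + 2 * r -> h x = F ((x - o) / r)] /\
  exists J J' : R, [/\ (\int[leb]_x (`|h x|)%:E)%E = J%:E, 0 <= J <= 3 * r,
    (\int[leb]_x (`|h' x|)%:E)%E = J'%:E & 0 <= J' <= 2].
Proof.
move=> [sF hF F0 F1] r0.
pose st c x := 1 * F (r^-1 * x + - r^-1 * c).
have argE c x : r^-1 * x + - r^-1 * c = (x - c) / r by field; rewrite gt_eqF.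
have st0 c x : x <= c -> st c x = 0.
  by move=> xc; rewrite /st argE F0 ?mulr0// pmulr_lle0 ?invr_gt0// subr_le0.
have st1 c x : c + r <= x -> st c x = 1.
  by move=> cx; rewrite /st argE F1 ?mulr1// ler_pdivlMr// mul1r lerBrDl.
have hst c : {homo st c : x y / x <= y} by move=> x y; exact: homo_affine.
have sst c : smooth1 (st c) by exact: smooth1_affine.
have st01 c x : 0 <= st c x <= 1.
  apply/andP; split.
    by rewrite -(st0 c (Num.min x c)) ?ge_min ?lexx ?orbT//; apply: hst; rewrite ge_min lexx.
  by rewrite -(st1 c (Num.max x (c + r))) ?le_max ?lexx ?orbT//; apply: hst; rewrite le_max lexx.
have dst c : exists2 f' : R -> R, (forall x : R, is_derive x 1 (st c) (f' x)) & continuous f'.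
  have [f' df _] := sst c 1%N; exists f' => //.
  exact: smooth1_continuous (smooth1_derive (sst c) df).
have [f1 df1 cf1] := dst o; have [f2 df2 cf2] := dst (o + 2 * r).
have f1E := derive_cst_le df1 (st0 o); have f1E' := derive_cst_ge df1 (st1 o).
have f2E := derive_cst_le df2 (st0 _); have f2E' := derive_cst_ge df2 (st1 _).
pose h x := st o x + -1 * st (o + 2 * r) x.
pose h' x := f1 x + -1 * f2 x.
have h01 x : 0 <= h x <= 1.
  rewrite /h mulN1r subr_ge0 lerBlDr.
  have /andP[a0 a1] := st01 (o + 2 * r) x; have /andP[b0 b1] := st01 o x.
  rewrite (le_trans b1) ?lerDl// andbT /st !mul1r; apply: hF.
  by rewrite !argE ler_pM2r ?invr_gt0// lerD2l lerN2 lerDl mulr_ge0// ltW.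
have sh : smooth1 h.
  move=> m; apply: diffnD; first exact: sst.
  by apply: diffnM; [exact: diffn_cst|exact: sst].
have dh (x : R) : is_derive x 1 h (h' x).
  exact: is_derive1D.
have ch := smooth1_continuous sh.
have ch' := smooth1_continuous (smooth1_derive sh dh).
have hout x : ~~ (o < x < o + 3 * r) -> h x = 0 /\ h' x = 0.
  rewrite negb_and -!leNgt => /orP[xo|xo].
    have xo2 : x <= o + 2 * r by apply: le_trans xo _; rewrite lerDl mulr_ge0// ltW.
    by rewrite /h /h' !st0// f1E// f2E// mulr0 addr0.
  by rewrite /h /h' !st1 ?f1E' ?f2E' ?mulr0 ?addr0 ?mulr1 ?subrr//; lra.
exists h, h'; split.
  split=> //.
  - by move=> x; apply: contraTT => /hout[e1 e2]; rewrite e1 e2 eqxx.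
  - by move=> x xo; rewrite /h (st0 (o + 2 * r))// mulr0 addr0 /st argE mul1r.
have [|J EJ J0] := @integral_le_fin (fun x => `|h x|) (3 * r) (fun=> normr_ge0 _).
  have -> : 3 * r = 1 * ((o + 3 * r) - o) by ring.
  rewrite -integral_cst_itv; last by rewrite lerDl mulr_ge0// ltW.
  apply: ge0_le_integral => //.
  - by apply/measurable_EFinP; apply: measurableT_comp => //; exact: continuous_measurable_fun.
  - by apply/measurable_EFinP; exact: measurable_cst_itv.
  - move=> x _; rewrite lee_fin in_itv/=; case: ifPn => [_|xo].
      by have /andP[a0 a1] := h01 x; rewrite ger0_norm.
    have [|e1 _] := hout x; last by rewrite e1 normr0.
    by apply: contra xo => /andP[/ltW -> /ltW ->].
have [|J' EJ' J'0] := @integral_le_fin (fun x => `|h' x|) 2 (fun=> normr_ge0 _); last by exists J, J'.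
have m1 : measurable_fun [set: measurableTypeR R] (fun x => (`|f1 x|)%:E).
  by apply/measurable_EFinP; apply: measurableT_comp => //; exact: continuous_measurable_fun.
have m2 : measurable_fun [set: measurableTypeR R] (fun x => (`|f2 x|)%:E).
  by apply/measurable_EFinP; apply: measurableT_comp => //; exact: continuous_measurable_fun.
have or : o < o + r by rewrite ltrDl.
have or2 : o + 2 * r < o + 2 * r + r by rewrite ltrDl.
apply: (@le_trans _ _ (\int[leb]_x ((`|f1 x|)%:E + (`|f2 x|)%:E))%E).
  apply: ge0_le_integral => //.
  - by apply/measurable_EFinP; apply: measurableT_comp => //; exact: continuous_measurable_fun.
  - exact: emeasurable_funD.
  - by move=> x _; rewrite lee_fin /h' mulN1r ler_normB.
rewrite ge0_integralD//.
rewrite (integral_step_derive or (hst o) df1 cf1 (st0 o) (st1 o)).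
by rewrite (integral_step_derive or2 (hst _) df2 cf2 (st0 _) (st1 _)).
Qed.

End Tensors.

(** * Spikes *)

Section Spikes.
Context {R : realType}.
Notation leb := (@lebesgue_measure R).

Definition ind (a b x : R) : R := if x \in `[a, b] then 1 else 0.

Lemma ind_ge0 a b x : 0 <= ind a b x.
Proof. by rewrite /ind; case: ifP. Qed.

(** The corner [lo'] of the box of y may depend on x, so that the transverse coordinates of y stay
    close to those of x; the volume of that box does not depend on x. *)
Definition rect_ker n (c : R) (lo hi len : 'I_n -> R) (lo' : n.-tuple R -> 'I_n -> R)
    (z : n.-tuple R * n.-tuple R) : R :=
  c * \prod_(i < n) ind (lo i) (hi i) (tnth z.1 i) *
  \prod_(i < n) ind (lo' z.1 i) (lo' z.1 i + len i) (tnth z.2 i).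

Lemma rect_ker_ge0 n c lo hi len lo' z : 0 <= c -> 0 <= @rect_ker n c lo hi len lo' z.
Proof. by move=> c0; rewrite !mulr_ge0 ?prodr_ge0// => i _; exact: ind_ge0. Qed.

Lemma prod_ind_neq0 n (lo hi : 'I_n -> R) (x : n.-tuple R) :
  \prod_(i < n) ind (lo i) (hi i) (tnth x i) != 0 -> forall i, lo i <= tnth x i <= hi i.
Proof.
move=> /prodf_neq0 h i; have := h i isT.
by rewrite /ind in_itv/=; case: ifP; rewrite ?eqxx.
Qed.

Lemma prod_ind_le1 n (lo hi : 'I_n -> R) (x : n.-tuple R) :
  0 <= \prod_(i < n) ind (lo i) (hi i) (tnth x i) <= 1.
Proof.
rewrite prodr_ge0; last by move=> i _; exact: ind_ge0.
rewrite prodr_ile1// => i _; rewrite ind_ge0/= /ind.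
by case: ifP; rewrite ?ler01.
Qed.

Lemma measurable_rect_ker n c lo hi len lo' :
  (forall i, measurable_fun [set: n.-tuple R] (lo' ^~ i)) ->
  measurable_fun [set: (n.-tuple R * n.-tuple R)%type] (rect_ker c lo hi len lo').
Proof.
move=> ml; apply: measurable_funM; [apply: measurable_funM => //|];
  apply: measurable_prod => i _.
  apply: (measurableT_comp (@measurable_cst_itv R (lo i) (hi i) 1)).
  exact: measurableT_comp (measurable_tnth i) measurable_fst.
rewrite (_ : (fun z => _) = (fun z : n.-tuple R * n.-tuple R => ind 0 (len i) (tnth z.2 i - lo' z.1 i))).
  apply: (measurableT_comp (@measurable_cst_itv R 0 (len i) 1)).
  apply: measurable_funB.
    exact: measurableT_comp (measurable_tnth i) measurable_snd.
  exact: measurableT_comp (ml i) measurable_fst.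
by apply/funext => z; rewrite /ind !in_itv/= subr_ge0 lerBlDl.
Qed.

Lemma dint_rect_ker n c lo hi len lo' : 0 <= c -> (forall i, lo i <= hi i) ->
  (forall i, 0 <= len i) ->
  dint (fun z => (@rect_ker n c lo hi len lo' z)%:E) =
  (c * \prod_(i < n) len i * \prod_(i < n) (hi i - lo i))%:E.
Proof.
move=> c0 lohi len0.
rewrite -tint_box//; last by rewrite mulr_ge0// prodr_ge0.
apply: eq_tint => x.
pose P := \prod_(i < n) ind (lo i) (hi i) (tnth x i).
have P0 : 0 <= P by apply: prodr_ge0 => i _; exact: ind_ge0.
have := @tint_box R n (lo' x) (fun i => lo' x i + len i) (c * P).
rewrite mulr_ge0// => /(_ isT) ->; last by move=> i; rewrite lerDl.
congr _%:E; rewrite -/P mulrAC; congr (_ * _ * _).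
by apply: eq_bigr => i _; rewrite addrAC subrr add0r.
Qed.

Lemma le_powR_neg (u v e : R) : 0 < u -> u <= v -> e <= 0 -> v `^ e <= u `^ e.
Proof.
move=> u0 uv e0; have v0 := lt_le_trans u0 uv.
rewrite -[e]opprK !(powRN _ (- e)) lef_pV2 ?posrE ?powR_gt0//.
by apply: ge0_ler_powR; rewrite ?nnegrE ?oppr_ge0// ltW.
Qed.

Lemma powR_expM (s e : R) k : 0 < s -> s `^ e * s ^+ k = s `^ (e + k%:R).
Proof.
move=> s0; rewrite -powR_mulrn ?ltW// -powRD//.
by apply/implyP => _; rewrite gt_eqF.
Qed.

(** Here e = N + gam. A positive e lets a small r beat any C; for e = 0 shrinking does not help and
    C itself must be small. *)
Lemma scale_exists (e eps C : R) : 0 < eps -> 0 < C -> 0 <= e -> (0 < e \/ C <= eps) ->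
  exists r : R, [/\ 0 < r, r <= 1, 3 * r <= eps & C * r `^ e <= eps].
Proof.
move=> eps0 C0 e0 H.
pose r0 : R := Num.min 1 (eps / 3).
have r00 : 0 < r0 by rewrite lt_min ltr01 divr_gt0.
have r01 : r0 <= 1 by rewrite ge_min lexx.
have r03 : 3 * r0 <= eps.
  have : r0 <= eps / 3 by rewrite ge_min lexx orbT.
  by lra.
case: H => [e1|Ce].
  pose r1 := (eps / C) `^ e^-1.
  have r10 : 0 < r1 by apply: powR_gt0; rewrite divr_gt0.
  exists (Num.min r0 r1); split.
  - by rewrite lt_min r00.
  - by rewrite ge_min r01.
  - by apply: le_trans r03; rewrite ler_pM2l// ge_min lexx.
  - rewrite mulrC -ler_pdivlMr//.
    have m0 : 0 <= Num.min r0 r1 by rewrite le_min !ltW.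
    have m1 : Num.min r0 r1 <= r1 by rewrite ge_min lexx orbT.
    apply: le_trans (ge0_ler_powR e0 m0 (ltW r10) m1) _.
    by rewrite /r1 -powRrM mulVf ?gt_eqF// powRr1// divr_ge0// ltW.
exists r0; split=> //; apply: le_trans Ce; apply: ler_piMr; first exact: ltW.
apply: le_trans (ge0_ler_powR e0 (ltW r00) ler01 r01) _.
by rewrite powR1.
Qed.

Lemma seq_min_gt0 (T : eqType) (f : T -> R) (l : seq T) : (forall b, b \in l -> 0 < f b) ->
  exists2 eta, 0 < eta & forall b, b \in l -> eta <= f b.
Proof.
elim: l => [|b l IH] f0; first by exists 1.
have [c cl|eta eta0 etal] := IH; first by apply: f0; rewrite inE cl orbT.
exists (Num.min (f b) eta); first by rewrite lt_min eta0 f0// mem_head.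
move=> c; rewrite inE => /orP[/eqP ->|/etal h]; rewrite ge_min ?lexx//.
by rewrite h orbT.
Qed.

Lemma nat_above (x : R) : exists n : nat, x <= n%:R.
Proof.
exists (Num.bound `|x|); apply: le_trans (ler_norm x) _.
by apply: ltW; apply: archi_boundP; exact: normr_ge0.
Qed.

End Spikes.

(** * Construction of a single spike *)

Section Spikes.
Context {R : realType}.
Notation leb := (@lebesgue_measure R).

Lemma in_slab_norm (tau o r x : R) : o = tau \/ o = 0 -> 3 * r <= 1 -> o <= x <= o + 3 * r ->
  `|x| <= `|tau| + 1.
Proof.
move=> ho r3 /andP[x1 x2]; have h1 := ler_norm tau.
have := lerNnormlW (lexx `|tau|); have h0 := normr_ge0 tau.
rewrite ler_norml; case: ho x1 x2 => -> x1 x2 h2; apply/andP; split; lra.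
Qed.

(** On a rectangle the distance of the two points is comparable to the scale s, from both sides: the
    upper bound feeds the oscillation and kernel estimates, the lower one the separation from the
    diagonal. *)
Lemma in_rect_bounds p1 p2 q2 (t s X Y : R) : 0 < p1 -> p1 < p2 -> p2 < 1 -> 1 < q2 -> q2 <= 2 ->
  0 < s -> s <= 1 -> 0 <= t -> t + s * q2 <= q2 -> in_rect p1 p2 q2 X Y (t, s) ->
  [/\ 0 < X, X < Y, Y <= 2, s * (1 - p2) <= Y - X & Y - X <= 2 * s].
Proof.
move=> p10 p12 p21 q21 q22 s0 s1 t0 tq /and4P[/= X1 X2 Y1 Y2].
have sp1 : 0 < s * p1 by rewrite mulr_gt0.
have sp : s * p1 < s * p2 by rewrite ltr_pM2l.
have sq : s * q2 <= s * 2 by rewrite ler_pM2l.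
have sp2 : 0 < s * (1 - p2) by rewrite mulr_gt0// subr_gt0.
split; lra.
Qed.

(* [k] is a kernel dominated by |x - y|^(gam - N) and living where [phi] oscillates more
   than [lam |x - y|^(1 + gam)]; its mass bounds nu(E_lam[phi]) from below, robustly. *)
Definition spike n (gam lam eps tau B M : R) (phi : n.+1.-tuple R -> R)
    (D : seq 'I_n.+1 -> n.+1.-tuple R -> R) (k : n.+1.-tuple R * n.+1.-tuple R -> R) :=
  [/\ [/\ D [::] = phi, forall s i, has_pderiv i (D s) (D (i :: s)),
          forall s, econt (D s) & forall s x, tnth x ord0 <= tau -> D s x = 0],
      [/\ forall x, `|phi x| <= B,
          forall x, phi x != 0 -> forall i, `|tnth x i| <= `|tau| + 1,
          forall i x, (phi x != 0) || (D [:: i] x != 0) -> tau < tnth x ord0 < tau + eps,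
          (tint (fun x => (`|phi x|)%:E) <= eps%:E)%E &
          forall i, (tint (fun x => (`|D [:: i] x|)%:E) <= eps%:E)%E],
      [/\ measurable_fun [set: (n.+1.-tuple R * n.+1.-tuple R)%type] k,
          forall z, 0 <= k z,
          forall x y, k (x, y) != 0 ->
            [/\ lam * enorm (tsub x y) `^ (1 + gam) < `|phi x - phi y|,
                tau < tnth x ord0 < tau + eps & tau < tnth y ord0 < tau + eps],
          forall x y, k (x, y) <= enorm (tsub x y) `^ (gam - n.+1%:R) &
          (M%:E <= dint (fun z => (k z)%:E))%E] &
      exists2 eta, 0 < eta & forall x y, k (x, y) != 0 -> eta <= enorm (tsub x y) /\
        forall i, `|tnth x i| <= `|tau| + 1 /\ `|tnth y i| <= `|tau| + 1].

(** Constants are fixed in this order: C0 from the dimension and gam alone, then the width r from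
    lam and eps, and last the number m of generations from M. Only m depends on M, and the norm
    bounds do not see it. *)
Lemma spike_exists n (gam : R) : -1 <= gam < 0 -> exists2 C0, 0 < C0 &
  forall lam eps tau M : R, 0 < lam -> 0 < eps -> eps <= 1 ->
    0 < n.+1%:R + gam \/ C0 * lam <= eps ->
    exists phi D k, @spike n gam lam eps tau (C0 * lam) M phi D k.
Proof.
move=> hgam; have /andP[g1 g0] := hgam.
have [p1 [p2 [q2 [kap [[p10 p12 p21] [q21 q22 kap0] cf]]]]] := cantor_family hgam.
have [S sS] := @step_exists R.
pose sN : R := Num.sqrt n.+1%:R.
have sN0 : 0 < sN by rewrite sqrtr_gt0 ltr0n.
pose B1 : R := (sN * 2) `^ (1 + gam).
have B10 : 0 < B1 by apply: powR_gt0; rewrite mulr_gt0.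
(* On a rectangle of scale s one has |x - y|^(1 + gam) <= B1 (s r)^(1 + gam); the 1 added to B1
   makes the oscillation inequality strict. *)
pose A0 := (B1 + 1) / kap.
have A00 : 0 < A0 by rewrite divr_gt0// addr_gt0.
have A0k : A0 * kap = B1 + 1 by rewrite divfK// gt_eqF.
(* Large enough for the sup bound a <= C0 lam and for both L^1 bounds: a (3r)^(n+1) for the spike, 2
   a (3r)^n for a partial derivative. *)
pose C0 := 2 * 3 ^+ n.+1 * A0.
have C00 : 0 < C0.
  by apply: mulr_gt0 => //; apply: mulr_gt0 => //; apply: exprn_gt0.
have A0C : A0 <= C0.
  rewrite /C0 ler_peMl ?ltW//.
  have : 1 <= 3 ^+ n.+1 :> R by rewrite exprn_ege1// ler1n.
  lra.
exists C0 => // lam eps tau M lam0 eps0 eps1 H.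
pose e := n.+1%:R + gam.
have e0 : 0 <= e.
  have : 1 <= n.+1%:R :> R by rewrite ler1n.
  by rewrite /e; lra.
have [r [r0 r1 r3 Cr]] : exists r : R, [/\ 0 < r, r <= 1, 3 * r <= eps & (C0 * lam) * r `^ e <= eps].
  by apply: scale_exists => //; rewrite mulr_gt0.
pose a := lam * r `^ (1 + gam) * A0.
have a0 : 0 < a.
  by apply: mulr_gt0 => //; apply: mulr_gt0 => //; exact: powR_gt0.
have rn : r `^ (1 + gam) * r ^+ n = r `^ e.
  by rewrite powR_expM//; congr powR; rewrite /e -natr1; ring.
have alam : a <= C0 * lam.
  have g10 : 0 <= 1 + gam by lra.
  have rp : r `^ (1 + gam) <= 1.
    by apply: le_trans (ge0_ler_powR g10 (ltW r0) ler01 r1) _; rewrite powR1.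
  rewrite /a mulrAC [leRHS]mulrC; apply: (@le_trans _ _ (lam * A0)); last by rewrite ler_pM2l.
  by apply: ler_piMr => //; rewrite mulr_ge0 ?ltW.
(* The kernel mass of one rectangle with its powers of r and s removed. *)
pose C1 := (sN * 2) `^ (gam - n.+1%:R) * ((q2 - 1) * (2^-1) ^+ n) * ((p2 - p1) * (2^-1) ^+ n).
have C10 : 0 < C1.
  have V0 : 0 < (2^-1 : R) ^+ n by rewrite exprn_gt0// invr_gt0.
  apply: mulr_gt0; last by rewrite mulr_gt0// subr_gt0.
  apply: mulr_gt0; last by rewrite mulr_gt0// subr_gt0.
  by apply: powR_gt0; rewrite mulr_gt0.
have [m hm] := nat_above (M / (C1 * r `^ e)).
have [F [l [sF [lP lc lk] lm]]] := cf m.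
have [h0 [h0' [[sh0 dh0 h01 hs0 hF] [J0 [J0' [EJ0 bJ0 EJ0' bJ0']]]]]] := bump_exists tau sF r0.
have [h1 [h1' [[sh1 dh1 h11 hs1 hS] [J1 [J1' [EJ1 bJ1 EJ1' bJ1']]]]]] := bump_exists 0 sS r0.
(* Only the first factor carries the Cantor-type step; the others are fixed cutoffs, equal to 1 on
   [r, 2r]. *)
pose h (i : 'I_n.+1) := if i == ord0 then h0 else h1.
pose h' (i : 'I_n.+1) := if i == ord0 then h0' else h1'.
have sh i : smooth1 (h i) by rewrite /h; case: ifP.
have dh i (x : R) : is_derive x 1 (h i) (h' i x) by rewrite /h /h'; case: ifP.
have [D [D0 DS cD Dz]] := tensor_smooth a sh.
pose phi := tensor a h.
have ch i := smooth1_continuous (sh i).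
have ch' i := smooth1_continuous (smooth1_derive (sh i) (dh i)).
have D1 i : D [:: i] = tensor a (fun j => if j == i then h' i else h j).
  have := DS [::] i; rewrite D0 => d1.
  exact: (has_pderiv_unique d1 (@tensor_pderiv R _ a h i (h' i) (dh i))).
have hh i x : 0 <= h i x <= 1 by rewrite /h; case: ifP.
pose J i := if i == ord0 :> 'I_n.+1 then J0 else J1.
pose J' i := if i == ord0 :> 'I_n.+1 then J0' else J1'.
have EJ i : (\int[leb]_x (`|h i x|)%:E)%E = (J i)%:E by rewrite /h /J; case: ifP.
have EJ' i : (\int[leb]_x (`|h' i x|)%:E)%E = (J' i)%:E by rewrite /h' /J'; case: ifP.
have bJ i : 0 <= J i <= 3 * r by rewrite /J; case: ifP.
have bJ' i : 0 <= J' i <= 2 by rewrite /J'; case: ifP.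
pose o (i : 'I_n.+1) := if i == ord0 then tau else 0.
have hsupp i x : (h i x != 0) || (h' i x != 0) -> o i < x < o i + 3 * r.
  by rewrite /h /h' /o; case: ifP => _; [exact: hs0|exact: hs1].
have phisupp x : phi x != 0 -> forall i, o i < tnth x i < o i + 3 * r.
  rewrite mulf_eq0 negb_or => /andP[_ /prodf_neq0 nz] i.
  by apply: hsupp; rewrite nz.
have Dsupp i x : D [:: i] x != 0 -> forall j, o j < tnth x j < o j + 3 * r.
  rewrite D1 mulf_eq0 negb_or => /andP[_ /prodf_neq0 nz] j.
  apply: hsupp; have /= := nz j isT.
  by case: ifP => [/eqP ->|_] nj; rewrite nj ?orbT.
have oB i x : o i <= x <= o i + 3 * r -> `|x| <= `|tau| + 1.
  apply: in_slab_norm; last exact: le_trans eps1.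
  by rewrite /o; case: ifP; [left|right].
have phi1 x : `|phi x| <= C0 * lam.
  rewrite normrM gtr0_norm//; apply: le_trans alam.
  apply: ler_piMr; first exact: ltW.
  rewrite normr_prod prodr_ile1// => i _.
  by rewrite normr_ge0/=; have /andP[z0 z1] := hh i (tnth x i); rewrite ger0_norm.
have phin : (tint (fun x => (`|phi x|)%:E) <= eps%:E)%E.
  rewrite (tint_tensor a ch EJ) lee_fin gtr0_norm//.
  apply: le_trans Cr.
  apply: (@le_trans _ _ (a * \prod_(i < n.+1) (3 * r))).
    by rewrite ler_pM2l//; apply: ler_prod.
  rewrite prodr_const card_ord exprMn [r ^+ n.+1]exprSr.
  have -> : a * (3 ^+ n.+1 * (r ^+ n * r)) = 3 ^+ n.+1 * A0 * lam * (r `^ (1 + gam) * r ^+ n) * r.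
    by rewrite /a; ring.
  rewrite rn (_ : C0 * lam * _ = 2 * (3 ^+ n.+1 * A0 * lam * r `^ e)); last by rewrite /C0; ring.
  have X0 : 0 <= 3 ^+ n.+1 * A0 * lam * r `^ e.
    apply: mulr_ge0 (powR_ge0 _ _); apply: mulr_ge0 (ltW lam0).
    by apply: mulr_ge0 (ltW A00); rewrite exprn_ge0.
  apply: le_trans (ler_wpM2l X0 r1) _; rewrite mulr1.
  by apply: ler_peMl => //; rewrite ler1n.
have Dn i : (tint (fun x => (`|D [:: i] x|)%:E) <= eps%:E)%E.
  rewrite D1 (@tint_tensor R _ a _ (fun j => if j == i then J' i else J j)); last 2 first.
  - by move=> j; case: ifP.
  - by move=> j; case: ifP.
  rewrite lee_fin gtr0_norm//; apply: le_trans Cr.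
  apply: (@le_trans _ _ (a * (2 * (3 * r) ^+ n))).
    rewrite ler_pM2l// (bigD1 i)//= eqxx.
    apply: ler_pM; [by have /andP[] := bJ' i| |by have /andP[] := bJ' i|].
      by apply: prodr_ge0 => j /negbTE ->; have /andP[] := bJ j.
    apply: (@le_trans _ _ (\prod_(j < n.+1 | j != i) (3 * r))).
      by apply: ler_prod => j /negbTE ->.
    by rewrite prodr_const cardC1 card_ord.
  rewrite exprMn.
  have -> : a * (2 * (3 ^+ n * r ^+ n)) = 2 * 3 ^+ n * A0 * lam * (r `^ (1 + gam) * r ^+ n).
    by rewrite /a; ring.
  rewrite rn (_ : C0 * lam * _ = 6 * (3 ^+ n * A0 * lam * r `^ e)); last by rewrite /C0 exprS; ring.
  rewrite (_ : 2 * _ * _ * _ * _ = 2 * (3 ^+ n * A0 * lam * r `^ e)); last by ring.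
  have X0 : 0 <= 3 ^+ n * A0 * lam * r `^ e.
    apply: mulr_ge0 (powR_ge0 _ _); apply: mulr_ge0 (ltW lam0).
    by apply: mulr_ge0 (ltW A00); rewrite exprn_ge0.
  by rewrite ler_wpM2r// ler_nat.
(* Transversally x_i ranges over [r, 3r/2] and y_i over [x_i, x_i + s r/2] with s <= 1, so both stay
   on the plateau of the cutoff and only the first coordinate changes the spike. *)
pose lo (b : R * R) (i : 'I_n.+1) := if i == ord0 then tau + r * (b.1 + b.2 * p1) else r.
pose hi (b : R * R) (i : 'I_n.+1) := if i == ord0 then tau + r * (b.1 + b.2 * p2) else 3 / 2 * r.
pose len (b : R * R) (i : 'I_n.+1) := if i == ord0 then r * b.2 * (q2 - 1) else b.2 * r * 2^-1.
pose lo' (b : R * R) (x : n.+1.-tuple R) (i : 'I_n.+1) :=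
  if i == ord0 then tau + r * (b.1 + b.2) else tnth x i.
pose E := gam - n.+1%:R.
(* As E < 0, this is a lower bound for |x - y|^E on the rectangle. *)
pose c (b : R * R) := (sN * 2 * (b.2 * r)) `^ E.
pose K b := rect_ker (c b) (lo b) (hi b) (len b) (lo' b).
pose k z := \sum_(b <- l) K b z.
have c0 b : 0 <= c b by exact: powR_ge0.
have K0 b z : 0 <= K b z by exact: rect_ker_ge0.
have mK b : measurable_fun [set: (n.+1.-tuple R * n.+1.-tuple R)%type] (K b).
  apply: measurable_rect_ker => i; rewrite /lo'; case: (i == ord0) => //.
  exact: measurable_tnth.
have Kin b x y : K b (x, y) != 0 ->
  [/\ in_rect p1 p2 q2 ((tnth x ord0 - tau) / r) ((tnth y ord0 - tau) / r) b,
      forall i, i != ord0 -> r <= tnth x i <= 3 / 2 * r &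
      forall i, i != ord0 -> tnth x i <= tnth y i <= tnth x i + b.2 * r * 2^-1].
  rewrite /K /rect_ker /= !mulf_eq0 !negb_or -andbA => /and3P[_ /prod_ind_neq0 hx /prod_ind_neq0 hy].
  split.
  - have := hx ord0; have := hy ord0; rewrite /lo /hi /lo' /len eqxx => /andP[y1 y2] /andP[x1 x2].
    apply/and4P; split.
    + by rewrite ler_pdivlMr// mulrC lerBrDl.
    + by rewrite ler_pdivrMr// mulrC lerBlDl.
    + by rewrite ler_pdivlMr// mulrC lerBrDl.
    + by rewrite ler_pdivrMr// mulrC lerBlDl; apply: le_trans y2 _; rewrite le_eqVlt; apply/orP; left; apply/eqP; ring.
  - by move=> i i0; have := hx i; rewrite /lo /hi (negbTE i0).
  - by move=> i i0; have := hy i; rewrite /lo' /len (negbTE i0).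
have flat1 i y : i != ord0 -> r <= y <= 3 / 2 * r + r / 2 -> h i y = 1.
  move=> /negbTE i0 /andP[y1 y2]; rewrite /h i0 hS; last by clear - y2 r0; lra.
  by have [_ _ _ ->] := sS; rewrite // subr0 ler_pdivlMr// mul1r.
have phiE x : (forall i, i != ord0 -> r <= tnth x i <= 3 / 2 * r + r / 2) ->
    (tnth x ord0 - tau) / r <= 2 -> phi x = a * F ((tnth x ord0 - tau) / r).
  move=> xi x0; rewrite /phi /tensor big_ord_recl big1; last first.
    by move=> i _; apply: flat1 => //; exact: xi.
  rewrite mulr1 /h eqxx hF//; move: x0; rewrite ler_pdivrMr// lerBlDl; exact.
have main b x y : b \in l -> K b (x, y) != 0 ->
  [/\ forall i, `|tnth (tsub x y) i| <= 2 * (b.2 * r),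
      b.2 * r * (1 - p2) <= `|tnth (tsub x y) ord0|,
      a * (kap * b.2 `^ (1 + gam)) <= `|phi x - phi y|,
      forall i, o i < tnth x i < o i + 3 * r &
      forall i, o i < tnth y i < o i + 3 * r].
  move=> bl /Kin[hin hx hy]; have [s0 s1 t0 tq] := lP _ bl.
  have sr0 : 0 < b.2 * r by rewrite mulr_gt0.
  have srr : b.2 * r <= r by rewrite ler_piMl// ltW.
  set X := (tnth x ord0 - tau) / r in hin; set Y := (tnth y ord0 - tau) / r in hin.
  have xE : tnth x ord0 = tau + r * X by rewrite /X; field; rewrite gt_eqF.
  have yE : tnth y ord0 = tau + r * Y by rewrite /Y; field; rewrite gt_eqF.
  have /and4P[X1 X2 Y1 Y2] := hin.
  have inb : in_rect p1 p2 q2 X Y (b.1, b.2) by [].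
  have [X0 XY Y2' XY1 XY2] := in_rect_bounds p10 p12 p21 q21 q22 s0 s1 t0 tq inb.
  have rXY1 : r * (b.2 * (1 - p2)) <= r * (Y - X) by rewrite ler_pM2l.
  have rXY2 : r * (Y - X) <= r * (2 * b.2) by rewrite ler_pM2l.
  have rX : 0 < r * X by rewrite mulr_gt0.
  have rY : r * X < r * Y by rewrite ltr_pM2l.
  have rY2 : r * Y <= r * 2 by rewrite ler_pM2l.
  have dE : tnth (tsub x y) ord0 = - (r * (Y - X)) by rewrite tnth_tsub xE yE; ring.
  have d0 : 0 <= r * (Y - X) by rewrite mulr_ge0 ?ltW// subr_gt0.
  have hy' i : i != ord0 -> [/\ r <= tnth x i, tnth x i <= 3 / 2 * r, r <= tnth y i,
      tnth y i <= 2 * r & `|tnth x i - tnth y i| <= 2 * (b.2 * r)].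
    move=> i0; have /andP[a1 a2] := hx i i0; have /andP[b1 b2] := hy i i0.
    rewrite distrC ger0_norm ?subr_ge0//.
    by clear - a1 a2 b1 b2 sr0 srr; split; lra.
  split.
  - move=> i; have [->|i0] := eqVneq i ord0.
      rewrite dE normrN ger0_norm//; apply: le_trans rXY2 _.
      by rewrite mulrCA [r * _]mulrC.
    by rewrite tnth_tsub; have [] := hy' i i0.
  - by rewrite dE normrN ger0_norm// mulrAC mulrC.
  - rewrite !phiE//.
    + rewrite -/X -/Y -mulrBr normrM gtr0_norm// ler_pM2l// distrC.
      by apply: le_trans (ler_norm _); exact: lk bl hin.
    + move=> i i0; have [_ _ b1 b2 _] := hy' i i0.
      by clear - b1 b2; apply/andP; split; lra.
    + move=> i i0; have [a1 a2 _ _ _] := hy' i i0.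
      by clear - a1 a2 r0; apply/andP; split; lra.
    + by rewrite -/X; apply: le_trans (ltW XY) _.
  - move=> i; rewrite /o; have [->|i0] := eqVneq i ord0.
      by rewrite xE; clear - rX rY rY2 r0; apply/andP; split; lra.
    by have [a1 a2 _ _ _] := hy' i i0; clear - a1 a2 r0; apply/andP; split; lra.
  - move=> i; rewrite /o; have [->|i0] := eqVneq i ord0.
      by rewrite yE; clear - rX rY rY2 r0; apply/andP; split; lra.
    by have [_ _ a1 a2 _] := hy' i i0; clear - a1 a2 r0; apply/andP; split; lra.
have kneq z : k z != 0 -> exists2 b, b \in l & K b z != 0.
  have [/hasP//|/hasPn hn] := boolP (has (fun b => K b z != 0) l).
  rewrite /k big1_seq ?eqxx// => b /andP[_ /hn].
  by rewrite negbK => /eqP.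
have enle b x y : b \in l -> K b (x, y) != 0 ->
    0 < enorm (tsub x y) /\ enorm (tsub x y) <= sN * 2 * (b.2 * r).
  move=> bl nz; have [d1 d2 _ _ _] := main _ _ _ bl nz; have [s0 _ _ _] := lP _ bl.
  split; last first.
    by rewrite -mulrA; apply: enorm_le => //; rewrite !mulr_ge0 ?ltW.
  apply: lt_le_trans (tnth_le_enorm _ ord0); apply: lt_le_trans d2.
  by rewrite !mulr_gt0// subr_gt0.
(* The family is finite, so its smallest scale keeps the kernel away from the diagonal. *)
have [eta eta0 etal] : exists2 eta, 0 < eta & forall b, b \in l -> eta <= b.2 * r * (1 - p2).
  apply: (@seq_min_gt0 R _ (fun b => b.2 * r * (1 - p2))) => b /lP[s0 _ _ _].
  by rewrite !mulr_gt0// subr_gt0.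
exists phi, D, k; split.
- split=> // s x x0; apply: (Dz s ord0 x tau) => // y yt.
  apply/eqP; apply: contraT => hy; have := hsupp ord0 y; rewrite hy => /(_ isT).
  by rewrite /o eqxx ltNge yt.
- split=> //.
  + move=> x /phisupp px i; apply: (oB i); have /andP[h2 h3] := px i.
    by rewrite !ltW.
  + move=> i x /orP[/phisupp|/Dsupp] /(_ ord0); rewrite /o eqxx => /andP[-> h2] /=;
    by apply: lt_le_trans h2 _; rewrite lerD2l.
- split.
  + exact: measurable_sum.
  + by move=> z; exact: sumr_ge0.
  + move=> x y /kneq[b bl nz]; have [d1 d2 d3 d4 d5] := main _ _ _ bl nz.
    have [en0 en1] := enle _ _ _ bl nz; have [s0 _ _ _] := lP _ bl.
    split; last 2 first.
    * have := d4 ord0; rewrite /o eqxx => /andP[-> h2] /=.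
      by apply: lt_le_trans h2 _; rewrite lerD2l.
    * have := d5 ord0; rewrite /o eqxx => /andP[-> h2] /=.
      by apply: lt_le_trans h2 _; rewrite lerD2l.
    apply: lt_le_trans d3.
    have g10 : 0 <= 1 + gam by rewrite -lerBlDl sub0r.
    apply: (@le_lt_trans _ _ (lam * (sN * 2 * (b.2 * r)) `^ (1 + gam))).
      rewrite ler_pM2l//; apply: (ge0_ler_powR g10) => //.
        by rewrite nnegrE ltW.
      by rewrite nnegrE; apply: le_trans en1; exact: ltW.
    rewrite powRM ?mulr_ge0 ?ltW// -/B1 powRM ?ltW//.
    have -> : a * (kap * b.2 `^ (1 + gam)) = lam * r `^ (1 + gam) * b.2 `^ (1 + gam) * (A0 * kap).
      by rewrite /a; ring.
    have X0 : 0 < lam * r `^ (1 + gam) * b.2 `^ (1 + gam).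
      by apply: mulr_gt0; [apply: mulr_gt0 => //|]; exact: powR_gt0.
    rewrite A0k mulrDr mulr1 (_ : lam * (B1 * _) = lam * r `^ (1 + gam) * b.2 `^ (1 + gam) * B1).
      by rewrite ltrDl.
    by ring.
  + move=> x y; set w := enorm _ `^ _.
    (* Disjointness of the rectangles: at most one term is nonzero, so the sum of kernels obeys the
       bound of a single one. *)
    apply: (@le_trans _ _ (\sum_(b <- l)
      (if in_rect p1 p2 q2 ((tnth x ord0 - tau) / r) ((tnth y ord0 - tau) / r) b then w else 0))).
      rewrite /k !big_seq; apply: ler_sum => b bl.
      have [->|nz] := eqVneq (K b (x, y)) 0; first by case: ifP => // _; exact: powR_ge0.
      have [-> _ _] := Kin _ _ _ nz; have [en0 en1] := enle _ _ _ bl nz.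
      apply: (@le_trans _ _ (c b)); last by apply: le_powR_neg => //; rewrite /E subr_le0 (le_trans (ltW g0)).
      rewrite /K /rect_ker -mulrA; apply: ler_piMr => //.
      have /andP[u0 u1] := prod_ind_le1 (lo b) (hi b) x.
      have /andP[v0 v1] := prod_ind_le1 (lo' b x) (fun i => lo' b x i + len b i) y.
      by apply: mulr_ile1.
    rewrite -big_mkcond big_const_seq iter_addr addr0.
    have := lc ((tnth x ord0 - tau) / r) ((tnth y ord0 - tau) / r).
    case: (count _ _) => [|[|]]// _; first by rewrite mulr0n; exact: powR_ge0.
  + rewrite (_ : (fun z => _) = (fun z => \sum_(b <- l) (K b z)%:E)%E); last first.
      by apply/funext => z; rewrite sumEFin.
    rewrite dint_sum; last 2 first.
    * by move=> b; exact/measurable_EFinP.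
    * by move=> b z; rewrite lee_fin.
    rewrite (eq_big_seq (fun b => (C1 * r `^ e * b.2 `^ (1 + gam))%:E)); last first.
      move=> b /lP[s0 s1 t0 tq]; rewrite /K dint_rect_ker//; last 2 first.
      * move=> i; rewrite /lo /hi; case: ifP => _; last by clear - r0; lra.
        by rewrite lerD2l ler_pM2l// lerD2l ler_pM2l// ltW.
      * move=> i; rewrite /len; case: ifP => _.
          by rewrite mulr_ge0 ?subr_ge0 ?ltW// mulr_gt0.
        by apply: mulr_ge0; rewrite ?invr_ge0//; apply: mulr_ge0; exact: ltW.
      congr _%:E; rewrite !big_ord_recl.
      have -> : \prod_(i < n) len b (lift ord0 i) = (b.2 * r * 2^-1) ^+ n.
        by rewrite (eq_bigr (fun=> b.2 * r * 2^-1))// prodr_const card_ord.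
      have -> : \prod_(i < n) (hi b (lift ord0 i) - lo b (lift ord0 i)) = (r * 2^-1) ^+ n.
        rewrite (eq_bigr (fun=> r * 2^-1)) ?prodr_const ?card_ord// => i _.
        by rewrite /lo /hi /=; field.
      rewrite /len /lo /hi eqxx /c.
      rewrite powRM; [|by rewrite mulr_ge0 ?ltW|by rewrite mulr_ge0 ?ltW].
      rewrite [(b.2 * r) `^ _]powRM; [|by rewrite ltW|by rewrite ltW].
      (* Besides the factor (s r)^E, the two boxes contribute n + 1 powers of r each, whereas s
         enters n + 1 times through the box of y and once through that of x. Hence the weights s^(1
         + gam) of [cantor_family]. *)
      rewrite (_ : e = E + (n + n + 2)%:R); last by rewrite /e /E !natrD -natr1; ring.
      rewrite (_ : 1 + gam = E + (n + 2)%:R); last by rewrite /E !natrD -natr1; ring.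
      rewrite -!powR_expM// /C1 -/E !exprD !exprMn; ring.
    rewrite sumEFin -mulr_sumr lee_fin mulrC.
    apply: le_trans (ler_wpM2r _ lm); last by rewrite mulr_ge0 ?powR_ge0 ?ltW.
    by rewrite -ler_pdivrMr// mulr_gt0// powR_gt0.
- exists eta => // x y /kneq[b bl nz]; have [d1 d2 d3 d4 d5] := main _ _ _ bl nz.
  split; first by apply: le_trans (tnth_le_enorm _ ord0); apply: le_trans d2; exact: etal.
  move=> i; split; apply: (oB i).
    by have /andP[u1 u2] := d4 i; rewrite !ltW.
  by have /andP[u1 u2] := d5 i; rewrite !ltW.
Qed.

End Spikes.

(** * Lower bounds and stability *)

Section NuBounds.
Context {R : realType}.

Lemma spike_W11 n (gam lam eps tau B M : R) phi D k : @spike R n gam lam eps tau B M phi D k ->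
  [/\ econt phi, compact_supp phi, L1 phi, forall i, L1 (D [:: i]) &
      weak_grad phi (fun i => D [:: i])].
Proof.
move=> [[D0 DS cD _] [_ supp _ _ _] _ _].
have cphi : econt phi by rewrite -D0.
have dphi i : has_pderiv i phi (D [:: i]) by rewrite -D0.
have sphi : compact_supp phi.
  exists (Num.sqrt n.+1%:R * (`|tau| + 1)) => x xM; apply/eqP; apply: contraTT xM => px.
  by rewrite -leNgt; apply: enorm_le; [rewrite addr_ge0|exact: supp].
split=> //; first exact: L1_econt.
  by move=> i; apply: L1_econt => //; exact: has_pderiv_supp (dphi i) sphi.
exact: weak_grad_pderiv.
Qed.

Lemma enorm_tsub_eq0 n (x y : n.-tuple R) : (enorm (tsub x y) == 0) = (x == y).
Proof.
apply/idP/eqP => [/eqP h|->].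
  apply: eq_from_tnth => i; apply/eqP; rewrite -subr_eq0 -tnth_tsub -normr_le0 -h.
  exact: tnth_le_enorm.
rewrite /enorm big1 ?sqrtr0// => i _.
by rewrite tnth_tsub subrr expr0n.
Qed.

(** The integrand of [nu] in a visibly measurable form: x <> y becomes d > 0, and the quotient is
    cleared. *)
Definition nuk n (u : n.-tuple R -> R) (lam gam : R) (z : n.-tuple R * n.-tuple R) : R :=
  let d := enorm (tsub z.1 z.2) in
  if (0 < d) && (lam * d `^ (1 + gam) < `|u z.1 - u z.2|) then d `^ (gam - n%:R) else 0.

Lemma nuk_ge0 n (u : n.-tuple R -> R) lam gam z : 0 <= nuk u lam gam z.
Proof. by rewrite /nuk; case: ifP => // _; exact: powR_ge0. Qed.

Lemma nuE n (u : n.-tuple R -> R) lam gam :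
  nu gam (Elg u lam gam) = dint (fun z => (nuk u lam gam z)%:E).
Proof.
apply: eq_tint => x; apply: eq_tint => y; rewrite /nuk /=.
have [->|xy] := eqVneq x y.
  rewrite asboolF; last by move=> [].
  by have /eqP -> : enorm (tsub y y) == 0; rewrite ?enorm_tsub_eq0// ltxx.
have d0 : 0 < enorm (tsub x y) by rewrite lt_neqAle enorm_ge0 eq_sym enorm_tsub_eq0 xy.
rewrite d0 /= -ltr_pdivlMr ?powR_gt0//.
case: ifPn => [/asboolP[[_ ->]]//|/asboolPn h]; case: ifPn => // h1.
by exfalso; apply: h; split; [split => //|]; apply/eqP.
Qed.

Lemma measurable_dist n :
  measurable_fun [set: (n.-tuple R * n.-tuple R)%type] (fun z => enorm (tsub z.1 z.2)).
Proof.
apply: measurable_enorm => i; under eq_fun do rewrite tnth_tsub.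
by apply: measurable_funB; apply: measurableT_comp (measurable_tnth i) _;
  [exact: measurable_fst|exact: measurable_snd].
Qed.

Lemma measurable_osc n (u : n.-tuple R -> R) : measurable_fun [set: n.-tuple R] u ->
  measurable_fun [set: (n.-tuple R * n.-tuple R)%type] (fun z => `|u z.1 - u z.2|).
Proof.
move=> mu; apply: measurableT_comp => //; apply: measurable_funB.
  exact: measurableT_comp mu measurable_fst.
exact: measurableT_comp mu measurable_snd.
Qed.

Lemma measurable_osc_gt n (u : n.-tuple R -> R) lam gam : measurable_fun [set: n.-tuple R] u ->
  measurable_fun [set: (n.-tuple R * n.-tuple R)%type]
    (fun z => lam * enorm (tsub z.1 z.2) `^ (1 + gam) < `|u z.1 - u z.2|).
Proof.
move=> mu; apply: measurable_fun_ltr; last exact: measurable_osc.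
apply: measurable_funM => //.
exact: measurableT_comp (measurable_powR (1 + gam)) (@measurable_dist n).
Qed.

Lemma measurable_nuk n (u : n.-tuple R -> R) lam gam : measurable_fun [set: n.-tuple R] u ->
  measurable_fun [set: (n.-tuple R * n.-tuple R)%type] (nuk u lam gam).
Proof.
move=> mu; apply: measurable_fun_ifT => //.
- apply: measurable_and; last exact: measurable_osc_gt.
  by apply: measurable_fun_ltr => //; exact: measurable_dist.
- exact: measurableT_comp (measurable_powR (gam - n%:R)) (@measurable_dist n).
Qed.

Lemma le_nu n (u : n.-tuple R -> R) lam lam' gam : measurable_fun [set: n.-tuple R] u ->
  lam <= lam' -> (nu gam (Elg u lam' gam) <= nu gam (Elg u lam gam))%E.
Proof.
move=> mu ll; rewrite !nuE; apply: le_dint.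
- by apply/measurable_EFinP; exact: measurable_nuk.
- by apply/measurable_EFinP; exact: measurable_nuk.
- by move=> z; rewrite lee_fin nuk_ge0.
move=> z; rewrite lee_fin {1}/nuk; case: ifPn => [/andP[d0 dl]|_]; last exact: nuk_ge0.
rewrite /nuk d0 ifT//=; apply: le_lt_trans dl.
by rewrite ler_wpM2r// powR_ge0.
Qed.

Lemma nuk_ge n (u : n.-tuple R -> R) lam gam x y : 0 < lam ->
  lam * enorm (tsub x y) `^ (1 + gam) < `|u x - u y| ->
  enorm (tsub x y) `^ (gam - n%:R) <= nuk u lam gam (x, y).
Proof.
move=> lam0 h; rewrite /nuk /= h andbT; case: ifPn => //; rewrite -leNgt => d0.
have /eqP xy : x == y by rewrite -enorm_tsub_eq0 eq_le d0 enorm_ge0.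
move: h; rewrite xy subrr normr0 ltNge => /negP; case.
by rewrite mulr_ge0 ?powR_ge0// ltW.
Qed.

Lemma nu_ge_kernel n (u : n.-tuple R -> R) lam gam (k : n.-tuple R * n.-tuple R -> R) :
  0 < lam -> measurable_fun [set: n.-tuple R] u ->
  measurable_fun [set: (n.-tuple R * n.-tuple R)%type] k -> (forall z, 0 <= k z) ->
  (forall x y, k (x, y) != 0 -> lam * enorm (tsub x y) `^ (1 + gam) < `|u x - u y|) ->
  (forall x y, k (x, y) <= enorm (tsub x y) `^ (gam - n%:R)) ->
  (dint (fun z => (k z)%:E) <= nu gam (Elg u lam gam))%E.
Proof.
move=> lam0 mu mk k0 kosc kle; rewrite nuE; apply: le_dint.
- exact/measurable_EFinP.
- by apply/measurable_EFinP; exact: measurable_nuk.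
- by move=> z; rewrite lee_fin.
move=> [x y]; rewrite lee_fin; have [->|nz] := eqVneq (k (x, y)) 0; first exact: nuk_ge0.
by apply: le_trans (kle _ _) _; apply: nuk_ge => //; exact: kosc.
Qed.

Lemma W11D n (u v : n.-tuple R -> R) : W11 u -> W11 v -> W11 (fun x => u x + v x).
Proof.
move=> [u1 [_ [g [g1 ug]]]] [v1 [_ [h [h1 vh]]]].
have uv1 := L1D u1 v1; split=> //; split; first exact: L1_loc_integrable.
exists (fun i x => g i x + h i x); split; first by move=> i; exact: L1D.
exact: weak_gradD.
Qed.

Lemma weak_grad_cst0 n : weak_grad (fun _ : n.-tuple R => 0 : R) (fun _ _ => 0).
Proof.
apply: weak_grad_pderiv => [|i||i]; [exact: econt_cst|exact: econt_cst| |exact: has_pderiv0].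
by exists 0.
Qed.

Lemma L1_cst0 n : L1 (fun _ : n.-tuple R => 0 : R).
Proof. by apply/L1P; exact: integrable0. Qed.

Definition gradnorm n (g : 'I_n -> n.-tuple R -> R) (x : n.-tuple R) : R :=
  Num.sqrt (\sum_(i < n) g i x ^+ 2).

Lemma measurable_gradnorm n (g : 'I_n -> n.-tuple R -> R) :
  (forall i, measurable_fun [set: n.-tuple R] (g i)) -> measurable_fun [set: n.-tuple R] (gradnorm g).
Proof.
move=> mg; apply: (measurableT_comp (continuous_measurable_fun (@sqrt_continuous R))).
by apply: measurable_sum => i; exact: measurable_funX.
Qed.

Lemma tint_gradnorm_le n (g : 'I_n -> n.-tuple R -> R) (e : R) : (forall i, L1 (g i)) ->
  (forall i, tint (fun x => (`|g i x|)%:E) <= e%:E)%E ->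
  (tint (fun x => (gradnorm g x)%:E) <= (n%:R * e)%:E)%E.
Proof.
move=> g1 ge; have mg i : measurable_fun [set: n.-tuple R] (fun x => (`|g i x|)%:E).
  by apply/measurable_EFinP; apply: measurableT_comp => //; exact: L1_measurable.
apply: (@le_trans _ _ (tint (fun x => \sum_(i < n) (`|g i x|)%:E)%E)).
  apply: le_tint => [||x|x].
  - by apply/measurable_EFinP; apply: measurable_gradnorm => i; exact: L1_measurable.
  - exact: emeasurable_sum.
  - by rewrite lee_fin sqrtr_ge0.
  - rewrite sumEFin lee_fin -(@ler_pXn2r _ 2)// ?nnegrE ?sqrtr_ge0 ?sumr_ge0//.
    rewrite sqr_sqrtr; last by apply: sumr_ge0 => i _; exact: sqr_ge0.
    have [] // : 0 <= \sum_(i < n) `|g i x| /\ \sum_(i < n) g i x ^+ 2 <= (\sum_(i < n) `|g i x|) ^+ 2.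
    apply: (big_ind2 (fun a b : R => 0 <= b /\ a <= b ^+ 2)) => [|a b c d [b0 ab] [d0 cd]|i _].
    + by rewrite expr0n.
    + by split; [rewrite addr_ge0|rewrite sqrrD; have := mulr_ge0 b0 d0; lra].
    + by rewrite real_normK ?num_real.
rewrite tint_sum//; apply: (@le_trans _ _ (\sum_(i < n) e%:E)%E).
  by apply: lee_sum => i _; exact: ge.
by rewrite sumEFin lee_fin sumr_const card_ord mulr_natl.
Qed.

Lemma W11_ball_sub n (u v : n.-tuple R -> R) g (r s t : R) : L1 u -> L1 v ->
  (forall i, L1 (g i)) -> weak_grad (fun x => v x - u x) g ->
  (tint (fun x => (`|v x - u x|%R)%:E) + tint (fun x => (gradnorm g x)%:E) <= t%:E)%E ->
  t + s <= r -> W11_ball v s `<=` W11_ball u r.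
Proof.
move=> u1 v1 g1 gvu normt ts w [Ww [h [h1 hwv norms]]].
have w1 : L1 w by case: Ww.
have LN (f : n.-tuple R -> R) : L1 f -> L1 (fun x => - f x).
  move=> f1; have mc : measurable_fun [set: n.-tuple R] (fun _ => -1 : R).
    exact: measurable_cst.
  rewrite (_ : (fun x => - f x) = fun x => f x * -1); last by apply/funext => x; rewrite mulrN1.
  by apply: (L1M_bounded (B := 1) f1 mc) => x; rewrite normrN1.
have vu1 : L1 (fun x => v x - u x) by apply: L1D => //; exact: LN.
have wv1 : L1 (fun x => w x - v x) by apply: L1D => //; exact: LN.
split=> //; exists (fun i x => g i x + h i x); split.
- by move=> i; exact: L1D.
- rewrite (_ : (fun x => w x - u x) = fun x => (v x - u x) + (w x - v x)).
    exact: weak_gradD.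
  by apply/funext => x; ring.
have mabs (f : n.-tuple R -> R) : L1 f -> measurable_fun [set: n.-tuple R] (fun x => (`|f x|)%:E).
  by move=> f1; apply/measurable_EFinP; apply: measurableT_comp => //; exact: L1_measurable.
have mgn (f : 'I_n -> n.-tuple R -> R) : (forall i, L1 (f i)) ->
    measurable_fun [set: n.-tuple R] (fun x => (gradnorm f x)%:E).
  by move=> f1; apply/measurable_EFinP; apply: measurable_gradnorm => i; exact: L1_measurable.
apply: (@lt_le_trans _ _ (t + s)%:E); last by rewrite lee_fin.
have gn0 (f : 'I_n -> n.-tuple R -> R) x : (0 <= (gradnorm f x)%:E)%E by rewrite lee_fin sqrtr_ge0.
have fin : (tint (fun x => (`|v x - u x|%R)%:E) + tint (fun x => (gradnorm g x)%:E))%E \is a fin_num.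
  rewrite ge0_fin_numE; first exact: le_lt_trans normt (ltry _).
  by apply: adde_ge0; apply: tint_ge0 => // x.
rewrite EFinD; apply: le_lt_trans (lee_ltD fin normt norms).
rewrite addeACA; apply: leeD.
  rewrite -tintD//; try exact: mabs.
  apply: le_tint => //.
  - by apply: (mabs (fun x => w x - u x)); apply: L1D => //; exact: LN.
  - by apply: emeasurable_funD; exact: mabs.
  - move=> x; rewrite -EFinD lee_fin (_ : w x - u x = (v x - u x) + (w x - v x)); last by ring.
    exact: ler_normD.
rewrite -tintD//; try exact: mgn.
apply: le_tint => //.
- by apply: (mgn (fun i x => g i x + h i x)) => i; exact: L1D.
- by apply: emeasurable_funD; exact: mgn.
- by move=> x; rewrite -EFinD lee_fin; exact: minkowski2.
Qed.

End NuBounds.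

(** * Stability of lower bounds and nowhere density *)

Section NowhereDense.
Context {R : realType}.

(** Spikes with tau = 0 have their kernels over this cube; its finite volume turns an L^1 bound in
    one variable into a bound over pairs. *)
Definition cube n (x : n.-tuple R) : R := \prod_(i < n) ind (-1) 1 (tnth x i).

Lemma cube_ge0 n (x : n.-tuple R) : 0 <= cube x.
Proof. by apply: prodr_ge0 => i _; exact: ind_ge0. Qed.

Lemma cube1 n (x : n.-tuple R) : (forall i, `|tnth x i| <= 1) -> cube x = 1.
Proof.
by move=> x1; apply: big1 => i _; rewrite /ind in_itv/= -ler_norml x1.
Qed.

Lemma measurable_cube n : measurable_fun [set: n.-tuple R] (@cube n).
Proof.
apply: measurable_prod => i _.
exact: (measurableT_comp (@measurable_cst_itv R (-1) 1 1) (measurable_tnth i)).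
Qed.

Lemma tint_cube n (c : R) : 0 <= c ->
  tint (fun x : n.-tuple R => (c * cube x)%:E) = (c * 2 ^+ n)%:E.
Proof.
move=> c0; have := @tint_box R n (fun=> -1) (fun=> 1) c c0.
rewrite (eq_bigr (fun=> 2)); last by move=> i _; rewrite opprK.
by rewrite prodr_const card_ord; apply => i; lra.
Qed.

Lemma dint_cubel n (f : n.-tuple R -> R) (s : R) : measurable_fun [set: n.-tuple R] f ->
  (forall x, 0 <= f x) -> tint (fun x => (f x)%:E) = s%:E ->
  dint (fun z => (f z.1 * cube z.2 + cube z.1 * f z.2)%:E) = (2 * (2 ^+ n * s))%:E.
Proof.
move=> mf f0 fs.
have s0 : 0 <= s by rewrite -lee_fin -fs; apply: tint_ge0 => x; rewrite lee_fin.
have m1 : measurable_fun [set: (n.-tuple R * n.-tuple R)%type] (fun z => (f z.1 * cube z.2)%:E).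
  apply/measurable_EFinP; apply: measurable_funM; first exact: measurableT_comp mf measurable_fst.
  exact: measurableT_comp (@measurable_cube n) measurable_snd.
have m2 : measurable_fun [set: (n.-tuple R * n.-tuple R)%type] (fun z => (cube z.1 * f z.2)%:E).
  apply/measurable_EFinP; apply: measurable_funM; first exact: measurableT_comp (@measurable_cube n) measurable_fst.
  exact: measurableT_comp mf measurable_snd.
rewrite (_ : (fun z => _) = (fun z : n.-tuple R * n.-tuple R =>
  (f z.1 * cube z.2)%:E + (cube z.1 * f z.2)%:E)%E); last by apply/funext => z; rewrite EFinD.
rewrite dintD//; last 2 first.
- by move=> z; rewrite lee_fin mulr_ge0// cube_ge0.
- by move=> z; rewrite lee_fin mulr_ge0// cube_ge0.
have -> : dint (fun z => (f z.1 * cube z.2)%:E) = (2 ^+ n * s)%:E.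
  rewrite EFinM -fs -tintZ//; last exact/measurable_EFinP.
  by apply: eq_tint => x; rewrite /= tint_cube// mulrC EFinM.
have -> : dint (fun z => (cube z.1 * f z.2)%:E) = (2 ^+ n * s)%:E.
  rewrite mulrC -tint_cube//; apply: eq_tint => x.
  rewrite /= [RHS]EFinM muleC -fs -tintZ ?cube_ge0//; exact/measurable_EFinP.
by rewrite -EFinD; congr _%:E; ring.
Qed.

(** A Chebyshev argument with f = |w - v|. Where v oscillates above level 2 lam and w does not
    exceed lam, f(x) + f(y) >= lam eta^(1 + gam); there the kernel is at most eta^(gam - n), hence
    at most a constant times f(x) + f(y), whose integral over pairs in the cube is controlled by
    s. *)
Lemma W11_stable n (gam lam eta C : R) (v w : n.-tuple R -> R)
    (k : n.-tuple R * n.-tuple R -> R) : 0 < lam -> 0 < eta -> gam < 0 -> -1 <= gam ->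
  measurable_fun [set: n.-tuple R] w -> measurable_fun [set: n.-tuple R] v ->
  measurable_fun [set: (n.-tuple R * n.-tuple R)%type] k -> (forall z, 0 <= k z) ->
  (forall x y, k (x, y) <= enorm (tsub x y) `^ (gam - n%:R)) ->
  (forall x y, k (x, y) != 0 -> [/\ 2 * lam * enorm (tsub x y) `^ (1 + gam) < `|v x - v y|,
     eta <= enorm (tsub x y) & forall i, `|tnth x i| <= 1 /\ `|tnth y i| <= 1]) ->
  C = eta `^ (gam - n%:R) / (lam * eta `^ (1 + gam)) * (2 * 2 ^+ n) ->
  forall s, (tint (fun x => (`|w x - v x|%R)%:E) <= s%:E)%E ->
  (dint (fun z => (k z)%:E) <= nu gam (Elg w lam gam) + (C * s)%:E)%E.
Proof.
move=> lam0 eta0 g0 g1 mw mv mk k0 kle kin EC s wvs.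
pose f x := `|w x - v x|.
have mf : measurable_fun [set: n.-tuple R] f.
  by apply: measurableT_comp => //; exact: measurable_funB.
have f0 x : 0 <= f x by exact: normr_ge0.
have t0 : (0 <= tint (fun x => (f x)%:E))%E by apply: tint_ge0 => x; rewrite lee_fin.
have fin : tint (fun x => (f x)%:E) \is a fin_num.
  by rewrite ge0_fin_numE//; exact: le_lt_trans wvs (ltry _).
have E := dint_cubel mf f0 (esym (fineK fin)).
pose c := eta `^ (gam - n%:R) / (lam * eta `^ (1 + gam)).
have c0 : 0 < c by rewrite divr_gt0 ?mulr_gt0// powR_gt0.
have g10 : 0 <= 1 + gam by lra.
have gn0 : gam - n%:R <= 0 by rewrite subr_le0 (le_trans (ltW g0)).
have m3 : measurable_fun [set: (n.-tuple R * n.-tuple R)%type]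
    (fun z => f z.1 * cube z.2 + cube z.1 * f z.2).
  apply: measurable_funD; apply: measurable_funM.
  - exact: measurableT_comp mf measurable_fst.
  - exact: measurableT_comp (@measurable_cube n) measurable_snd.
  - exact: measurableT_comp (@measurable_cube n) measurable_fst.
  - exact: measurableT_comp mf measurable_snd.
have f3 z : 0 <= f z.1 * cube z.2 + cube z.1 * f z.2.
  by rewrite addr_ge0// mulr_ge0// cube_ge0.
apply: (@le_trans _ _ (dint (fun z => (nuk w lam gam z)%:E + (c * (f z.1 * cube z.2 + cube z.1 * f z.2))%:E)%E)).
  apply: le_dint.
  - exact/measurable_EFinP.
  - apply: emeasurable_funD; first by apply/measurable_EFinP; exact: measurable_nuk.
    by apply/measurable_EFinP; exact: measurable_funM.
  - by move=> z; rewrite lee_fin.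
  move=> [x y]; rewrite -EFinD lee_fin /=.
  have [->|nz] := eqVneq (k (x, y)) 0.
    by rewrite addr_ge0 ?nuk_ge0// mulr_ge0 ?(ltW c0)//; exact: (f3 (x, y)).
  have [vosc de xy1] := kin _ _ nz.
  have -> : cube x = 1 by apply: cube1 => i; have [] := xy1 i.
  have -> : cube y = 1 by apply: cube1 => i; have [] := xy1 i.
  rewrite mulr1 mul1r.
  have [wosc|wosc] := ltP (lam * enorm (tsub x y) `^ (1 + gam)) `|w x - w y|.
    apply: le_trans (kle _ _) _; rewrite -[leLHS]addr0; apply: lerD; first exact: nuk_ge.
    by rewrite mulr_ge0 ?addr_ge0// ltW.
  rewrite -[leLHS]add0r; apply: lerD; first exact: nuk_ge0.
  apply: le_trans (kle _ _) _.
  have eg : eta `^ (1 + gam) <= enorm (tsub x y) `^ (1 + gam).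
    by apply: (ge0_ler_powR g10) => //; rewrite nnegrE ?enorm_ge0// ltW.
  have vw : `|v x - v y| <= `|w x - w y| + (f x + f y).
    have -> : v x - v y = (w x - w y) + ((w y - v y) - (w x - v x)) by ring.
    by apply: le_trans (ler_normD _ _) _; rewrite lerD2l [leRHS]addrC; exact: ler_normB.
  have lf : lam * eta `^ (1 + gam) <= f x + f y.
    have := ler_wpM2l (ltW lam0) eg; move: vosc vw wosc; clear.
    move: (enorm _ `^ _) (eta `^ _) => A B; lra.
  apply: le_trans (le_powR_neg eta0 de gn0) _.
  rewrite /c -mulrA ler_peMr ?powR_ge0// mulrC ler_pdivlMr ?mul1r//.
  by rewrite mulr_gt0// powR_gt0.
rewrite dintD//; last 4 first.
- by apply/measurable_EFinP; exact: measurable_nuk.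
- by apply/measurable_EFinP; exact: measurable_funM.
- by move=> z; rewrite lee_fin nuk_ge0.
- by move=> z; rewrite lee_fin mulr_ge0// ltW.
rewrite nuE leeD2l//.
have -> : dint (fun z => (c * (f z.1 * cube z.2 + cube z.1 * f z.2))%:E) =
    (c * (2 * (2 ^+ n * fine (tint (fun x => (f x)%:E)))))%:E.
  rewrite EFinM -E dintE; last 2 first.
  - by apply/measurable_EFinP; exact: measurable_funM.
  - by move=> z; rewrite lee_fin mulr_ge0// ltW.
  rewrite dintE; last 2 first.
  - exact/measurable_EFinP.
  - by move=> z; rewrite lee_fin.
  under eq_integral do rewrite EFinM.
  rewrite ge0_integralZl_EFin ?ltW//; last exact/measurable_EFinP.
  by move=> z _; rewrite lee_fin.
rewrite lee_fin EC -/c -[leRHS]mulrA; apply: ler_wpM2l; first exact: ltW.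
rewrite -[leRHS]mulrA; apply: ler_wpM2l => //; apply: ler_wpM2l; first by rewrite exprn_ge0.
by rewrite -lee_fin fineK.
Qed.

(** The level is spent by factors of 2: the spike oscillates above 4 lam, so at each pair u or u +
    phi oscillates above 2 lam, and a small ball around the better of the two still sees level
    lam. *)
Lemma W11_nowhere_dense_spikes n (gam : R) (F : set (n.+1.-tuple R -> R)) : -1 <= gam < 0 ->
  (forall eps, 0 < eps <= 1 -> exists lam M1 : R, [/\ 0 < lam,
     forall w, F w -> (nu gam (Elg w lam gam) <= M1%:E)%E &
     forall M, exists B phi D k, @spike R n gam (4 * lam) eps 0 B M phi D k]) ->
  W11_nowhere_dense F.
Proof.
move=> /andP[g1 g0] HF u r Wu r0.
have u1 : L1 u by case: Wu.
(* The spike costs eps in L^1 and at most eps for each of the n + 1 partial derivatives, in total at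
   most r/2. *)
pose eps := Num.min 1 (r / (2 * n.+2%:R)).
have N0 : 0 < 2 * n.+2%:R :> R by rewrite mulr_gt0// ltr0n.
have eps0 : 0 < eps by rewrite lt_min ltr01 divr_gt0.
have eps1 : eps <= 1 by rewrite ge_min lexx.
have epsr : n.+2%:R * eps <= r / 2.
  have : eps <= r / (2 * n.+2%:R) by rewrite ge_min lexx orbT.
  by rewrite ler_pdivlMr// => h; rewrite ler_pdivlMr//; apply: le_trans h; rewrite le_eqVlt; apply/orP; left; apply/eqP; ring.
have [|lam [M1 [lam0 FM HM]]] := HF eps; first by rewrite eps0.
pose M := 4 * (`|M1| + 1).
have [B [phi [D [k sp]]]] := HM M.
have [cphi sphi phi1 D1 wphi] := spike_W11 sp.
have [_ [_ _ _ nphi nD] [mk k0 kosc kle kM] [eta eta0 keta]] := sp.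
have mphi := L1_measurable phi1; have mu := L1_measurable u1.
pose up x := u x + phi x.
have Wphi : W11 phi by split=> //; split; [exact: L1_loc_integrable|exists (fun i => D [:: i])].
have Wup : W11 up by exact: W11D.
have mup : measurable_fun [set: n.+1.-tuple R] up by exact: measurable_funD.
(* The part of the kernel where v oscillates above 2 lam; the parts for u and u + phi cover the
   whole kernel. *)
pose kk (v : n.+1.-tuple R -> R) (z : n.+1.-tuple R * n.+1.-tuple R) :=
  if 2 * lam * enorm (tsub z.1 z.2) `^ (1 + gam) < `|v z.1 - v z.2| then k z else 0.
have kk0 v z : 0 <= kk v z by rewrite /kk; case: ifP.
have mkk v : measurable_fun [set: n.+1.-tuple R] v ->
    measurable_fun [set: (n.+1.-tuple R * n.+1.-tuple R)%type] (kk v).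
  by move=> mv; apply: measurable_fun_ifT => //; exact: measurable_osc_gt.
have kkD : (M%:E <= dint (fun z => (kk u z)%:E) + dint (fun z => (kk up z)%:E))%E.
  rewrite -dintD; last 4 first.
  - by apply/measurable_EFinP; exact: mkk.
  - by apply/measurable_EFinP; exact: mkk.
  - by move=> z; rewrite lee_fin.
  - by move=> z; rewrite lee_fin.
  apply: le_trans kM _; apply: le_dint.
  - exact/measurable_EFinP.
  - by apply: emeasurable_funD; apply/measurable_EFinP; exact: mkk.
  - by move=> z; rewrite lee_fin.
  move=> [x y]; rewrite -EFinD lee_fin.
  have [->|nz] := eqVneq (k (x, y)) 0; first by rewrite addr_ge0.
  have [osc _ _] := kosc _ _ nz.
  rewrite {1}/kk /=; case: ifPn => [_|]; first by rewrite lerDl.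
  rewrite -leNgt => hu; rewrite add0r /kk /= ifT//.
  have : `|phi x - phi y| <= `|up x - up y| + `|u x - u y|.
    have -> : phi x - phi y = (up x - up y) - (u x - u y) by rewrite /up; ring.
    exact: ler_normB.
  by move: osc hu; clear; move: (enorm _ `^ _) => A; lra.
have M20 : M / 2 = 2 * (`|M1| + 1) by rewrite /M; lra.
have [v [Wv mv vM [g [g1' gvu gn]]]] : exists v, [/\ W11 v, measurable_fun [set: n.+1.-tuple R] v,
    ((M / 2)%:E <= dint (fun z => (kk v z)%:E))%E &
    exists g, [/\ forall i, L1 (g i), weak_grad (fun x => v x - u x) g &
      (tint (fun x => (`|v x - u x|%R)%:E) + tint (fun x => (gradnorm g x)%:E) <= (r / 2)%:E)%E]].
  have /orP[h|] := orbN ((M / 2)%:E <= dint (fun z => (kk u z)%:E))%E.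
    exists u; split; [exact: Wu|exact: mu|exact: h|]; exists (fun _ _ => 0); split; first by move=> i; exact: L1_cst0.
      rewrite (_ : (fun x => _) = fun=> 0); first exact: weak_grad_cst0.
      by apply/funext => x; rewrite subrr.
    rewrite -tintD//; last 3 first.
    - by apply/measurable_EFinP; apply: measurableT_comp => //; exact: measurable_funB.
    - by apply/measurable_EFinP; apply: measurable_gradnorm.
    - by move=> x; rewrite lee_fin sqrtr_ge0.
    rewrite (eq_tint (g := fun=> 0%E)).
      by rewrite tintE// integral0 lee_fin; apply: divr_ge0 => //; exact: ltW.
    by move=> x; rewrite subrr normr0 /gradnorm big1 ?sqrtr0 ?adde0// => i _; rewrite expr0n.
  rewrite -ltNge => h; exists up; split; [exact: Wup|exact: mup| |].
    rewrite leNgt; apply/negP => h'; have := lteD h h'; rewrite -EFinD -splitr.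
    by rewrite ltNge kkD.
  have E : (fun x => up x - u x) = phi by apply/funext => x; rewrite /up addrAC subrr add0r.
  exists (fun i => D [:: i]); rewrite E; split=> //.
  rewrite (_ : (fun x => (`|up x - u x|)%:E) = fun x => (`|phi x|)%:E); last first.
    by apply/funext => x; rewrite -[phi]E.
  apply: le_trans (leeD nphi (tint_gradnorm_le D1 nD)) _.
  rewrite -EFinD lee_fin; apply: le_trans epsr.
  by rewrite -[n.+2%:R]nat1r mulrDl mul1r.
have eg0 : 0 < eta `^ (1 + gam) by exact: powR_gt0.
pose C := eta `^ (gam - n.+1%:R) / (lam * eta `^ (1 + gam)) * (2 * 2 ^+ n.+1).
have C0 : 0 < C.
  by rewrite mulr_gt0 ?mulr_gt0 ?invr_gt0 ?exprn_gt0 ?powR_gt0// mulr_gt0.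
(* r/2 keeps the new ball inside the given one; 1/C limits the perturbation loss C s to 1. *)
pose s := Num.min (r / 2) C^-1.
have s0 : 0 < s by rewrite lt_min invr_gt0 C0 divr_gt0.
exists v, s; split=> //.
  apply: (W11_ball_sub u1 _ g1' gvu gn); first by case: Wv.
  have : s <= r / 2 by rewrite ge_min lexx.
  by lra.
apply/seteqP; split=> // w [[Ww [h [h1 _ hs]]] Fw].
have w1 : L1 w by case: Ww.
have wvs : (tint (fun x => (`|w x - v x|%R)%:E) <= s%:E)%E.
  apply: le_trans (ltW hs); rewrite leeDl//; apply: tint_ge0 => x.
  by rewrite lee_fin sqrtr_ge0.
have kle' x y : kk v (x, y) <= enorm (tsub x y) `^ (gam - n.+1%:R).
  by rewrite /kk; case: ifP => // _; exact: powR_ge0.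
have kin x y : kk v (x, y) != 0 -> [/\ 2 * lam * enorm (tsub x y) `^ (1 + gam) < `|v x - v y|,
     eta <= enorm (tsub x y) & forall i, `|tnth x i| <= 1 /\ `|tnth y i| <= 1].
  rewrite /kk /=; case: ifPn; rewrite ?eqxx// => osc /keta[h2 h3]; split=> // i.
  by have := h3 i; rewrite normr0 add0r.
have := W11_stable lam0 eta0 g0 g1 (L1_measurable w1) mv (mkk _ mv) (kk0 v) kle' kin (erefl C) wvs.
have Cs : C * s <= 1.
  by rewrite mulrC -ler_pdivlMr// div1r ge_min lexx orbT.
move=> h2; have : ((M / 2)%:E <= M1%:E + 1%:E)%E.
  apply: le_trans vM _; apply: le_trans h2 _; apply: leeD; first exact: FM.
  by rewrite lee_fin.
rewrite -EFinD lee_fin M20; have := ler_norm M1; have := normr_ge0 M1.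
lra.
Qed.

End NowhereDense.

(** * Sums of spikes *)

Section SpikeSums.
Context {R : realType}.

(** Disjoint slabs in the first coordinate make u equal to spike j on slab j, so each kernel works
    for u unchanged; the widths also bound the norms, hence one summability condition. *)
Lemma spike_sum n (gam C : R) (lam eps tau B M : nat -> R) phi D k :
  (forall j, @spike R n gam (lam j) (eps j) (tau j) (B j) (M j) (phi j) (D j) (k j)) ->
  (forall j, 0 < lam j) ->
  (forall i j t, tau i < t < tau i + eps i -> tau j < t < tau j + eps j -> i = j) ->
  (forall K : nat, \sum_(j < K) eps j <= C) ->
  exists u, [/\ W11 u, disjoint_sum phi u &
    forall j, ((M j)%:E <= nu gam (Elg u (lam j) gam))%E].
Proof.
move=> sp lam0 slab sC.
have /choice[kx kxP] : forall t : R, exists j : nat, forall i,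
    tau i < t < tau i + eps i -> i = j.
  move=> t; have [[j hj]|nj] := pselect (exists j, tau j < t < tau j + eps j).
    by exists j => i hi; exact: slab hi hj.
  (* Points outside all slabs get index 0, which is harmless: every spike and its first derivatives
     vanish there. *)
  by exists 0%N => i hi; exfalso; apply: nj; exists i.
have slabP j i x : (phi j x != 0) || (D j [:: i] x != 0) -> j = kx (tnth x ord0).
  by move=> h; apply: kxP; have [_ [_ _ hs _ _] _ _] := sp j; exact: hs h.
pose u x := phi (kx (tnth x ord0)) x.
pose g i x := D (kx (tnth x ord0)) [:: i] x.
have du : disjoint_sum phi u.
  move=> x; exists (kx (tnth x ord0)); split=> // j jx.
  apply/eqP; apply: contraT => h; case/negP: jx; apply/eqP.
  by apply: (slabP j ord0); rewrite h.
have dg i : disjoint_sum (fun j => D j [:: i]) (g i).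
  move=> x; exists (kx (tnth x ord0)); split=> // j jx.
  apply/eqP; apply: contraT => h; case/negP: jx; apply/eqP.
  by apply: (slabP j i); rewrite h orbT.
have W j := spike_W11 (sp j).
have phi1 j : L1 (phi j) by have [] := W j.
have D1 j i : L1 (D j [:: i]) by have [] := W j.
have u1 : L1 u.
  by apply: (disjoint_sum_L1 du phi1 _ sC) => j; have [_ [_ _ _ ? _] _ _] := sp j.
have g1 i : L1 (g i).
  by apply: (disjoint_sum_L1 (dg i) (fun j => D1 j i) _ sC) => j; have [_ [_ _ _ _ hs] _ _] := sp j; exact: hs.
have wg : weak_grad u g.
  apply: (weak_grad_disjoint_sum phi1 (g := fun j i => D j [:: i])) => // j.
  by have [] := W j.
exists u; split=> //.
  by split=> //; split; [exact: L1_loc_integrable|exists g].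
move=> j; have [_ _ [mk k0 kosc kle kM] _] := sp j.
apply: le_trans kM _; apply: nu_ge_kernel => //; first exact: L1_measurable.
move=> x y /kosc[osc hx hy].
by rewrite /u -(kxP _ _ hx) -(kxP _ _ hy).
Qed.

(** For [lam j.+1] <= l < [lam j], monotonicity of [nu] in the level gives l nu(E_l) >=
    [lam j.+1 * M j]; hence the shifted index in the last hypothesis. *)
Lemma nu_cvg_pinfty n (gam : R) (u : n.-tuple R -> R) (lam M : nat -> R) :
  measurable_fun [set: n.-tuple R] u -> (forall j, 0 < lam j) ->
  (forall j, lam j.+1 <= lam j) -> (forall d, 0 < d -> exists j, lam j <= d) ->
  (forall j, ((M j)%:E <= nu gam (Elg u (lam j) gam))%E) ->
  (forall j, j%:R <= lam j.+1 * M j) ->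
  ((l%:E * nu gam (Elg u l gam))%E @[l --> (0 : R)^'+] --> +oo)%E.
Proof.
move=> mu lam0 ldec lto0 lM jM; apply/cvgeyPge => A.
have ldec' : {homo lam : i j / (i <= j)%N >-> j <= i}.
  by apply: homo_leq => // x y z yx zy; exact: le_trans zy yx.
have [J AJ] := nat_above A.
near=> l.
have l0 : 0 < l by near: l; exact: nbhs_right_gt.
have lJ : l < lam J by near: l; exact: nbhs_right_lt.
have ex : exists j, lam j <= l by exact: lto0.
have [m ml mmin] := ex_minnP ex.
have Jm : (J < m)%N.
  rewrite ltnNge; apply/negP => mJ; have := ldec' _ _ mJ.
  by move=> h; have := lt_le_trans lJ (le_trans h ml); rewrite ltxx.
case: m Jm ml mmin => [|j]// Jj ml mmin.
have lj : l < lam j.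
  by rewrite ltNge; apply/negP => /mmin; rewrite ltnn.
have M0 : 0 <= M j by rewrite -(pmulr_rge0 _ (lam0 j.+1)); apply: le_trans (jM j).
apply: (@le_trans _ _ (l * M j)%:E).
  rewrite lee_fin; apply: le_trans AJ _; apply: (@le_trans _ _ j%:R); first by rewrite ler_nat.
  by apply: le_trans (jM j) _; rewrite ler_wpM2r.
rewrite EFinM lee_wpmul2l ?lee_fin ?(ltW l0)//.
by apply: le_trans (lM j) _; exact: le_nu (ltW lj).
Unshelve. all: by end_near. Qed.

(** On the half-space x_0 <= L only the first L spikes and their derivatives survive, so near every
    point the sum is a fixed finite one. In the proof, L is taken above x_0 + 1 to serve a whole
    neighbourhood. *)
Lemma smooth_slab_sum n (u : n.+1.-tuple R -> R)
    (D : nat -> seq 'I_n.+1 -> n.+1.-tuple R -> R) :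
  (forall j s i, has_pderiv i (D j s) (D j (i :: s))) -> (forall j s, econt (D j s)) ->
  (forall j s x, tnth x ord0 <= j%:R -> D j s x = 0) ->
  disjoint_sum (fun j => D j [::]) u -> smooth u.
Proof.
move=> dD cD zD du.
have /choice[K KP] : forall x : n.+1.-tuple R, exists K : nat, tnth x ord0 <= K%:R.
  by move=> x; exact: nat_above.
pose T s x := \sum_(j < K x) D j s x.
have sumE s x (L L' : nat) : (L <= L')%N -> tnth x ord0 <= L%:R ->
    \sum_(j < L') D j s x = \sum_(j < L) D j s x.
  move=> LL xL; rewrite -(subnK LL) addnC big_split_ord/= [X in _ + X]big1 ?addr0// => j _.
  by apply: zD; apply: le_trans xL _; rewrite ler_nat leq_addr.
have TE s x (L : nat) : tnth x ord0 <= L%:R -> T s x = \sum_(j < L) D j s x.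
  by move=> xL; have [h|/ltnW h] := leqP (K x) L; [rewrite (sumE s x (K x) L)|rewrite -(sumE s x L (K x))].
exists T; split.
- apply/funext => x; have [k ux] := disjoint_sum_partial x du.
  pose L := maxn (K x) k.+1.
  rewrite (TE _ _ L); first by rewrite ux leq_maxr.
  by apply: le_trans (KP x) _; rewrite ler_nat leq_maxl.
- move=> s i; apply/has_pderivP => x.
  have [L xL] := nat_above (tnth x ord0 + 1).
  have xL' : tnth x ord0 <= L%:R by apply: le_trans xL; rewrite lerDl.
  have := @has_pderiv_sum R _ i _ (index_enum 'I_L) _ _ (fun j : 'I_L => dD j s i).
  move=> /has_pderivP/(_ x); rewrite -TE//; apply: near_eq_is_derive.
  near=> h; rewrite (TE _ _ L)//; apply: le_trans xL.
  rewrite tnth_shift lerD2l; case: ifP => // _.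
  by apply: le_trans (ler_norm _) _; near: h; apply/nbhs_ballP; exists 1 => //= h; rewrite /ball/= sub0r normrN; exact: ltW.
- move=> s x e e0; have [L xL] := nat_above (tnth x ord0 + 1).
  have xL' : tnth x ord0 <= L%:R by apply: le_trans xL; rewrite lerDl.
  have cL : econt (fun x => \sum_(j < L) D j s x) by apply: econt_sum => j _; exact: cD.
  have [d d0 Hd] := cL x e e0; exists (Num.min d 1); first by rewrite lt_min d0 ltr01.
  move=> y; rewrite lt_min => /andP[yd y1]; rewrite !(TE _ _ L)//; first exact: Hd.
  apply: le_trans xL; rewrite addrC -lerBlDr -tnth_tsub.
  by apply: le_trans (ler_norm _) _; apply: le_trans (tnth_le_enorm _ _) (ltW y1).
Unshelve. all: by end_near. Qed.

Lemma dyadic_sum (K : nat) : \sum_(j < K) (2^-1 : R) ^+ j.+1 <= 1.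
Proof.
have -> : \sum_(j < K) (2^-1 : R) ^+ j.+1 = 1 - 2^-1 ^+ K.
  elim: K => [|K IH]; first by rewrite big_ord0 expr0 subrr.
  by rewrite big_ord_recr/= IH exprS; lra.
by rewrite gerBl exprn_ge0// invr_ge0.
Qed.

(** Slab j is the dyadic interval (2^-(j+1), 2^-j). *)
Lemma dyadic_slabs i j (t : R) : 2^-1 ^+ i.+1 < t < 2^-1 ^+ i.+1 + 2^-1 ^+ i.+1 ->
  2^-1 ^+ j.+1 < t < 2^-1 ^+ j.+1 + 2^-1 ^+ j.+1 -> i = j.
Proof.
have half m : (2^-1 : R) ^+ m.+1 + 2^-1 ^+ m.+1 = 2^-1 ^+ m by rewrite exprS; lra.
rewrite !half => /andP[i1 i2] /andP[j1 j2]; apply/eqP; rewrite eqn_leq.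
have mono a b : (a < b)%N -> (2^-1 : R) ^+ b <= 2^-1 ^+ a.+1.
  by move=> ab; apply: ler_wiXn2l => //; lra.
apply/andP; split; rewrite leqNgt; apply/negP => /mono h.
  by have := lt_le_trans (lt_trans j1 i2) h; rewrite ltxx.
by have := lt_le_trans (lt_trans i1 j2) h; rewrite ltxx.
Qed.

End SpikeSums.

(** * Choice of the parameters and the three assertions *)

Section Parts.
Context {R : realType}.

Definition dyad (j : nat) : R := 2^-1 ^+ j.+1.

Lemma dyad_gt0 j : 0 < dyad j.
Proof. by rewrite exprn_gt0// invr_gt0. Qed.

Lemma dyad_le1 j : dyad j <= 1.
Proof. by apply: exprn_ile1; [rewrite invr_ge0|lra]. Qed.

Lemma dyadS j : dyad j.+1 <= dyad j.
Proof. by rewrite /dyad exprS ler_piMl ?exprn_ge0 ?invr_ge0//; lra. Qed.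

Lemma dyad_lt j : dyad j * j.+1%:R <= 1.
Proof.
rewrite /dyad exprVn mulrC ler_pdivrMr ?exprn_gt0// mul1r -natrX ler_nat.
exact: ltnW (ltn_expl _ _).
Qed.

(* The factor j^-j beats every power of j (rapid decrease), and C * height C j <= 2^-(j+1). *)
Definition height (C : R) (j : nat) : R := dyad j / C / j.+1%:R ^+ j.+1.

Lemma height_gt0 C j : 0 < C -> 0 < height C j.
Proof. by move=> C0; rewrite divr_gt0 ?divr_gt0 ?dyad_gt0// exprn_gt0// ltr0n. Qed.

Lemma height_le C j : 0 < C -> C * height C j <= dyad j.
Proof.
move=> C0; rewrite /height mulrA [C * _]mulrC divfK ?gt_eqF//.
rewrite ler_pdivrMr ?exprn_gt0 ?ltr0n// ler_peMr ?(ltW (dyad_gt0 j))//.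
by rewrite exprn_ege1// ler1n.
Qed.

Lemma heightS C j : 0 < C -> height C j.+1 <= height C j.
Proof.
move=> C0; rewrite /height; apply: ler_pM.
- by rewrite divr_ge0 ?ltW ?dyad_gt0.
- by rewrite invr_ge0 exprn_ge0.
- by rewrite ler_pM2r ?invr_gt0// dyadS.
rewrite lef_pV2 ?posrE ?exprn_gt0 ?ltr0n// -!natrX ler_nat.
by apply: (@leq_trans (j.+2 ^ j.+1)); [rewrite leq_exp2r|rewrite leq_exp2l].
Qed.

Lemma height_cvg C d : 0 < C -> 0 < d -> exists j, height C j <= d.
Proof.
move=> C0 d0; have [j hj] := nat_above (C * d)^-1; exists j.
have Cd : 0 < C * d by rewrite mulr_gt0.
rewrite -(ler_pM2l C0); apply: le_trans (height_le j C0) _.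
have hd := dyad_lt j; rewrite -(ler_pM2r (ltr0Sn R j)); apply: le_trans hd _.
rewrite -ler_pdivrMl// mulr1; apply: le_trans hj _.
by rewrite ler_nat.
Qed.

(** For k <= j + 1 the denominator (j + 1)^(j + 1) absorbs the power; otherwise (j + 1)^k <= k^k. *)
Lemma height_pow C j k : 0 < C -> j.+1%:R ^+ k * (C * height C j) <= k%:R ^+ k + 1.
Proof.
move=> C0; have d1 := dyad_le1 j; have d0 := dyad_gt0 j.
have E : C * height C j = dyad j / j.+1%:R ^+ j.+1.
  by rewrite /height mulrA [C * _]mulrC divfK// gt_eqF.
have [kj|jk] := leqP k j.+1.
  apply: (@le_trans _ _ 1); last by rewrite lerDr exprn_ge0.
  rewrite E mulrA ler_pdivrMr ?exprn_gt0 ?ltr0n// mul1r mulrC.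
  apply: (@le_trans _ _ (j.+1%:R ^+ k)); first by rewrite ler_piMl// exprn_ge0.
  by apply: ler_weXn2l => //; rewrite ler1n.
apply: (@le_trans _ _ (j.+1%:R ^+ k)); last first.
  apply: (@le_trans _ _ (k%:R ^+ k)); last by rewrite lerDl.
  by rewrite -!natrX ler_nat leq_exp2r//; [exact: ltnW|exact: leq_ltn_trans jk].
rewrite ler_piMr ?exprn_ge0//; apply: le_trans (height_le j C0) d1.
Qed.

Lemma spike_sum_supp n (gam : R) (lam eps tau B M : nat -> R) phi D k u (T : R) :
  (forall j, @spike R n gam (lam j) (eps j) (tau j) (B j) (M j) (phi j) (D j) (k j)) ->
  disjoint_sum phi u -> (forall j, `|tau j| <= T) -> compact_supp u.
Proof.
move=> sp du tT; exists (Num.sqrt n.+1%:R * (T + 1)) => x xM.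
have T0 : 0 <= T by apply: le_trans (tT 0%N).
have [j [-> _]] := du x; apply/eqP; apply: contraTT xM => px.
have [_ [_ supp _ _ _] _ _] := sp j.
rewrite -leNgt; apply: enorm_le => [|i]; first by rewrite addr_ge0.
by apply: le_trans (supp _ px i) _; rewrite lerD2r.
Qed.

Lemma part_i n (gam : R) : -1 <= gam < 0 -> exists u : n.+1.-tuple R -> R,
  [/\ smooth u, Wdot11 u, rapidly_decreasing u &
      ((lam%:E * nu gam (Elg u lam gam))%E @[lam --> (0 : R)^'+] --> +oo)%E].
Proof.
move=> hg; have [C C0 sp] := spike_exists n hg.
(* M is chosen so that [lam j.+1 * M j] = j. *)
pose lam j := height C j; pose M j := j%:R / lam j.+1.
have lam0 j : 0 < lam j by exact: height_gt0.
have /choice[phi /choice[D /choice[k spk]]] : forall j, exists phi D k,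
    @spike R n gam (lam j) (dyad j) j%:R (C * lam j) (M j) phi D k.
  (* The alternative C lam <= eps is taken because N + gam may be 0 here. *)
  by move=> j; apply: sp => //; [exact: dyad_gt0|exact: dyad_le1|right; exact: height_le].
have [i j t|K|u [Wu du lM]] := spike_sum (C := 1) spk lam0.
- have lt1 (a b : nat) : a%:R < t -> t < b%:R + dyad b -> (a <= b)%N.
    move=> a1 b2; rewrite -ltnS -(ltr_nat R) -natr1.
    by apply: lt_trans a1 _; apply: lt_le_trans b2 _; rewrite lerD2l dyad_le1.
  move=> /andP[i1 i2] /andP[j1 j2]; apply/eqP.
  by rewrite eqn_leq (lt1 i j)// (lt1 j i).
- exact: dyadic_sum.
have u1 : L1 u by case: Wu.
exists u; split.
- apply: (@smooth_slab_sum R n u D).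
  + by move=> j; have [[_ ? _ _] _ _ _] := spk j.
  + by move=> j; have [[_ _ ? _] _ _ _] := spk j.
  + by move=> j; have [[_ _ _ ?] _ _ _] := spk j.
  + by rewrite (_ : (fun j => _) = phi)//; apply/funext => j; have [[? _ _ _] _ _ _] := spk j.
- by case: Wu.
(* Spike j has |x_i| <= j + 1 on its support and is bounded by C [lam j]. *)
- move=> m; exists (Num.sqrt n.+1%:R ^+ m * (m%:R ^+ m + 1)) => x.
  have [j [-> _]] := du x.
  have [->|px] := eqVneq (phi j x) 0.
    by rewrite normr0 mulr0 mulr_ge0 ?exprn_ge0 ?sqrtr_ge0// addr_ge0// exprn_ge0.
  have [_ [bnd supp _ _ _] _ _] := spk j.
  have en : enorm x <= Num.sqrt n.+1%:R * j.+1%:R.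
    apply: enorm_le => // i; apply: le_trans (supp _ px i) _.
    by rewrite ger0_norm// natr1.
  apply: (@le_trans _ _ ((Num.sqrt n.+1%:R * j.+1%:R) ^+ m * (C * lam j))).
    apply: ler_pM => //; first by rewrite exprn_ge0// enorm_ge0.
    by rewrite lerXn2r// nnegrE ?enorm_ge0// mulr_ge0 ?sqrtr_ge0.
  rewrite exprMn -mulrA ler_wpM2l ?exprn_ge0 ?sqrtr_ge0//.
  exact: height_pow.
- apply: (nu_cvg_pinfty (lam := lam) (M := M)) => //.
  + exact: L1_measurable.
  + by move=> j; exact: heightS.
  + by move=> d; exact: height_cvg.
  + by move=> j; rewrite /M mulrC divfK// gt_eqF.
Qed.

Lemma dyad_norm j : `|dyad j| <= 1 :> R.
Proof. by rewrite gtr0_norm ?dyad_gt0// dyad_le1. Qed.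

Lemma part_ii_exists n (gam : R) : -1 <= gam < 0 -> exists u : n.+1.-tuple R -> R,
  [/\ W11 u, compact_supp u &
      ((lam%:E * nu gam (Elg u lam gam))%E @[lam --> (0 : R)^'+] --> +oo)%E].
Proof.
move=> hg; have [C C0 sp] := spike_exists n hg.
pose lam j := height C j; pose M j := j%:R / lam j.+1.
have lam0 j : 0 < lam j by exact: height_gt0.
have /choice[phi /choice[D /choice[k spk]]] : forall j, exists phi D k,
    @spike R n gam (lam j) (dyad j) (dyad j) (C * lam j) (M j) phi D k.
  by move=> j; apply: sp => //; [exact: dyad_gt0|exact: dyad_le1|right; exact: height_le].
have [i j t|K|u [Wu du lM]] := spike_sum (C := 1) spk lam0.
- exact: dyadic_slabs.
- exact: dyadic_sum.
have u1 : L1 u by case: Wu.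
exists u; split=> //; first exact: (spike_sum_supp spk du dyad_norm).
apply: (nu_cvg_pinfty (lam := lam) (M := M)) => //.
- exact: L1_measurable.
- by move=> j; exact: heightS.
- by move=> d; exact: height_cvg.
- by move=> j; rewrite /M mulrC divfK// gt_eqF.
Qed.

(** Since N + gam > 0, the levels may tend to infinity together with the masses; a fixed level l
    lies below almost all of them, so nu(E_l) exceeds every bound. *)
Lemma part_iii_exists n (gam : R) : -1 <= gam < 0 -> 0 < n.+1%:R + gam ->
  exists u : n.+1.-tuple R -> R,
  [/\ W11 u, compact_supp u & forall lam : R, 0 < lam -> nu gam (Elg u lam gam) = +oo%E].
Proof.
move=> hg hng; have [C C0 sp] := spike_exists n hg.
pose lam j : R := j.+1%:R.
have lam0 j : 0 < lam j by rewrite ltr0n.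
have /choice[phi /choice[D /choice[k spk]]] : forall j, exists phi D k,
    @spike R n gam (lam j) (dyad j) (dyad j) (C * lam j) j%:R phi D k.
  by move=> j; apply: sp => //; [exact: dyad_gt0|exact: dyad_le1|left].
have [i j t|K|u [Wu du lM]] := spike_sum (C := 1) spk lam0.
- exact: dyadic_slabs.
- exact: dyadic_sum.
have u1 : L1 u by case: Wu.
exists u; split=> //; first exact: (spike_sum_supp spk du dyad_norm).
move=> l l0; apply/eqyP => A A0.
have [j hj] := nat_above (Num.max l A).
move: hj; rewrite ge_max => /andP[lj Aj].
apply: (@le_trans _ _ (j%:R)%:E); first by rewrite lee_fin.
apply: le_trans (lM j) _; apply: le_nu; first exact: L1_measurable.
by apply: le_trans lj _; rewrite ler_nat.
Qed.

(** A finite limsup gives a bound on some interval (0, 1/(m + 1)), with m enlarged to serve as the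
    bound too; so countably many sets suffice. *)
Lemma part_ii_meager n (gam : R) : -1 <= gam < 0 ->
  W11_meager [set u : n.+1.-tuple R -> R | W11 u /\
    exists C : R, \forall lam \near (0 : R)^'+, (lam%:E * nu gam (Elg u lam gam) <= C%:E)%E].
Proof.
move=> hg; have [C C0 sp] := spike_exists n hg.
exists (fun m => [set u | W11 u /\ forall lam : R, 0 < lam < m.+1%:R^-1 ->
  (lam%:E * nu gam (Elg u lam gam) <= m%:R%:E)%E]); split.
  move=> m; apply: (W11_nowhere_dense_spikes hg) => eps /andP[eps0 eps1].
  (* 1/(m + 2) puts the level strictly inside the range of the m-th set; the other term makes a
     spike at level 4 lam cost at most eps. *)
  pose lam := Num.min (m.+2%:R^-1) (eps / (4 * C)).
  have lam0 : 0 < lam by rewrite lt_min invr_gt0 ltr0n divr_gt0// mulr_gt0.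
  have lamm : lam < m.+1%:R^-1.
    apply: (@le_lt_trans _ _ m.+2%:R^-1); first by rewrite ge_min lexx.
    by rewrite ltf_pV2 ?posrE ?ltr0n// ltr_nat.
  have lamC : C * (4 * lam) <= eps.
    have : lam <= eps / (4 * C) by rewrite ge_min lexx orbT.
    by rewrite ler_pdivlMr ?mulr_gt0// => h; rewrite mulrCA mulrA mulrC.
  exists lam, (lam^-1 * m%:R); split=> //.
    move=> w [_ /(_ lam)]; rewrite lam0 lamm => /(_ isT) h.
    have -> : nu gam (Elg w lam gam) = ((lam^-1)%:E * (lam%:E * nu gam (Elg w lam gam)))%E.
      by rewrite muleA -EFinM mulVf ?mul1e// gt_eqF.
    by rewrite EFinM; apply: lee_wpmul2l => //; rewrite lee_fin invr_ge0 ltW.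
  move=> M; exists (C * (4 * lam)); apply: sp => //; first by rewrite mulr_gt0.
  by right.
move=> u [Wu [A]].
move=> /nbhs_ballP[e /= e0 He].
have [m hm] := nat_above (Num.max A e^-1).
move: hm; rewrite ge_max => /andP[Am em].
exists m => //; split=> // lam /andP[l0 lm].
apply: (@le_trans _ _ A%:E); last by rewrite lee_fin.
apply: He => //; rewrite /ball/= sub0r normrN gtr0_norm//.
apply: lt_le_trans lm _; rewrite -[e]invrK lef_pV2 ?posrE ?invr_gt0 ?ltr0n//.
by apply: le_trans em _; rewrite ler_nat.
Qed.

(** By monotonicity in the level, one integer m can dominate both the level and the value of [nu].
    The fixed level m + 1 is not small, which is where N + gam > 0 enters. *)
Lemma part_iii_meager n (gam : R) : -1 <= gam < 0 -> 0 < n.+1%:R + gam ->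
  W11_meager [set u : n.+1.-tuple R -> R | W11 u /\
    exists lam : R, 0 < lam /\ (nu gam (Elg u lam gam) < +oo)%E].
Proof.
move=> hg hng; have [C C0 sp] := spike_exists n hg.
exists (fun m => [set u | W11 u /\ (nu gam (Elg u m.+1%:R gam) <= m%:R%:E)%E]); split.
  move=> m; apply: (W11_nowhere_dense_spikes hg) => eps /andP[eps0 eps1].
  exists m.+1%:R, m%:R; split=> //; first by move=> w [].
  move=> M; exists (C * (4 * m.+1%:R)); apply: sp => //.
  by left.
move=> u [Wu [lam [lam0 fin]]].
have nu0 : (0 <= nu gam (Elg u lam gam))%E.
  by rewrite nuE; apply: tint_ge0 => x; apply: tint_ge0 => y; rewrite lee_fin nuk_ge0.
have ff : nu gam (Elg u lam gam) \is a fin_num by rewrite ge0_fin_numE.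
have [m hm] := nat_above (Num.max lam (fine (nu gam (Elg u lam gam)))).
move: hm; rewrite ge_max => /andP[lm fm].
exists m => //; split=> //; apply: (@le_trans _ _ (nu gam (Elg u lam gam))).
  apply: le_nu; first by case: Wu => [[]].
  by apply: le_trans lm _; rewrite ler_nat.
by rewrite -(fineK ff) lee_fin.
Qed.

End Parts.

Unset Implicit Arguments.
Theorem theorem1p8 (R : realType) (N : nat) : (1 <= N)%N ->
  (* (i) *)
  (forall gam : R, -1 <= gam < 0 ->
    exists u : N.-tuple R -> R,
      [/\ smooth u, Wdot11 u, rapidly_decreasing u &
          ((lam%:E * nu gam (Elg u lam gam))%E @[lam --> 0^'+] --> +oo)%E]) /\
  (* (ii) *)
  (forall gam : R, -1 <= gam < 0 ->
    (exists u : N.-tuple R -> R,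
      [/\ W11 u, compact_supp u &
          ((lam%:E * nu gam (Elg u lam gam))%E @[lam --> 0^'+] --> +oo)%E]) /\
    W11_meager [set u : N.-tuple R -> R | W11 u /\
       exists C : R, \forall lam \near 0^'+, (lam%:E * nu gam (Elg u lam gam) <= C%:E)%E]) /\
  (* (iii) *)
  (forall gam : R, (-1 <= gam < 0 /\ (2 <= N)%N) \/ (-1 < gam < 0 /\ N = 1%N) ->
    (exists u : N.-tuple R -> R,
      [/\ W11 u, compact_supp u & forall lam : R, 0 < lam -> nu gam (Elg u lam gam) = +oo%E]) /\
    W11_meager [set u : N.-tuple R -> R | W11 u /\
       exists lam : R, 0 < lam /\ (nu gam (Elg u lam gam) < +oo)%E]).
Proof.
case: N => // n _; split; last split.
- by move=> gam; exact: part_i.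
- by move=> gam hg; split; [exact: part_ii_exists|exact: part_ii_meager].
move=> gam hg.
(* Both alternatives amount to N + gam > 0; the excluded case N = 1, gam = -1 is the one where it
   vanishes. *)
have [hg1 hng] : -1 <= gam < 0 /\ 0 < n.+1%:R + gam.
  case: hg => [[/andP[g1 g0] n1]|[/andP[g1 g0] n1]].
    have n2 : 2 <= n.+1%:R :> R by rewrite ler_nat.
    by split; [rewrite g1|lra].
  by split; [rewrite (ltW g1)|rewrite n1; lra].
by split; [exact: part_iii_exists|exact: part_iii_meager].
Qed.
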